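(* Let $m>2$ and let $\eta_\varepsilon$, $\varepsilon>0$, be the kernels on the one-dimensional torus $\mathbb{S}^1=\mathbb{R}/\mathbb{Z}$ given by $\eta_\varepsilon(x)=\sum_{k\in\mathbb{Z}}\tilde\eta_\varepsilon(x-k)$, where $\tilde\eta_\varepsilon(x)=\frac1\varepsilon\tilde\eta(x/\varepsilon)$ and $\tilde\eta(x)=\frac{m-1}{2(1+|x|)^m}$ for $x\in\mathbb{R}$. There exists $K>0$, depending only on $m$, such that for any $u\in L^1(\mathbb{S}^1)$ whose positive part $u_+$ belongs to $H^1(\mathbb{S}^1)\cap L^\infty(\mathbb{S}^1)$, every $c>0$ and every $\varepsilon>0$, setting $u_\varepsilon:=\eta_\varepsilon*u$, $$\|((u_\varepsilon-c)_+)'\|_{L^2}\le K\,\frac{\|u_+\|_{L^\infty}}{c}\,\|(u_+)'\|_{L^2}.$$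
   Context: $u_+=\max\{u,0\}$ denotes the positive part, and $*$ is convolution on the torus $\mathbb{S}^1$. *)

(* Defs.v *)
From HB Require Import structures.
From mathcomp Require Import all_boot all_order all_algebra.
From mathcomp Require Import all_classical all_reals all_analysis.

Set Implicit Arguments.
Unset Strict Implicit.
Unset Printing Implicit Defensive.

Import Order.TTheory GRing.Theory Num.Theory.
Import numFieldNormedType.Exports.

Local Open Scope classical_set_scope.
Local Open Scope ring_scope.

(* Functions on the torus R/Z are represented by 1-periodic functions on R;
   integrals over the torus are taken over the fundamental domain [0, 1[. *)

Definition torus_measure (R : realType) : {measure set (measurableTypeR R) -> \bar R} :=
  mrestr (@lebesgue_measure R) (measurable_itv `[(0 : R), (1 : R)[).

Definition torus_Lp (R : realType) (p : \bar R) : set (R -> R) :=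
  [set f | periodic f 1 /\ f \in Lfun (torus_measure R) p].

Definition torus_Lnorm (R : realType) (p : \bar R) (f : R -> R) : \bar R :=
  ('N[torus_measure R]_p[EFin \o f])%E.

Definition torus_smooth (R : realType) : set (R -> R) :=
  [set phi : R -> R | periodic phi 1 /\
             forall (n : nat) (x : R), derivable (derive1n n phi) x 1].

Definition is_weak_derivative (R : realType) (f g : R -> R) : Prop :=
  [/\ torus_Lp 1%E f, torus_Lp 1%E g &
      forall phi : R -> R, torus_smooth phi ->
        \int[torus_measure R]_x (f x * derive1 phi x) =
        - \int[torus_measure R]_x (g x * phi x)].

Definition torus_H1 (R : realType) : set (R -> R) :=
  [set f | torus_Lp 2%:E f /\
           exists g : R -> R, is_weak_derivative f g /\ torus_Lp 2%:E g].

Definition profile (R : realType) (m x : R) : R :=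
  (m - 1) / (2 * (1 + `|x|) `^ m).

Definition scaled_profile (R : realType) (m eps x : R) : R :=
  eps^-1 * profile m (x / eps).

Definition torus_kernel (R : realType) (m eps x : R) : R :=
  fine (\esum_(k in [set: int]) (scaled_profile m eps (x - k%:~R))%:E).

Definition torus_convolution (R : realType) (f g : R -> R) (x : R) : R :=
  \int[torus_measure R]_y (f (x - y) * g y).

(* Main.v *)
(** For a 1-periodic function the convolution with the torus kernel is the
    convolution on the line with p(r) = (m-1)/2 eps^(m-1) (eps + |r|)^(-m), so
    u_eps is C^1 with derivative p' * u, and |p'| <= m p / (eps + |r|).
    Almost everywhere u = v - n, where v >= 0 is the absolutely continuous
    representative of u_+ and n >= 0 vanishes off the zero set Z of v.  Put
    f = |(u_+)'|.  At a point x with u_eps(x) > 0 the n-mass (p * n)(x) is at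
    most (p * v)(x) <= v(x) + (p * |v - v(x)|)(x), and v(x) is at most the
    integral of f over the ball of radius d(x) + eps/2, where d = dist(., Z).
    Since n is supported at distance at least d(x) from x,
      |u_eps'(x)| <= 2 m eps^(m-2) int (eps + |x-t|)^(1-m) f(t) dt
                     + m (eps + d(x))^(-1) int_(|x-t| <= d(x) + eps/2) f(t) dt.
    Both operators are bounded on L^2 of the torus by Schur's test, with norms
    depending only on m; the factor ||u_+||_oo / c is free, because it is at
    least 1 as soon as u_eps exceeds c somewhere. *)

Require Import Defs.
From HB Require Import structures.
From mathcomp Require Import all_boot all_order all_algebra.
From mathcomp Require Import all_classical all_reals all_analysis.
From mathcomp Require Import measurable_realfun ess_sup_inf ring lra.

Import Order.TTheory GRing.Theory Num.Theory.
Import numFieldNormedType.Exports.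

Local Open Scope classical_set_scope.
Local Open Scope ring_scope.

Set Implicit Arguments.
Unset Strict Implicit.
Unset Printing Implicit Defensive.

(** * Periodic functions and integrals over the torus *)

(** The obstacle is that the negative part is merely integrable, so the term [p' * n] cannot be
    estimated on its own; its mass is controlled by that of [v] only where [u_eps] is positive. The
    oscillation of [v] is harmless because [p'] is odd, so that [v(x)] may be subtracted. The slack
    [eps / 2] in the radius gives a zero of [v] in the ball without asking that the distance be
    attained; being less than [eps], it also keeps the lower bound [eps + d(x) - |x - t|] for the
    1-Lipschitz function [eps + d] positive on that ball. The kernel [(eps + |r|)^(1-m)] has finite
    mass of order [eps^(2-m)] because [m > 2], and this cancels the prefactor [eps^(m-2)]: the
    constant is free of [eps]. Since weak derivatives are given only by testing against smooth
    periodic functions, the representative [v] comes from a du Bois-Reymond argument with an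
    explicit family of test functions. *)

Section LebesgueInvariance.
Context {R : realType}.
Notation mu := (@lebesgue_measure R).
Notation mR := (measurableTypeR R).
Implicit Types (a b s x y : R).

Lemma lebesgue_measure_translate a (A : set mR) : measurable A ->
  pushforward mu ((fun x => x + a) : mR -> mR) A = mu A.
Proof.
have mt : measurable_fun setT ((fun x => x + a) : mR -> mR).
  exact: measurable_funD.
move=> mA; apply/esym.
pose HB_mt := isMeasurableFun.Build _ _ _ _ _ mt.
pose t : {mfun mR >-> mR} := HB.pack ((fun x => x + a) : mR -> mR) HB_mt.
apply: (@lebesgue_measure_unique R (pushforward mu t)) => //= _ [[c d] /= cd] <-.
rewrite /pushforward.
have -> : t @^-1` `]c, d] = [set` `](c - a), (d - a)]].
  by apply/seteqP; split=> x /=; rewrite !in_itv/= ltrBlDr lerBrDr.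
rewrite !lebesgue_measure_itv/= !lte_fin ltrD2r.
by case: ifP => // _; rewrite -!EFinB; congr (_%:E); ring.
Qed.

Local Open Scope ereal_scope.

Lemma ge0_integral_translate a (f : R -> \bar R) :
  measurable_fun [set: R] f -> (forall x, 0 <= f x) ->
  \int[mu]_x f (x + a)%R = \int[mu]_x f x.
Proof.
move=> mf f0.
have mt : measurable_fun setT ((fun x => x + a)%R : mR -> mR).
  exact: measurable_funD.
transitivity (\int[pushforward mu ((fun x => x + a)%R : mR -> mR)]_x f x).
  by rewrite ge0_integral_pushforward//.
by apply: eq_measure_integral => A mA _; exact: lebesgue_measure_translate.
Qed.

Lemma ge0_integral_reflect (f : R -> \bar R) :
  measurable_fun [set: R] f -> (forall x, 0 <= f x) ->
  \int[mu]_x f (- x)%R = \int[mu]_x f x.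
Proof.
move=> mf f0.
have mt : measurable_fun setT (-%R : mR -> mR) by [].
transitivity (\int[pushforward mu (-%R : mR -> mR)]_x f x).
  by rewrite ge0_integral_pushforward//.
by apply: eq_measure_integral => A mA _; exact: lebesgue_measureN.
Qed.

Lemma ge0_integral_sub a (f : R -> \bar R) :
  measurable_fun [set: R] f -> (forall x, 0 <= f x) ->
  \int[mu]_x f (a - x)%R = \int[mu]_x f x.
Proof.
move=> mf f0.
rewrite -(ge0_integral_translate a mf f0).
rewrite -(@ge0_integral_reflect (fun x => f (x + a)%R))//.
  by apply: eq_integral => x _; rewrite addrC.
by apply: measurableT_comp => //; exact: measurable_funD.
Qed.

Lemma ge0_integral_itv_translate a (b c : R) (f : R -> \bar R) :
  measurable_fun [set: R] f -> (forall x, 0 <= f x) ->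
  \int[mu]_(x in `[b, c[) f (x + a)%R = \int[mu]_(x in `[(b + a)%R, (c + a)%R[) f x.
Proof.
move=> mf f0; rewrite integral_mkcond [RHS]integral_mkcond.
rewrite -[RHS](ge0_integral_translate a).
- apply: eq_integral => x _; rewrite /patch.
  by rewrite !mem_setE !in_itv/= lerD2r ltrD2r.
- apply: (iffLR (measurable_restrictT f (measurable_itv _))).
  exact: measurable_funTS.
- by move=> x; rewrite /patch; case: ifP.
Qed.

End LebesgueInvariance.

Section Periodic.
Context {R : realType}.
Notation mu := (@lebesgue_measure R).
Notation mR := (measurableTypeR R).
Local Open Scope ereal_scope.

Lemma periodic_int (U : Type) (f : R -> U) :
  (forall x, f (x + 1)%R = f x) -> forall (k : int) x, f (x + k%:~R)%R = f x.
Proof.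
move=> pf.
have pn (n : nat) x : f (x + n%:R)%R = f x.
  elim: n x => [|n IH] x; first by rewrite addr0.
  by rewrite -natr1 addrA pf.
case=> n x; first exact: pn.
by rewrite NegzE mulrNz -[LHS](pn n.+1) subrK.
Qed.

Lemma ge0_integral_itv_split (a b c : R) (f : R -> \bar R) :
  (a <= b)%R -> (b <= c)%R ->
  measurable_fun [set: R] f -> (forall x, 0 <= f x) ->
  \int[mu]_(x in `[a, c[) f x =
  \int[mu]_(x in `[a, b[) f x + \int[mu]_(x in `[b, c[) f x.
Proof.
move=> ab bc mf f0.
have -> : [set` `[a, c[] = [set` `[a, b[] `|` [set` `[b, c[].
  by rewrite -itv_bndbnd_setU// bnd_simp.
rewrite ge0_integral_setU//.
- exact: measurable_funS mf.
- apply/disj_setPS => x /=; rewrite !in_itv/= => -[/andP[_ xb] /andP[bx _]].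
  by move: (lt_le_trans xb bx); rewrite ltxx.
Qed.

Lemma ge0_integral_periodic (s : R) (h : R -> \bar R) :
  measurable_fun [set: R] h -> (forall x, 0 <= h x) ->
  (forall x, h (x + 1)%R = h x) ->
  \int[mu]_(x in `[s, (s + 1)%R[) h x = \int[mu]_(x in `[0%R, 1%R[) h x.
Proof.
move=> mh h0 ph.
(* The integer [n + 1] cuts [[s, s + 1[] into two pieces; integer translations send them to [[s - n,
   1[] and [[0, s - n[], which tile [[0, 1[]. *)
set n := Num.floor s.
have ns : (n%:~R <= s)%R by exact: floor_le_tmp.
have sn : (s < n%:~R + 1)%R by rewrite -[1%R]/(1%:~R) -intrD; exact: floorD1_gt.
have trans (k : int) b c : \int[mu]_(x in `[b, c[) h x =
    \int[mu]_(x in `[(b + k%:~R)%R, (c + k%:~R)%R[) h x.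
  rewrite -(ge0_integral_itv_translate _ _ _ mh h0).
  by apply: eq_integral => x _; rewrite periodic_int.
rewrite (@ge0_integral_itv_split s (n%:~R + 1)%R)//; [|lra|lra].
rewrite (trans (- n)%R) [X in _ + X](trans (- (n + 1))%R).
rewrite (_ : n%:~R + 1 + (- n)%:~R = 1)%R; last by rewrite mulrNz; ring.
rewrite (_ : n%:~R + 1 + (- (n + 1))%:~R = 0)%R; last first.
  by rewrite mulrNz intrD; ring.
rewrite (_ : s + 1 + (- (n + 1))%:~R = s + (- n)%:~R)%R; last first.
  by rewrite !mulrNz intrD; ring.
rewrite addeC -ge0_integral_itv_split//; rewrite mulrNz; lra.
Qed.

Lemma ge0_integral_periodic_translate (s : R) (h : R -> \bar R) :
  measurable_fun [set: R] h -> (forall x, 0 <= h x) ->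
  (forall x, h (x + 1)%R = h x) ->
  \int[mu]_(x in `[0%R, 1%R[) h (x + s)%R = \int[mu]_(x in `[0%R, 1%R[) h x.
Proof.
move=> mh h0 ph; rewrite (ge0_integral_itv_translate _ _ _ mh h0) add0r addrC.
exact: ge0_integral_periodic.
Qed.

(** The enumeration 0, -1, 1, -2, 2, ... turns sums over the integers into series, to which monotone
    convergence applies. *)
Definition int_of_nat_zigzag (n : nat) : int :=
  if odd n then Negz n./2 else Posz n./2.

Lemma int_of_nat_zigzag_bij :
  set_bij [set: nat] [set: int] int_of_nat_zigzag.
Proof.
split=> //.
- move=> n1 n2 _ _; rewrite /int_of_nat_zigzag.
  case: ifPn => o1; case: ifPn => o2 // [e];
  rewrite -(odd_double_half n1) -(odd_double_half n2) e ?o1 ?o2 //.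
  by rewrite (negbTE o1) (negbTE o2).
- move=> [n|n] _ /=.
  + by exists n.*2 => //; rewrite /int_of_nat_zigzag odd_double doubleK.
  + exists n.*2.+1 => //.
    by rewrite /int_of_nat_zigzag/= odd_double/= uphalf_double.
Qed.

Lemma esum_int_nneseries (a : int -> \bar R) : (forall k, 0 <= a k) ->
  \esum_(k in [set: int]) a k = \sum_(n <oo) a (int_of_nat_zigzag n).
Proof.
move=> a0; rewrite (reindex_esum _ _ _ _ int_of_nat_zigzag_bij).
by rewrite nneseries_esumT.
Qed.

Lemma measurable_esum_int (a : int -> R -> \bar R) :
  (forall k, measurable_fun [set: R] (a k)) -> (forall k x, 0 <= a k x) ->
  measurable_fun [set: R] (fun x => \esum_(k in [set: int]) a k x).
Proof.
move=> ma a0; under eq_fun do rewrite esum_int_nneseries//.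
by apply: ge0_emeasurable_sum.
Qed.

(** The intervals [[k, k + 1[] tile the line; translating each of them to [[0, 1[] is the passage
    from the line to the torus. *)
Lemma ge0_integral_unfold (h : R -> \bar R) :
  measurable_fun [set: R] h -> (forall x, 0 <= h x) ->
  \int[mu]_x h x =
  \int[mu]_(x in `[0%R, 1%R[) \esum_(k in [set: int]) h (x + k%:~R)%R.
Proof.
move=> mh h0.
pose e (n : nat) : R := (int_of_nat_zigzag n)%:~R.
under [RHS]eq_integral do rewrite esum_int_nneseries//.
rewrite integral_nneseries//; last first.
  move=> n; apply: measurable_funTS; apply: measurableT_comp => //.
  exact: measurable_funD.
have cover : \bigcup_n [set` `[e n, (e n + 1)%R[] = [set: R].
  apply/seteqP; split=> // x _.
  have [_ _ /(_ (Num.floor x) Logic.I)[n _ en]] := int_of_nat_zigzag_bij.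
  exists n => //=; rewrite in_itv/= /e en.
  rewrite floor_le_tmp/= -[1%R]/(1%:~R) -intrD; exact: floorD1_gt.
rewrite -cover ge0_integral_bigcup//.
- apply: eq_eseriesr => n _.
  rewrite (addrC (e n) 1%R) -[X in `[X, _[](add0r (e n)).
  by rewrite -(ge0_integral_itv_translate _ _ _ mh h0).
- by rewrite cover.
- apply/trivIsetP => i j _ _ ij; rewrite -subset0 => x /=.
  rewrite !in_itv/= => -[/andP[ix xi] /andP[jx xj]].
  have [_ inj _] := int_of_nat_zigzag_bij.
  move: ij; apply/negP; rewrite negbK; apply/eqP.
  apply: inj; rewrite ?inE//.
  have: (e i < e j + 1)%R by lra.
  have: (e j < e i + 1)%R by lra.
  rewrite /e -[X in (_ < _ + X)%R -> (_ < _ + X)%R -> _]/(1%:~R) -!intrD !ltr_int !ltzD1 => ji ij.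
  by apply/eqP; rewrite eq_le ij ji.
Qed.

End Periodic.

Section TorusMeasure.
Context {R : realType}.
Notation mu := (@lebesgue_measure R).
Notation tm := (torus_measure R).
Local Open Scope ereal_scope.

Lemma torus_measureC : tm (~` [set` `[0%R, 1%R[]) = 0.
Proof. by rewrite /torus_measure/= /mrestr setICl measure0. Qed.

Lemma torus_measureT : tm [set: R] = 1.
Proof.
rewrite /torus_measure/= /mrestr setTI lebesgue_measure_itv/= lte_fin ltr01.
by rewrite oppr0 addr0.
Qed.

Lemma integral_torus (f : R -> \bar R) : measurable_fun [set: R] f ->
  \int[tm]_x f x = \int[mu]_(x in `[0%R, 1%R[) f x.
Proof.
have ge0 g : measurable_fun [set: R] g -> (forall x, 0 <= g x) ->
    \int[tm]_x g x = \int[mu]_(x in `[0%R, 1%R[) g x.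
  move=> mg g0.
  rewrite -(setvU [set` `[0%R, 1%R[]) ge0_integral_setU//.
  - rewrite [X in X + _](_ : _ = 0) ?add0e.
      apply: eq_measure_integral => A mA AI.
      by rewrite /= /torus_measure/= /mrestr; congr (mu _); exact/setIidPl.
    rewrite (@null_set_integral _ _ _ tm)//.
    + exact: measurableC.
    + exact: measurable_funS mg.
    + exact: torus_measureC.
  - exact: measurableC.
  - exact: measurable_funS mg.
  - by apply/disj_setPS => x [].
move=> mf; rewrite integralE [RHS]integralE !ge0//.
- exact: measurable_funeneg.
- exact: measurable_funepos.
Qed.

Lemma torus_integrableP (f : R -> \bar R) : measurable_fun [set: R] f ->
  tm.-integrable [set: R] f <-> mu.-integrable [set` `[0%R, 1%R[] f.
Proof.
move=> mf; split=> /integrableP[_ lf]; apply/integrableP; split=> //.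
- exact: measurable_funS mf.
- by rewrite -integral_torus//; exact: measurableT_comp.
- by rewrite integral_torus//; exact: measurableT_comp.
Qed.

Lemma Rintegral_torus (f : R -> R) : measurable_fun [set: R] f ->
  (\int[tm]_x f x = \int[mu]_(x in `[0%R, 1%R[) f x)%R.
Proof.
by move=> mf; rewrite /Rintegral integral_torus//; exact/measurable_EFinP.
Qed.

End TorusMeasure.

(** * Schur's test *)

Section PowerIntegrals.
Context {R : realType}.
Notation mu := (@lebesgue_measure R).

Lemma powR_cvgy0 (r : R) : 0 < r -> y `^ (- r) @[y --> +oo] --> (0 : R).
Proof.
move=> r0; apply/cvgrPdist_le => e e0.
near=> y.
have y0 : 0 < y by near: y; exact: nbhs_pinfty_gt.
rewrite sub0r normrN ger0_norm ?powR_ge0// powRN invf_ple ?posrE ?powR_gt0//.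
have -> : e^-1 = (e^-1 `^ r^-1) `^ r.
  by rewrite -powRrM mulVf ?gt_eqF// powRr1// invr_ge0 ltW.
apply: ge0_ler_powR; rewrite ?nnegrE ?powR_ge0 ?ltW//.
Unshelve. all: by end_near. Qed.

Lemma is_derive_powR (r y : R) : 0 < y ->
  is_derive y 1 (@powR R ^~ r) (r * y `^ (r - 1)).
Proof.
move=> y0; apply: DeriveDef.
  by apply: derivable_powR; rewrite in_itv/= y0.
by rewrite -derive1E powR_derive1// in_itv/= y0.
Qed.

Lemma continuous_powR (r y : R) : 0 < y -> {for y, continuous (@powR R ^~ r)}.
Proof.
move=> y0; apply/differentiable_continuous/derivable1_diffP.
exact: (@ex_derive _ _ _ _ _ _ _ (is_derive_powR r y0)).
Qed.

Lemma integral_powR_tail (q a : R) : 1 < q -> 0 < a ->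
  (\int[mu]_(y in `[a, +oo[) (y `^ (- q))%:E = (a `^ (1 - q) / (q - 1))%:E)%E.
Proof.
move=> q1 a0.
pose F (y : R) := - (q - 1)^-1 * y `^ (1 - q).
have dF (y : R) : 0 < y -> is_derive y 1 F (y `^ (- q)).
  move=> y0; have ? := is_derive_powR (1 - q) y0.
  rewrite /F; apply: is_derive_eq.
  rewrite (_ : 1 - q - 1 = - q); last ring.
  rewrite /GRing.scale/= mulrA (_ : - (q - 1)^-1 * (1 - q) = 1) ?mul1r//.
  by field; lra.
have cF (y : R) : 0 < y -> {for y, continuous F}.
  move=> y0; apply/differentiable_continuous/derivable1_diffP.
  exact: (@ex_derive _ _ _ _ _ _ _ (dF _ y0)).
rewrite (@ge0_continuous_FTC2y _ _ F a 0)//.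
- rewrite sub0e -EFinN; congr (_%:E); rewrite /F; field; lra.
- by move=> x _; exact: powR_ge0.
- apply/continuous_within_itvcyP; split.
    move=> x; rewrite in_itv/= andbT => ax.
    exact: continuous_powR (lt_trans a0 ax).
  apply: cvg_at_right_filter; exact: continuous_powR.
- rewrite -[X in _ --> X](mulr0 (- (q - 1)^-1)).
  apply: cvgMr; rewrite (_ : 1 - q = - (q - 1)); last ring.
  by apply: powR_cvgy0; lra.
- move=> x ax; exact: (@ex_derive _ _ _ _ _ _ _ (dF _ (lt_trans a0 ax))).
- apply: cvg_at_right_filter; exact: cF.
- move=> x; rewrite in_itv/= andbT => ax; rewrite derive1E.
  exact: (@derive_val _ _ _ _ _ _ _ (dF _ (lt_trans a0 ax))).
Qed.

Lemma measurable_fun_powR_comp d (T : measurableType d) (r : R) (f : T -> R) :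
  measurable_fun [set: T] f -> measurable_fun [set: T] (fun x => f x `^ r).
Proof. by move=> mf; exact: (measurableT_comp (measurable_powR r)). Qed.

(** The even integrand is compared with the sum of a half-line function and its reflection. Both
    count at the origin, so the pointwise comparison is an inequality. *)
Lemma integral_radial_le (g : R -> R) (P : R -> bool) :
  measurable_fun [set: R] g -> (forall x, 0 <= g x) ->
  measurable_fun [set: R] P ->
  (\int[mu]_r (if P `|r| then g `|r| else 0)%:E <=
   2%:E * \int[mu]_(r in `[0%R, +oo[) (if P r then g r else 0)%:E)%E.
Proof.
move=> mg g0 mP.
pose h (r : R) := if (0 <= r) && P r then g r else 0.
have mh : measurable_fun [set: R] h.
  apply: measurable_fun_ifT => //; apply: measurable_and => //.
  exact: measurable_fun_ler.
have h0 r : 0 <= h r by rewrite /h; case: ifP.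
have hE : (\int[mu]_(r in `[0%R, +oo[) (if P r then g r else 0)%:E =
           \int[mu]_r (h r)%:E)%E.
  rewrite integral_mkcond; apply: eq_integral => r _.
  by rewrite /patch mem_setE in_itv/= andbT /h; case: leP.
rewrite hE.
have -> : (2%:E * \int[mu]_r (h r)%:E =
           \int[mu]_r ((h r)%:E + (h (- r))%:E))%E.
  rewrite ge0_integralD//=; last 4 first.
  - by move=> x _; rewrite lee_fin.
  - exact/measurable_EFinP.
  - by move=> x _; rewrite lee_fin.
  - by apply/measurable_EFinP; exact: measurableT_comp.
  rewrite (@ge0_integral_reflect _ (EFin \o h))//; last exact/measurable_EFinP.
  by rewrite -[2%R]/(1 + 1)%R EFinD ge0_muleDl// ?mul1e.
apply: ge0_le_integral => //.
- by move=> x _; rewrite lee_fin; case: ifP.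
- apply/measurable_EFinP; apply: measurable_fun_ifT => //; exact: measurableT_comp.
- apply: emeasurable_funD; first exact/measurable_EFinP.
  by apply/measurable_EFinP; exact: measurableT_comp.
- move=> r _; rewrite -EFinD lee_fin.
  have [r0|r0] := leP 0 r.
    by rewrite ger0_norm// /h r0/=; case: ifP => // _; rewrite lerDl; case: ifP.
  rewrite ltr0_norm// {2}/h oppr_ge0 (ltW r0)/=.
  by case: ifP => // _; rewrite ?lerDr ?h0 ?addr_ge0.
Qed.

Lemma integral_radial_tail (q a rho : R) : 1 < q -> 0 < a -> 0 <= rho ->
  (\int[mu]_r (if rho <= `|r| then (a + `|r|) `^ (- q) else 0)%:E <=
   (2 * ((a + rho) `^ (1 - q) / (q - 1)))%:E)%E.
Proof.
move=> q1 a0 rho0.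
have mg (b : R) : measurable_fun [set: R] (fun r => (b + r) `^ (- q)).
  by apply: measurable_fun_powR_comp; exact: measurable_funD.
apply: (le_trans (@integral_radial_le (fun r => (a + r) `^ (- q))
   (fun r => rho <= r) _ _ _)) => //.
- by move=> x; exact: powR_ge0.
- exact: measurable_fun_ler.
rewrite EFinM lee_pmul2l//= -integral_powR_tail//; last by lra.
pose k (y : R) := if a + rho <= y then y `^ (- q) else 0.
have mk : measurable_fun [set: R] (EFin \o k).
  apply/measurable_EFinP; apply: measurable_fun_ifT => //.
  exact: measurable_fun_ler.
have k0 y : (0 <= (EFin \o k) y)%E.
  by rewrite lee_fin /k; case: ifP => // _; exact: powR_ge0.
rewrite [leRHS]integral_mkcond.
rewrite [leRHS](_ : _ = \int[mu]_y (EFin \o k) y)%E; last first.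
  by apply: eq_integral => y _; rewrite /patch mem_setE in_itv/= andbT /k/=; case: ifP.
rewrite -(ge0_integral_translate a mk k0).
rewrite integral_mkcond; apply: ge0_le_integral => //.
- move=> x _; rewrite /patch; case: ifP => // _; rewrite lee_fin.
  by case: ifP => // _; exact: powR_ge0.
- apply: (iffLR (measurable_restrictT _ (measurable_itv _))).
  apply: measurable_funTS; apply/measurable_EFinP; apply: measurable_fun_ifT => //.
  exact: measurable_fun_ler.
- apply: measurableT_comp => //; exact: measurable_funD.
- move=> x _; rewrite /patch; case: ifP => // _.
  by rewrite /= lee_fin /k (addrC x) lerD2l.
Qed.

(** The antiderivative [-2 (s - r)^(1/2)] stays bounded up to the singularity at [s], so the bound
    is uniform in [rho]; [rho < s] keeps the integrand continuous on the closed interval. *)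
Lemma integral_radial_core (s rho : R) : 0 <= rho -> rho < s ->
  (\int[mu]_r (if `|r| <= rho then (s - `|r|) `^ (- 2^-1) else 0)%:E <=
   (4 * s `^ (2^-1))%:E)%E.
Proof.
move=> rho0 rs.
have mg : measurable_fun [set: R] (fun r => (s - r) `^ (- 2^-1)).
  by apply: measurable_fun_powR_comp; exact: measurable_funB.
apply: (le_trans (@integral_radial_le (fun r => (s - r) `^ (- 2^-1))
   (fun r => r <= rho) _ _ _)) => //.
- by move=> x; exact: powR_ge0.
- exact: measurable_fun_ler.
rewrite (_ : 4 * s `^ 2^-1 = 2 * (2 * s `^ 2^-1)); last by rewrite mulrA -natrM.
rewrite EFinM lee_pmul2l//=.
rewrite [leLHS](_ : _ = \int[mu]_(r in `[0%R, rho]) ((s - r) `^ (- 2^-1))%:E)%E; last first.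
  rewrite integral_mkcond [RHS]integral_mkcond; apply: eq_integral => r _.
  by rewrite /patch !mem_setE !in_itv/= andbT; case: leP => //= _; case: leP.
have [->|rhoN0] := eqVneq rho 0.
  by rewrite set_itv1 integral_set1 lee_fin mulr_ge0// powR_ge0.
have {}rho0 : 0 < rho by rewrite lt_neqAle eq_sym rhoN0.
pose F (r : R) := - 2 * (s - r) `^ (2^-1).
have dF (r : R) : r < s -> is_derive r 1 F ((s - r) `^ (- 2^-1)).
  move=> rs'; have sr0 : 0 < s - r by lra.
  have ? := is_derive_powR (2^-1) sr0.
  have ? : is_derive r 1 (fun r : R => s - r) (- 1).
    by rewrite -[- 1]sub0r; apply: is_deriveB.
  have ? := @is_derive1_comp _ (@powR R ^~ 2^-1) (fun r : R => s - r) r _ _ _ _.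
  rewrite /F; apply: is_derive_eq.
  rewrite (_ : 2^-1 - 1 = - 2^-1); last by field.
  by rewrite /GRing.scale/=; field.
have cF (r : R) : r < s -> {for r, continuous F}.
  move=> ?; apply/differentiable_continuous/derivable1_diffP.
  exact: (@ex_derive _ _ _ _ _ _ _ (dF _ _)).
rewrite (@continuous_FTC2 _ _ F)//.
- rewrite -EFinB lee_fin /F subr0.
  by have := powR_ge0 (s - rho) 2^-1; lra.
- apply: continuous_in_subspaceT => r; rewrite inE/= in_itv/= => /andP[r0 rr].
  have sr0 : 0 < s - r by lra.
  apply: (@continuous_comp _ _ _ (fun r => s - r) (@powR R ^~ (- 2^-1))).
    by apply: continuousB; [exact: cst_continuous|exact: cvg_id].
  exact: continuous_powR.
- split.
  + move=> x; rewrite in_itv/= => /andP[x0 xr].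
    by apply: (@ex_derive _ _ _ _ _ _ _ (dF _ _)); lra.
  + by apply: cvg_at_right_filter; apply: cF; lra.
  + by apply: cvg_at_left_filter; apply: cF.
- move=> x; rewrite in_itv/= => /andP[x0 xr]; rewrite derive1E.
  by apply: (@derive_val _ _ _ _ _ _ _ (dF _ _)); lra.
Qed.

End PowerIntegrals.

Section SchurTest.
Context {R : realType}.
Notation mu := (@lebesgue_measure R).
Notation mR := (measurableTypeR R).

Lemma ge0_fubini_set (A : set mR) (F : mR * mR -> \bar R) : measurable A ->
  measurable_fun [set: mR * mR] F -> (forall p, (0 <= F p)%E) ->
  (\int[mu]_(x in A) \int[mu]_t F (x, t) =
   \int[mu]_t \int[mu]_(x in A) F (x, t))%E.
Proof.
move=> mA mF F0.
pose G := F \_ (A `*` [set: mR]).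
have mG : measurable_fun [set: mR * mR] G.
  apply: (iffLR (measurable_restrictT _ _)); first exact: measurableX.
  exact: measurable_funTS.
have G0 p : (0 <= G p)%E by rewrite /G /patch; case: ifP.
transitivity (\int[mu]_x \int[mu]_t G (x, t))%E.
  rewrite integral_mkcond; apply: eq_integral => x _.
  rewrite /patch /G; case: ifPn => xA.
    apply: eq_integral => t _; rewrite /patch mem_set//; split=> //=.
    by rewrite inE in xA.
  rewrite integral0_eq// => t _; rewrite /patch memNset//= => -[] /= xA' _.
  by move: xA; rewrite notin_setE.
rewrite (@fubini_tonelli _ _ _ _ _ mu mu G)//.
apply: eq_integral => t _; rewrite [RHS]integral_mkcond.
apply: eq_integral => x _; rewrite /patch /G /patch.
case: (boolP (x \in A)) => xA.
  by rewrite mem_set//; split=> //=; rewrite inE in xA.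
by rewrite memNset//= => -[] /= xA' _; move: xA; rewrite notin_setE.
Qed.

Lemma le_sqr_of_young (C Q : R) (X : \bar R) : 0 < C -> 0 <= Q -> (0 <= X)%E ->
  (forall l : R, 0 < l -> (X <= ((l * C + Q / l) / 2)%:E)%E) ->
  (X * X <= (C * Q)%:E)%E.
Proof.
move=> C0 Q0; case: X => [x| |] //; last by move=> _ /(_ _ ltr01).
rewrite lee_fin => x0 H; rewrite -EFinM lee_fin.
have [->|xN0] := eqVneq x 0; first by rewrite mul0r mulr_ge0// ltW.
have {}x0 : 0 < x by rewrite lt_neqAle eq_sym xN0.
(* The minimiser would be [sqrt (Q / C)], which is not admissible for [Q = 0]; the value [x / C]
   avoids it and gives [x <= x / 2 + C * Q / (2 * x)]. *)
have := H (x / C) (divr_gt0 x0 C0); rewrite lee_fin.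
rewrite divfK ?gt_eqF// ler_pdivlMr// invf_div => h.
have {}h : x <= Q * (C / x) by lra.
by move: h; rewrite mulrA ler_pdivlMr// (mulrC C).
Qed.

(** Young's inequality with a free parameter [l] is integrated first and optimised afterwards, so
    finiteness of the left integral is a consequence. An infinite right integral makes the claim
    trivial because [C > 0]. *)
Lemma ge0_integral_cauchy_schwarz (C : R) (k k1 k2 f : R -> R) : 0 < C ->
  measurable_fun [set: R] k -> measurable_fun [set: R] k1 ->
  measurable_fun [set: R] k2 -> measurable_fun [set: R] f ->
  (forall t, 0 <= k t) -> (forall t, 0 <= k1 t) -> (forall t, 0 <= k2 t) ->
  (forall t, 0 <= f t) -> (forall t, k t ^+ 2 <= k1 t * k2 t) ->
  (\int[mu]_t (k1 t)%:E <= C%:E)%E ->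
  ((\int[mu]_t (k t * f t)%:E) * (\int[mu]_t (k t * f t)%:E) <=
   C%:E * \int[mu]_t (k2 t * f t ^+ 2)%:E)%E.
Proof.
move=> C0 mk mk1 mk2 mf k0 k10 k20 f0 kk Hk1.
set X := (\int[mu]_t (k t * f t)%:E)%E.
set Q := (\int[mu]_t (k2 t * f t ^+ 2)%:E)%E.
have mQ : measurable_fun [set: R] (fun t => (k2 t * f t ^+ 2)%:E).
  by apply/measurable_EFinP; apply: measurable_funM => //; exact: measurable_funX.
have Qt0 t : (0 <= (k2 t * f t ^+ 2)%:E)%E.
  by rewrite lee_fin mulr_ge0// exprn_ge0.
have Q0 : (0 <= Q)%E by exact: integral_ge0.
have X0 : (0 <= X)%E by apply: integral_ge0 => t _; rewrite lee_fin mulr_ge0.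
have [Qoo|Qfin] := eqVneq Q +oo%E.
  by rewrite Qoo gt0_muley ?leey// lte_fin.
have {Qfin}Qfin : Q \is a fin_num by rewrite ge0_fin_numE// ltey.
rewrite -(fineK Qfin) -EFinM; apply: le_sqr_of_young => //.
  exact: fine_ge0.
move=> l l0.
have young t : k t * f t <= l / 2 * k1 t + (2 * l)^-1 * (k2 t * f t ^+ 2).
  set a := k1 t; set b := k2 t * f t ^+ 2.
  have a0 : 0 <= a by exact: k10.
  have b0 : 0 <= b by rewrite mulr_ge0// exprn_ge0.
  have y0 : 0 <= l / 2 * a + (2 * l)^-1 * b.
    by rewrite addr_ge0// mulr_ge0// ?divr_ge0 ?invr_ge0 ?mulr_ge0// ltW.
  rewrite -(@ler_pXn2r _ 2)// ?nnegrE ?mulr_ge0//.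
  apply: (@le_trans _ _ (a * b)).
    by rewrite exprMn /b mulrA ler_wpM2r// ?exprn_ge0.
  have -> : (l / 2 * a + (2 * l)^-1 * b) ^+ 2 =
      a * b + (l / 2 * a - (2 * l)^-1 * b) ^+ 2.
    by field; lra.
  by rewrite lerDl sqr_ge0.
apply: (@le_trans _ _ (\int[mu]_t ((l / 2)%:E * (k1 t)%:E +
    ((2 * l)^-1)%:E * (k2 t * f t ^+ 2)%:E))%E).
  apply: ge0_le_integral => //.
  - by move=> t _; rewrite lee_fin mulr_ge0.
  - by apply/measurable_EFinP; exact: measurable_funM.
  - apply: emeasurable_funD; apply: measurable_funeM => //.
    exact/measurable_EFinP.
  - by move=> t _; rewrite -!EFinM -EFinD lee_fin.
have l20 : 0 <= l / 2 by rewrite divr_ge0// ltW.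
have l2i0 : 0 <= (2 * l)^-1 by rewrite invr_ge0 mulr_ge0// ltW.
rewrite ge0_integralD//=; last 4 first.
- by move=> t _; rewrite -EFinM lee_fin mulr_ge0.
- by apply: measurable_funeM; exact/measurable_EFinP.
- by move=> t _; rewrite mule_ge0.
- exact: measurable_funeM.
rewrite !ge0_integralZl_EFin//; last 2 first.
- by move=> t _; rewrite lee_fin.
- exact/measurable_EFinP.
have -> : (l * C + fine Q / l) / 2 = l / 2 * C + (2 * l)^-1 * fine Q.
  by field; lra.
rewrite EFinD !EFinM fineK//; apply: leeD => //.
by apply: lee_pmul => //; rewrite ?lee_fin//; apply: integral_ge0 => t _; rewrite lee_fin.
Qed.

(** A Schur test in which [x] runs over one period and [t] over the whole line. Cauchy-Schwarz uses
    the row bound on [k1]; the diagonal periodicity of [k2] then makes its full column integrals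
    appear. *)
Lemma schur_test_periodic (C1 C2 : R) (k k1 k2 : mR * mR -> R) (f : R -> R) :
  0 < C1 -> 0 <= C2 ->
  measurable_fun [set: mR * mR] k -> measurable_fun [set: mR * mR] k1 ->
  measurable_fun [set: mR * mR] k2 -> measurable_fun [set: R] f ->
  (forall p, 0 <= k p) -> (forall p, 0 <= k1 p) -> (forall p, 0 <= k2 p) ->
  (forall t, 0 <= f t) -> (forall p, k p ^+ 2 <= k1 p * k2 p) ->
  (forall x t, k2 (x + 1, t + 1) = k2 (x, t)) -> (forall t, f (t + 1) = f t) ->
  (forall x, (\int[mu]_t (k1 (x, t))%:E <= C1%:E)%E) ->
  (forall t, (\int[mu]_x (k2 (x, t))%:E <= C2%:E)%E) ->
  (\int[mu]_(x in `[0%R, 1%R[)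
     ((\int[mu]_t (k (x, t) * f t)%:E) * (\int[mu]_t (k (x, t) * f t)%:E)) <=
   (C1 * C2)%:E * \int[mu]_(x in `[0%R, 1%R[) (f x ^+ 2)%:E)%E.
Proof.
move=> C10 C20 mk mk1 mk2 mf k0 k10 k20 f0 kk pk2 pf H1 H2.
have sec (g : mR * mR -> R) x : measurable_fun [set: mR * mR] g ->
    measurable_fun [set: mR] (fun t => g (x, t)).
  by move=> mg; exact: measurableT_comp.
pose q (p : mR * mR) := k2 p * f p.2 ^+ 2.
have mq : measurable_fun [set: mR * mR] (EFin \o q).
  apply/measurable_EFinP; apply: measurable_funM => //; apply: measurable_funX.
  exact: (measurableT_comp mf).
have q0 p : (0 <= (EFin \o q) p)%E by rewrite lee_fin mulr_ge0// exprn_ge0.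
have qR0 p : 0 <= q p by rewrite mulr_ge0// exprn_ge0.
have mfub (g : mR * mR -> R) : measurable_fun [set: mR * mR] g ->
   (forall p, 0 <= g p) -> measurable_fun [set: mR] (fun x => \int[mu]_t (g (x, t))%:E)%E.
  move=> mg g0.
  apply: (@measurable_fun_fubini_tonelli_F _ _ _ _ _ mu (EFin \o g)).
    exact/measurable_EFinP.
  by move=> p; rewrite lee_fin.
have mkf : measurable_fun [set: mR * mR] (fun p => k p * f p.2).
  by apply: measurable_funM => //; exact: (measurableT_comp mf).
have kf0 p : 0 <= k p * f p.2 by rewrite mulr_ge0.
apply: (@le_trans _ _ (\int[mu]_(x in `[0%R, 1%R[) (C1%:E * \int[mu]_t (q (x, t))%:E))%E).
  apply: ge0_le_integral => //.
  - move=> x _; rewrite mule_ge0//; apply: integral_ge0 => t _;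
    by rewrite lee_fin mulr_ge0.
  - apply: measurable_funTS; apply: emeasurable_funM; exact: (mfub _ mkf kf0).
  - apply: measurable_funTS; apply: measurable_funeM; apply: mfub.
      exact/measurable_EFinP.
    by [].
  - move=> x _.
    apply: (@ge0_integral_cauchy_schwarz C1 (fun t => k (x, t)) (fun t => k1 (x, t))
      (fun t => k2 (x, t)) f) => //; exact: sec.
rewrite ge0_integralZl_EFin//; last 3 first.
- by move=> x _; apply: integral_ge0 => t _; rewrite (q0 (x, t)).
- apply: measurable_funTS; apply: mfub; first exact/measurable_EFinP.
  by [].
- exact: ltW.
rewrite EFinM -muleA lee_pmul2l// ?lte_fin//.
have mshift : measurable_fun [set: mR * mR] (fun p : mR * mR => (p.1, p.2 + p.1) : mR * mR).
  by apply: measurable_fun_pair => //=; exact: measurable_funD.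
have mshift' : measurable_fun [set: mR * mR] (fun p : mR * mR => (p.1 - p.2, p.1) : mR * mR).
  by apply: measurable_fun_pair => //=; exact: measurable_funB.
(* With [t = s + x], and then [x] translated by [s] at fixed [s], the pair [(x, s + x)] becomes
   [(x - s, x)]: [f] is evaluated in the fundamental domain while [s] sweeps a whole column of
   [k2]. *)
have -> : (\int[mu]_(x in `[0%R, 1%R[) \int[mu]_t (q (x, t))%:E =
    \int[mu]_(x in `[0%R, 1%R[) \int[mu]_s (q (x, s + x)%R)%:E)%E.
  apply: eq_integral => x _.
  rewrite (@ge0_integral_translate _ x (fun t => (q (x, t))%:E))//.
    by apply: (measurableT_comp mq).
  by move=> t; exact: (q0 (x, t)).
rewrite (@ge0_fubini_set _ (fun p : mR * mR => (q (p.1, p.2 + p.1))%:E))//; last 2 first.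
- exact: (measurableT_comp mq mshift).
- by move=> p; exact: (q0 (p.1, p.2 + p.1)).
have -> : (\int[mu]_s \int[mu]_(x in `[0%R, 1%R[) (q (x, s + x)%R)%:E =
    \int[mu]_s \int[mu]_(x in `[0%R, 1%R[) (q (x - s, x)%R)%:E)%E.
  apply: eq_integral => s _.
  rewrite -(@ge0_integral_periodic_translate _ s (fun x => (q (x - s, x)%R)%:E)).
  - by apply: eq_integral => x _; rewrite addrK addrC.
  - apply: (measurableT_comp mq); apply: measurable_fun_pair => //=.
    exact: measurable_funB.
  - by move=> x; exact: (q0 (x - s, x)).
  - by move=> x; rewrite /q/= pf addrAC pk2.
rewrite -(@ge0_fubini_set _ (fun p : mR * mR => (q (p.1 - p.2, p.1))%:E))//; last 2 first.
- exact: (measurableT_comp mq mshift').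
- by move=> p; exact: (q0 (p.1 - p.2, p.1)).
rewrite -ge0_integralZl_EFin//; last 2 first.
- by move=> x _; rewrite lee_fin exprn_ge0.
- by apply: measurable_funTS; apply/measurable_EFinP; exact: measurable_funX.
apply: ge0_le_integral => //.
- by move=> x _; apply: integral_ge0 => s _; exact: (q0 (x - s, x)).
- apply: measurable_funTS.
  apply: (mfub (fun p : mR * mR => q (p.1 - p.2, p.1))).
    by apply/measurable_EFinP; exact: (measurableT_comp mq mshift').
  by [].
- apply: measurable_funTS; apply: measurable_funeM; apply/measurable_EFinP.
  exact: measurable_funX.
- move=> x _; rewrite /q/=.
  have mk2x : measurable_fun [set: mR] (fun s => (k2 (s, x))%:E).
    by apply/measurable_EFinP; apply: (measurableT_comp mk2).
  under eq_integral do rewrite mulrC EFinM.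
  rewrite ge0_integralZl_EFin//; last 3 first.
  - by move=> s _; rewrite lee_fin.
  - apply: (measurableT_comp mk2x); exact: measurable_funB.
  - by rewrite exprn_ge0.
  rewrite muleC lee_wpmul2r ?lee_fin ?exprn_ge0//.
  rewrite (@ge0_integral_sub _ x (fun s => (k2 (s, x))%:E))//.
  by move=> s; rewrite lee_fin.
Qed.

End SchurTest.

(** * The kernel on the line *)

Section LineKernel.
Context {R : realType}.
Notation mu := (@lebesgue_measure R).
Notation mR := (measurableTypeR R).
Implicit Types (m eps q r x y t : R).

Definition line_kernel m eps r : R :=
  (m - 1) / 2 * eps `^ (m - 1) * (eps + `|r|) `^ (- m).

Lemma scaled_profileE m eps r : 0 < eps ->
  scaled_profile m eps r = line_kernel m eps r.
Proof.
move=> e0; rewrite /scaled_profile /profile /line_kernel.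
have er0 : 0 < eps + `|r| by rewrite ltr_wpDr.
have -> : 1 + `|r / eps| = (eps + `|r|) / eps.
  by rewrite normrM normfV (gtr0_norm e0); field; lra.
rewrite powRM ?invr_ge0 ?ltW//.
have epm : eps `^ m * eps^-1 `^ m = 1.
  by rewrite -powRM ?invr_ge0 ?ltW// mulfV ?gt_eqF// powR1.
have epm0 : eps `^ m != 0 by rewrite gt_eqF// powR_gt0.
have -> : eps^-1 `^ m = (eps `^ m)^-1.
  by apply: (mulfI epm0); rewrite epm mulfV.
rewrite powRN powRB; last by apply/implyP => _; rewrite gt_eqF.
rewrite powRr1; last exact: ltW.
have erm0 : (eps + `|r|) `^ m != 0 by rewrite gt_eqF// powR_gt0.
have e0' : eps != 0 by rewrite gt_eqF.
by field; rewrite ?e0' ?epm0 ?erm0.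
Qed.

Lemma line_kernel_ge0 m eps r : 1 < m -> 0 <= line_kernel m eps r.
Proof.
by move=> m1; rewrite /line_kernel !mulr_ge0 ?powR_ge0//; lra.
Qed.

Lemma measurable_decay q eps :
  measurable_fun [set: R] (fun r => (eps + `|r|) `^ q).
Proof.
apply: measurable_fun_powR_comp; apply: measurable_funD => //.
Qed.

Lemma measurable_line_kernel m eps : measurable_fun [set: R] (line_kernel m eps).
Proof. by apply: measurable_funM => //; exact: measurable_decay. Qed.

(** From [eps + |r + s| <= eps + |r| + 1 <= (1 + eps^-1) * (eps + |r|)]. The constant depends on
    [eps], but it serves only finiteness and domination and never enters the final estimate. *)
Lemma decay_harnack q eps r s : 0 < eps -> 0 <= q -> `|s| <= 1 ->
  (eps + `|r|) `^ (- q) <= (1 + eps^-1) `^ q * (eps + `|r + s|) `^ (- q).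
Proof.
move=> e0 q0 s1; rewrite !powRN.
have er0 : 0 < eps + `|r| by rewrite ltr_wpDr.
have ers0 : 0 < eps + `|r + s| by rewrite ltr_wpDr.
rewrite ler_pdivlMr ?powR_gt0// ler_pdivrMl ?powR_gt0//.
have c0 : 0 <= 1 + eps^-1 by rewrite addr_ge0// invr_ge0 ltW.
rewrite -powRM//; last exact: ltW.
apply: ge0_ler_powR => //; rewrite ?nnegrE; try by rewrite ?mulr_ge0// ltW.
have h1 : `|r + s| <= `|r| + 1 by rewrite (le_trans (ler_normD _ _))// lerD2l.
apply: (@le_trans _ _ (eps + `|r| + 1)); first lra.
rewrite mulrDr mulr1 lerD2l mulrDl mulfV ?gt_eqF// lerDl.
by rewrite divr_ge0// ltW.
Qed.

Lemma line_kernel_harnack m eps r s : 1 < m -> 0 < eps -> `|s| <= 1 ->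
  line_kernel m eps r <= (1 + eps^-1) `^ m * line_kernel m eps (r + s).
Proof.
move=> m1 e0 s1; rewrite /line_kernel mulrCA ler_wpM2l//.
  by rewrite mulr_ge0 ?powR_ge0//; lra.
by apply: decay_harnack => //; lra.
Qed.

(** The normalisation [(m - 1) / 2] cancels the [2 / (m - 1)] of the tail integral, so that
    [rho = 0] gives total mass at most 1. *)
Lemma integral_line_kernel_tail m eps rho : 1 < m -> 0 < eps -> 0 <= rho ->
  (\int[mu]_r (if rho <= `|r| then line_kernel m eps r else 0)%:E <=
   (eps `^ (m - 1) * (eps + rho) `^ (1 - m))%:E)%E.
Proof.
move=> m1 e0 rho0.
set c := (m - 1) / 2 * eps `^ (m - 1).
have c0 : 0 <= c by rewrite mulr_ge0 ?powR_ge0//; lra.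
rewrite (_ : (\int[mu]_r _ = \int[mu]_r
  (c%:E * (if rho <= `|r| then (eps + `|r|) `^ (- m) else 0)%:E))%E); last first.
  apply: eq_integral => r _; rewrite -EFinM /line_kernel; congr (_%:E).
  by case: ifP => // _; rewrite mulr0.
rewrite ge0_integralZl_EFin//; last 2 first.
- by move=> r _; rewrite lee_fin; case: ifP => // _; exact: powR_ge0.
- apply/measurable_EFinP; apply: measurable_fun_ifT => //.
  + exact: measurable_fun_ler.
  + exact: measurable_decay.
apply: (@le_trans _ _ (c%:E * (2 * ((eps + rho) `^ (1 - m) / (m - 1)))%:E)%E).
  by apply: lee_wpmul2l; [rewrite lee_fin|exact: integral_radial_tail].
rewrite -EFinM lee_fin /c le_eqVlt; apply/orP; left; apply/eqP.
by field; lra.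
Qed.

Lemma integral_line_kernel_le1 m eps x : 1 < m -> 0 < eps ->
  (\int[mu]_y (line_kernel m eps (x - y))%:E <= 1)%E.
Proof.
move=> m1 e0.
rewrite (@ge0_integral_sub _ x (fun y => (line_kernel m eps y)%:E)); last 2 first.
- by apply/measurable_EFinP; exact: measurable_line_kernel.
- by move=> y; rewrite lee_fin line_kernel_ge0.
have := integral_line_kernel_tail m1 e0 (lexx 0).
rewrite addr0 -powRD; last by apply/implyP => _; rewrite gt_eqF.
rewrite (_ : m - 1 + (1 - m) = 0); last ring.
rewrite powRr0; apply: le_trans; rewrite le_eqVlt; apply/orP; left; apply/eqP.
by apply: eq_integral => r _; rewrite normr_ge0.
Qed.

(** By the Harnack inequality each term is at most a constant times its average over a unit
    interval. These intervals tile the line, so the series is dominated by the integral of the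
    kernel. *)
Lemma esum_line_kernel_le m eps x : 1 < m -> 0 < eps ->
  (\esum_(k in [set: int]) (line_kernel m eps (x - k%:~R))%:E <=
   ((1 + eps^-1) `^ m)%:E)%E.
Proof.
move=> m1 e0; set H := (1 + eps^-1) `^ m.
have H0 : 0 <= H by exact: powR_ge0.
have k0 r : (0 <= (line_kernel m eps r)%:E)%E by rewrite lee_fin line_kernel_ge0.
have mk r : measurable_fun [set: R] (fun s => (line_kernel m eps (r - s))%:E).
  apply/measurable_EFinP; apply: (measurableT_comp (measurable_line_kernel m eps)).
  exact: measurable_funB.
have mk2 (k : int) :
    measurable_fun [set: R] (fun s => (line_kernel m eps (x - (s + k%:~R)))%:E).
  under eq_fun do rewrite opprD addrCA addrC.
  exact: mk.
apply: (@le_trans _ _ (\esum_(k in [set: int])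
  \int[mu]_(s in `[0%R, 1%R[) (H%:E * (line_kernel m eps (x - (s + k%:~R)))%:E))%E).
  apply: le_esum => k _.
  rewrite -[leLHS]mule1 -[X in (_ * X <= _)%E](_ : mu [set` `[0%R, 1%R[] = 1%E); last first.
    by rewrite lebesgue_measure_itv/= lte_fin ltr01 oppr0 adde0.
  rewrite -integral_cst//; apply: ge0_le_integral => //.
  - by move=> s _ /=.
  - apply: measurable_funTS; apply: measurable_funeM. exact: mk2.
  - move=> s; rewrite /= in_itv/= => /andP[s0 s1].
    rewrite -EFinM lee_fin /H.
    rewrite (_ : x - (s + k%:~R) = (x - k%:~R) + - s); last by ring.
    by apply: line_kernel_harnack => //; rewrite normrN ger0_norm// ltW.
rewrite esum_int_nneseries; last first.
  by move=> k; apply: integral_ge0 => s _; rewrite mule_ge0.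
under eq_eseriesr.
  move=> k _; rewrite ge0_integralZl_EFin//; last first.
    apply: measurable_funTS. exact: mk2.
  over.
rewrite nneseriesZl; last by move=> k _; exact: integral_ge0.
rewrite -integral_nneseries//; last first.
  move=> k; apply: measurable_funTS. exact: mk2.
under eq_integral do rewrite -(esum_int_nneseries (a := fun k => (line_kernel m eps (x - (_ + k%:~R)))%:E))//.
rewrite -(@ge0_integral_unfold _ (fun s => (line_kernel m eps (x - s))%:E))//.
rewrite -[leRHS]mule1; apply: lee_wpmul2l; first by rewrite lee_fin.
exact: integral_line_kernel_le1.
Qed.

End LineKernel.

(** * The periodised kernel and convolution on the torus *)

Section TorusKernel.
Context {R : realType}.
Notation mu := (@lebesgue_measure R).
Notation mR := (measurableTypeR R).
Implicit Types (m eps x y t : R).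

(** [fine] sends an infinite sum to 0; finiteness of the periodisation is what makes the real-valued
    kernel faithful. *)
Lemma torus_kernelE m eps z : 1 < m -> 0 < eps ->
  ((torus_kernel m eps z)%:E =
   \esum_(k in [set: int]) (line_kernel m eps (z - k%:~R))%:E)%E.
Proof.
move=> m1 e0; rewrite /torus_kernel.
under eq_esum do rewrite scaled_profileE//.
rewrite fineK// ge0_fin_numE; last first.
  by apply: esum_ge0 => k _; rewrite lee_fin line_kernel_ge0.
by rewrite (le_lt_trans (esum_line_kernel_le _ _ _))// ltry.
Qed.

Lemma torus_kernel_ge0 m eps z : 1 < m -> 0 < eps -> 0 <= torus_kernel m eps z.
Proof.
move=> m1 e0; rewrite -lee_fin torus_kernelE//.
by apply: esum_ge0 => k _; rewrite lee_fin line_kernel_ge0.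
Qed.

Lemma torus_kernel_le m eps z : 1 < m -> 0 < eps ->
  torus_kernel m eps z <= (1 + eps^-1) `^ m.
Proof. by move=> m1 e0; rewrite -lee_fin torus_kernelE// esum_line_kernel_le. Qed.

Lemma measurable_torus_kernel m eps : 1 < m -> 0 < eps ->
  measurable_fun [set: R] (torus_kernel m eps).
Proof.
move=> m1 e0; apply/measurable_EFinP.
rewrite (_ : EFin \o _ = fun z =>
  (\esum_(k in [set: int]) (line_kernel m eps (z - k%:~R))%:E)%E); last first.
  by apply/funext => z /=; rewrite torus_kernelE.
apply: measurable_esum_int.
- move=> k; apply/measurable_EFinP.
  apply: (measurableT_comp (measurable_line_kernel m eps)).
  exact: measurable_funB.
- by move=> k z; rewrite lee_fin line_kernel_ge0.
Qed.

Lemma ge0_integral_torus_kernel m eps x (g : R -> R) : 1 < m -> 0 < eps ->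
  measurable_fun [set: R] g -> (forall y, 0 <= g y) ->
  (forall y, g (y + 1) = g y) ->
  (\int[mu]_(y in `[0%R, 1%R[) (torus_kernel m eps (x - y) * g y)%:E =
   \int[mu]_y (line_kernel m eps (x - y) * g y)%:E)%E.
Proof.
move=> m1 e0 mg g0 pg.
have mkg : measurable_fun [set: R] (fun y => (line_kernel m eps (x - y) * g y)%:E).
  apply/measurable_EFinP; apply: measurable_funM => //.
  by apply: (measurableT_comp (measurable_line_kernel m eps)); exact: measurable_funB.
have kg0 y : (0 <= (line_kernel m eps (x - y) * g y)%:E)%E.
  by rewrite lee_fin mulr_ge0// line_kernel_ge0.
rewrite [RHS]ge0_integral_unfold//.
apply: eq_integral => y _; rewrite mulrC EFinM torus_kernelE// !esum_int_nneseries//.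
- rewrite -nneseriesZl; last by move=> k _; rewrite lee_fin line_kernel_ge0.
  apply: eq_eseriesr => k _; rewrite -EFinM (periodic_int pg).
  by rewrite mulrC opprD addrA.
- by move=> k; rewrite lee_fin line_kernel_ge0.
Qed.

(** Unfolding is available for nonnegative integrands; since both kernels are nonnegative, it can be
    applied to [u^\+] and [u^\-] separately. *)
Lemma integral_torus_kernel m eps x (u : R -> R) : 1 < m -> 0 < eps ->
  measurable_fun [set: R] u -> (forall y, u (y + 1) = u y) ->
  (\int[torus_measure R]_y (torus_kernel m eps (x - y) * u y)%:E =
   \int[mu]_y (line_kernel m eps (x - y) * u y)%:E)%E.
Proof.
move=> m1 e0 mu' pu.
have mk : measurable_fun [set: R] (fun y => torus_kernel m eps (x - y)).
  by apply: (measurableT_comp (measurable_torus_kernel m1 e0)); exact: measurable_funB.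
have pos (k : R -> R) : (forall y, 0 <= k y) ->
    ((fun y => (k y * u y)%:E)^\+ = (fun y => (k y * u^\+ y)%:E))%E.
  by move=> k0; apply/funext => y; rewrite funeposE -EFin_max /funrpos maxr_pMr// mulr0.
have neg (k : R -> R) : (forall y, 0 <= k y) ->
    ((fun y => (k y * u y)%:E)^\- = (fun y => (k y * u^\- y)%:E))%E.
  by move=> k0; apply/funext => y; rewrite funenegE -EFinN -EFin_max /funrneg maxr_pMr// mulr0 mulrN.
rewrite integral_torus; last first.
  by apply/measurable_EFinP; exact: measurable_funM.
rewrite integralE [RHS]integralE !pos ?neg; last 4 first.
- by move=> y; exact: line_kernel_ge0.
- by move=> y; exact: torus_kernel_ge0.
- by move=> y; exact: line_kernel_ge0.
- by move=> y; exact: torus_kernel_ge0.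
rewrite !ge0_integral_torus_kernel//.
- exact: measurable_funrneg.
- by move=> y; rewrite /funrneg pu.
- exact: measurable_funrpos.
- by move=> y; rewrite /funrpos pu.
Qed.

Lemma torus_convolutionE m eps (u : R -> R) x : 1 < m -> 0 < eps ->
  measurable_fun [set: R] u -> (forall y, u (y + 1) = u y) ->
  torus_convolution (torus_kernel m eps) u x =
  \int[mu]_y (line_kernel m eps (x - y) * u y).
Proof.
by move=> *; rewrite /torus_convolution /Rintegral integral_torus_kernel.
Qed.

(** Folded onto the torus the kernel is bounded, so finiteness over one period of [g] is enough. *)
Lemma integral_line_kernel_periodic_lty m eps x (g : R -> R) : 1 < m -> 0 < eps ->
  measurable_fun [set: R] g -> (forall y, 0 <= g y) ->
  (forall y, g (y + 1) = g y) ->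
  (\int[mu]_(y in `[0%R, 1%R[) (g y)%:E < +oo)%E ->
  (\int[mu]_y (line_kernel m eps (x - y) * g y)%:E < +oo)%E.
Proof.
move=> m1 e0 mg g0 pg gfin.
rewrite -ge0_integral_torus_kernel//.
apply: (@le_lt_trans _ _ (\int[mu]_(y in `[0%R, 1%R[)
   (((1 + eps^-1) `^ m)%:E * (g y)%:E))%E).
  apply: ge0_le_integral => //.
  - by move=> y _; rewrite lee_fin mulr_ge0// torus_kernel_ge0.
  - apply: measurable_funTS; apply/measurable_EFinP; apply: measurable_funM => //.
    apply: (measurableT_comp (measurable_torus_kernel m1 e0)).
    exact: measurable_funB.
  - apply: measurable_funTS; apply: measurable_funeM; exact/measurable_EFinP.
  - by move=> y _; rewrite -EFinM lee_fin ler_wpM2r// torus_kernel_le.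
rewrite ge0_integralZl_EFin//; last 3 first.
- by move=> y _; rewrite lee_fin.
- by apply: measurable_funTS; exact/measurable_EFinP.
- exact: powR_ge0.
rewrite lte_mul_pinfty// ?lee_fin ?powR_ge0//.
Qed.

Lemma integrable_line_kernel m eps x (u : R -> R) : 1 < m -> 0 < eps ->
  measurable_fun [set: R] u -> (forall y, u (y + 1) = u y) ->
  mu.-integrable [set` `[0, 1[] (EFin \o u) ->
  mu.-integrable [set: mR] (fun y => (line_kernel m eps (x - y) * `|u y|)%:E).
Proof.
move=> m1 e0 mu' pu /integrableP[_ iu]; apply/integrableP; split.
  apply/measurable_EFinP; apply: measurable_funM; last exact: measurableT_comp.
  by apply: (measurableT_comp (measurable_line_kernel m eps)); exact: measurable_funB.
rewrite [ltLHS](_ : _ = \int[mu]_y (line_kernel m eps (x - y) * `|u y|)%:E)%E; last first.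
  apply: eq_integral => y _.
  by rewrite gee0_abs// lee_fin mulr_ge0// line_kernel_ge0.
apply: (@integral_line_kernel_periodic_lty m eps x (fun y => `|u y|)) => //.
- exact: measurableT_comp.
- by move=> y; rewrite pu.
Qed.

End TorusKernel.

(** * Dominated convergence for real-valued integrals *)

Section DominatedConvergence.
Context d (T : measurableType d) {R : realType}.
Variables (mu : {measure set T -> \bar R}) (D : set T).
Hypothesis mD : measurable D.

Lemma Rintegral_dominated_cvg (f_ : nat -> T -> R) (f g : T -> R) :
  (forall n, measurable_fun D (f_ n)) -> measurable_fun D f ->
  {ae mu, forall x, D x -> f_ n x @[n --> \oo] --> f x} ->
  mu.-integrable D (EFin \o g) ->
  (forall n x, D x -> `|f_ n x| <= g x) ->
  \int[mu]_(x in D) f_ n x @[n --> \oo] --> \int[mu]_(x in D) f x.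
Proof.
move=> mf_ mf f_f ig fg.
have [] := @dominated_convergence _ _ _ mu _ mD (fun n => EFin \o f_ n) (EFin \o f)
  (EFin \o g).
- by move=> n; exact/measurable_EFinP.
- exact/measurable_EFinP.
- apply: filterS f_f => x fx Dx.
  by apply: cvg_EFin; [exact: nearW|exact: fx].
- exact: ig.
- by apply: aeW => x n Dx; rewrite /= lee_fin fg.
move=> fi _; have ffin : (\int[mu]_(x in D) (EFin \o f) x)%E \is a fin_num.
  exact: integrable_fin_num.
by rewrite -(fineK ffin) => /fine_cvg.
Qed.

Lemma Rintegral_dominated_dnbhs (q : R -> T -> R) (q0 g : T -> R) :
  (forall h, `|h| <= 1 -> measurable_fun D (q h)) -> measurable_fun D q0 ->
  {ae mu, forall y, D y -> q h y @[h --> 0^'] --> q0 y} ->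
  mu.-integrable D (EFin \o g) ->
  (forall h y, h != 0 -> `|h| <= 1 -> D y -> `|q h y| <= g y) ->
  \int[mu]_(y in D) q h y @[h --> 0^'] --> \int[mu]_(y in D) q0 y.
Proof.
move=> mq mq0 qq0 ig qg; apply/cvgr_dnbhsP => t [t0 tcvg].
(* The domination holds only for [|h| <= 1], so the sequence is shifted past the index from which it
   stays there. *)
have [N _ tN] : \forall n \near \oo, `|t n| <= 1.
  have /cvgr0_norm_le := tcvg; exact.
rewrite -(cvg_shiftn N).
apply: (@Rintegral_dominated_cvg (fun n => q (t (n + N)%N)) q0 g) => //.
- by move=> n; apply: mq; apply: tN; exact: leq_addl.
- apply: filterS qq0 => y H Dy.
  have /cvgr_dnbhsP := H Dy; apply; split => //.
  by rewrite (cvg_shiftn N).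
- by move=> n y Dy; apply: qg => //; apply: tN; exact: leq_addl.
Qed.

End DominatedConvergence.

(** * Differentiation of the convolution on the line *)

Section LineKernelDerivative.
Context {R : realType}.
Notation mu := (@lebesgue_measure R).
Notation mR := (measurableTypeR R).
Implicit Types (m eps r x y t h : R).

(** The derivative of [line_kernel] away from its kink at 0. As [Num.sg 0 = 0], it takes the value 0
    there and is odd at every point. *)
Definition dline_kernel m eps r : R :=
  - Num.sg r * (m * ((m - 1) / 2 * eps `^ (m - 1)) * (eps + `|r|) `^ (- (m + 1))).

Lemma dline_kernel_odd m eps r : dline_kernel m eps (- r) = - dline_kernel m eps r.
Proof. by rewrite /dline_kernel sgrN normrN opprK mulNr opprK. Qed.

Lemma dline_kernel_le m eps r : 1 < m -> 0 < eps ->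
  `|dline_kernel m eps r| <= m / (eps + `|r|) * line_kernel m eps r.
Proof.
move=> m1 e0; rewrite /dline_kernel normrM normrN.
have er0 : 0 < eps + `|r| by rewrite ltr_wpDr.
have c0 : 0 <= m * ((m - 1) / 2 * eps `^ (m - 1)) * (eps + `|r|) `^ (- (m + 1)).
  by rewrite !mulr_ge0 ?powR_ge0//; lra.
rewrite (ger0_norm c0).
have s1 : `|Num.sg r| <= 1 by rewrite normr_sg; case: (r != 0).
apply: (le_trans (ler_piMl c0 s1)).
rewrite /line_kernel opprD (@powRD _ (eps + `|r|)); last first.
  by apply/implyP => _; rewrite gt_eqF.
rewrite (@powR_inv1 _ (eps + `|r|)) ?(ltW er0)// le_eqVlt; apply/orP; left; apply/eqP.
by field; rewrite gt_eqF.
Qed.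

Lemma dline_kernel_le_eps m eps r : 1 < m -> 0 < eps ->
  `|dline_kernel m eps r| <= m / eps * line_kernel m eps r.
Proof.
move=> m1 e0; apply: (le_trans (dline_kernel_le _ m1 e0)).
apply: ler_wpM2r; first exact: line_kernel_ge0.
have er0 : 0 < eps + `|r| by rewrite ltr_wpDr.
rewrite ler_wpM2l//; first lra.
by rewrite lef_pV2// ?posrE// lerDl.
Qed.

Lemma measurable_dline_kernel m eps : measurable_fun [set: R] (dline_kernel m eps).
Proof.
apply: measurable_funM; last by apply: measurable_funM => //; exact: measurable_decay.
apply: measurableT_comp => //.
rewrite (_ : Num.sg = (fun r : R => if r == 0 then 0 else if r < 0 then -1 else 1)) //.
apply: measurable_fun_ifT => //; first exact: measurable_fun_eqr.
by apply: measurable_fun_ifT => //; exact: measurable_fun_ltr.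
Qed.

Lemma near_sgr r : r != 0 ->
  \forall z \near r, Num.sg z = Num.sg r /\ `|z| = Num.sg r * z.
Proof.
rewrite neq_lt => /orP[rlt0|rgt0].
  near=> z; have z0 : z < 0 by near: z; exact: lt_nbhsl.
  by rewrite (ltr0_norm z0) !ltr0_sg// mulN1r.
near=> z; have z0 : 0 < z by near: z; exact: lt_nbhsr.
by rewrite (gtr0_norm z0) !gtr0_sg// mul1r.
Unshelve. all: by end_near. Qed.

Lemma is_derive_line_kernel m eps r : 0 < eps -> r != 0 ->
  is_derive r 1 (line_kernel m eps) (dline_kernel m eps r).
Proof.
move=> e0 r0.
set s := Num.sg r.
have sr : s * r = `|r| by rewrite normrEsg.
set c := (m - 1) / 2 * eps `^ (m - 1).
have near_s : \near r, c * (eps + s * r) `^ (- m) = line_kernel m eps r.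
  by apply: filterS (near_sgr r0) => z [_ zE]; rewrite /line_kernel zE.
have esr0 : 0 < eps + s * r by rewrite sr ltr_wpDr.
have H1 := is_derive_powR (- m) esr0.
have H2 : is_derive r 1 (fun r : R => eps + s * r) (0 + s *: 1).
  by apply: is_deriveD; exact: (is_deriveZ s (is_derive_id r 1)).
have H3 := @is_derive1_comp _ (@powR R ^~ (- m)) (fun r => eps + s * r) r _ _ H1 H2.
have H4 : is_derive r 1 (fun r : R => c * (eps + s * r) `^ (- m)) _ := is_deriveZ c H3.
have := @near_eq_is_derive _ _ _ _ (line_kernel m eps) r 1 _ near_s H4.
move=> H5; apply: (is_derive_eq H5).
rewrite /dline_kernel -/s sr /GRing.scale/= opprD -/c.
by ring.
Qed.

Lemma continuous_dline_kernel m eps r : 0 < eps -> r != 0 ->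
  {for r, continuous (dline_kernel m eps)}.
Proof.
move=> e0 r0.
set c := m * ((m - 1) / 2 * eps `^ (m - 1)).
have sr : Num.sg r * r = `|r| by rewrite normrEsg.
have near_s : {near r, (fun z => - Num.sg r * (c * (eps + Num.sg r * z) `^ (- (m + 1)))) =1
   dline_kernel m eps}.
  by apply: filterS (near_sgr r0) => z [sE zE]; rewrite /dline_kernel zE sE.
have H : - Num.sg r * (c * (eps + Num.sg r * z) `^ (- (m + 1))) @[z --> r] -->
    - Num.sg r * (c * (eps + Num.sg r * r) `^ (- (m + 1))).
  apply: cvgMr; apply: cvgMr.
  apply: (@continuous_comp _ _ _ (fun t => eps + Num.sg r * t) (@powR R ^~ (- (m + 1)))).
    by apply: continuousD; [exact: cst_continuous|apply: cvgMr; exact: cvg_id].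
  by apply: continuous_powR; rewrite sr ltr_wpDr.
rewrite /prop_for/continuous_at [X in _ --> X]/dline_kernel -sr -/c.
exact: cvg_trans (near_eq_cvg near_s) H.
Qed.

(** Mean value theorem: the derivative is largest in absolute value at the left end, and one factor
    [(eps + c)^-1] at the intermediate point is traded for [eps^-1]. *)
Lemma decay_lipschitz m eps (a b : R) : 0 < eps -> 0 <= m -> 0 <= a -> a <= b ->
  `|(eps + b) `^ (- m) - (eps + a) `^ (- m)| <=
   m / eps * (b - a) * (eps + a) `^ (- m).
Proof.
move=> e0 m0 a0; rewrite le_eqVlt => /orP[/eqP <-|ab].
  by rewrite !subrr normr0 mulr0 mul0r.
have dF x : x \in `]a, b[ ->
    is_derive x 1 (fun t => (eps + t) `^ (- m)) (- m * (eps + x) `^ (- m - 1)).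
  rewrite in_itv/= => /andP[ax xb]; have ex0 : 0 < eps + x by lra.
  have H1 := is_derive_powR (- m) ex0.
  have H2 : is_derive x 1 (fun t => eps + t) 1.
    by rewrite -[X in is_derive _ _ _ X]add0r; apply: is_deriveD.
  have := @is_derive1_comp _ (@powR R ^~ (- m)) (fun t => eps + t) x _ _ H1 H2.
  by rewrite mulr1.
have cF : {within `[a, b], continuous (fun t => (eps + t) `^ (- m))}.
  apply: continuous_in_subspaceT => x; rewrite inE/= in_itv/= => /andP[ax xb].
  have ex0 : 0 < eps + x by lra.
  apply: (@continuous_comp _ _ _ (fun t => eps + t) (@powR R ^~ (- m))).
    by apply: continuousD; [exact: cst_continuous|exact: cvg_id].
  exact: continuous_powR.
have [c cab ->] := MVT ab dF cF.
move: cab; rewrite in_itv/= => /andP[ac cb].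
have ec0 : 0 < eps + c by lra.
have ba0 : 0 < b - a by lra.
rewrite normrM (gtr0_norm ba0) normrM normrN (ger0_norm m0) (ger0_norm (powR_ge0 _ _)).
rewrite (_ : m / eps * (b - a) * _ = m * (eps^-1 * (eps + a) `^ (- m)) * (b - a)); last first.
  by ring.
apply: ler_wpM2r; first exact: ltW.
apply: ler_wpM2l => //; rewrite powRD; last by apply/implyP => _; rewrite gt_eqF.
rewrite powR_inv1; last exact: ltW.
rewrite mulrC; apply: ler_pM.
- by rewrite invr_ge0 ltW.
- exact: powR_ge0.
- by rewrite lef_pV2 ?posrE//; lra.
- rewrite !powRN lef_pV2 ?posrE ?powR_gt0//; last lra.
  by apply: ge0_ler_powR; rewrite ?nnegrE//; lra.
Qed.

(** A Lipschitz constant proportional to the kernel itself provides an integrable majorant of the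
    difference quotients that does not depend on [h]. *)
Lemma line_kernel_lipschitz m eps r h : 1 < m -> 0 < eps -> `|h| <= 1 ->
  `|line_kernel m eps (r + h) - line_kernel m eps r| <=
    m / eps * (1 + eps^-1) `^ m * line_kernel m eps r * `|h|.
Proof.
move=> m1 e0 h1.
set H := (1 + eps^-1) `^ m.
have m0 : 0 <= m by lra.
have c0 : 0 <= (m - 1) / 2 * eps `^ (m - 1) by rewrite mulr_ge0 ?powR_ge0//; lra.
have H1 : 1 <= H.
  rewrite -[leLHS](powRr0 (1 + eps^-1)) ler_powR//.
  by rewrite lerDl invr_ge0 ltW.
rewrite /line_kernel -mulrBr normrM (ger0_norm c0).
rewrite (_ : m / eps * H * _ * _ = (m - 1) / 2 * eps `^ (m - 1) *
  (m / eps * `|h| * (H * (eps + `|r|) `^ (- m)))); last by ring.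
apply: ler_wpM2l => //.
have me0 : 0 <= m / eps * `|h|.
  by rewrite mulr_ge0// divr_ge0// ltW.
have [rh|hr] := leP `|r| `|r + h|.
- apply: (le_trans (decay_lipschitz e0 m0 (normr_ge0 r) rh)).
  apply: ler_pM; rewrite ?powR_ge0//.
  + by rewrite mulr_ge0 ?divr_ge0 ?subr_ge0// ltW.
  + apply: ler_wpM2l; first by rewrite divr_ge0// ltW.
    by have := ler_normD r h; lra.
  + by rewrite ler_peMl// powR_ge0.
(* Here the mean value bound carries the decay at [r + h], which the Harnack inequality brings back
   to [r]. *)
- rewrite distrC; apply: (le_trans (decay_lipschitz e0 m0 (normr_ge0 (r + h)) (ltW hr))).
  apply: ler_pM; rewrite ?powR_ge0//.
  + by rewrite mulr_ge0 ?divr_ge0 ?subr_ge0// ltW.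
  + apply: ler_wpM2l; first by rewrite divr_ge0// ltW.
    by have := ler_normD (r + h) (- h); rewrite addrK normrN; lra.
  + have := @decay_harnack _ m eps (r + h) (- h) e0 m0.
    by rewrite normrN addrK; exact.
Qed.

Variables (m eps : R) (u : R -> R).
Hypotheses (m1 : 1 < m) (e0 : 0 < eps) (mu' : measurable_fun [set: R] u).
Hypothesis pu : forall y, u (y + 1) = u y.
Hypothesis iu : mu.-integrable [set` `[0, 1[] (EFin \o u).

Let msec (k : R -> R) x : measurable_fun [set: R] k ->
  measurable_fun [set: mR] (fun y => k (x - y)).
Proof. by move=> mk; apply: (measurableT_comp mk); exact: measurable_funB. Qed.

Let integrable_majorant x C :
  mu.-integrable [set: mR]
    (EFin \o (fun y => C * (line_kernel m eps (x - y) * `|u y|))).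
Proof.
rewrite /comp; under eq_fun do rewrite EFinM.
by apply: integrableZl => //; exact: integrable_line_kernel.
Qed.

Lemma integrable_line_conv x :
  mu.-integrable [set: mR] (EFin \o (fun y => line_kernel m eps (x - y) * u y)).
Proof.
apply: le_integrable (integrable_majorant x 1) => //.
- apply/measurable_EFinP; apply: measurable_funM => //.
  by apply: msec; exact: measurable_line_kernel.
- move=> y _ /=; rewrite lee_fin mul1r normrM [leRHS]normrM normr_id.
  by rewrite ger0_norm// line_kernel_ge0.
Qed.

Lemma integrable_dline_conv x :
  mu.-integrable [set: mR] (EFin \o (fun y => dline_kernel m eps (x - y) * u y)).
Proof.
apply: le_integrable (integrable_majorant x (m / eps)) => //.
- apply/measurable_EFinP; apply: measurable_funM => //.
  by apply: msec; exact: measurable_dline_kernel.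
- move=> y _ /=; rewrite lee_fin normrM [leRHS]ger0_norm; last first.
    rewrite mulr_ge0//; first by rewrite divr_ge0// ltW// (lt_trans ltr01).
    by rewrite mulr_ge0// line_kernel_ge0.
  by rewrite mulrA ler_wpM2r// dline_kernel_le_eps.
Qed.

Let ae_neq (x : R) : {ae mu, forall y : mR, x - y != 0}.
Proof.
exists [set x]; split => //; first exact: lebesgue_measure_set1.
by move=> y /= /negP; rewrite negbK subr_eq0 => /eqP.
Qed.

Lemma is_derive_line_conv x :
  is_derive x 1 (fun x => \int[mu]_y (line_kernel m eps (x - y) * u y))
    (\int[mu]_y (dline_kernel m eps (x - y) * u y)).
Proof.
set F := fun x => \int[mu]_y (line_kernel m eps (x - y) * u y).
suff H : h^-1 *: (F (h *: 1 + x) - F x) @[h --> 0^'] -->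
    \int[mu]_y (dline_kernel m eps (x - y) * u y).
  apply: DeriveDef; first by apply/cvg_ex; eexists; exact: H.
  by apply/cvg_lim; first exact: Rhausdorff.
set C := m / eps * (1 + eps^-1) `^ m.
pose q h y := h^-1 * (line_kernel m eps (h + x - y) - line_kernel m eps (x - y)) * u y.
have -> : (fun h => h^-1 *: (F (h *: 1 + x) - F x)) = fun h => \int[mu]_y q h y.
  apply/funext => h; rewrite /F /GRing.scale/= mulr1 -RintegralB//; last 2 first.
  - exact: integrable_line_conv.
  - exact: integrable_line_conv.
  rewrite -RintegralZl//.
    by apply: eq_Rintegral => y _; rewrite /q; ring.
  rewrite /comp; under eq_fun do rewrite EFinB.
  by apply: integrableB => //; exact: integrable_line_conv.
apply: (@Rintegral_dominated_dnbhs _ _ _ mu _ measurableT q _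
  (fun y => C * (line_kernel m eps (x - y) * `|u y|))).
- move=> h _; apply: measurable_funM => //; apply: measurable_funM => //.
  by apply: measurable_funB; apply: msec; exact: measurable_line_kernel.
- apply: measurable_funM => //; apply: msec; exact: measurable_dline_kernel.
- apply: filterS (ae_neq x) => y xy _.
  apply: cvgMl; have [] := is_derive_line_kernel m e0 xy.
  move=> /cvg_ex[/= l ql] <-.
  rewrite [X in _ --> X](_ : _ = l); last by apply/cvg_lim => //; exact: Rhausdorff.
  apply: cvg_trans ql; apply: near_eq_cvg; near=> h.
  by rewrite /GRing.scale/= mulr1 addrA.
- exact: integrable_majorant.
- move=> h y h0 h1 _; rewrite /q normrM mulrA ler_wpM2r// normrM normfV.
  rewrite mulrC ler_pdivrMr ?normr_gt0//.
  have := @line_kernel_lipschitz m eps (x - y) h m1 e0 h1.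
  by rewrite (addrC _ h) addrA.
Unshelve. all: by end_near. Qed.

(** [dline_kernel] jumps at 0, but for fixed [x] the jump is met only at [y = x], a null set, so
    dominated convergence still gives continuity. *)
Lemma continuous_dline_conv :
  continuous (fun x => \int[mu]_y (dline_kernel m eps (x - y) * u y)).
Proof.
move=> x; apply/(@cvg_nbhsP _ R^o) => w wx.
have wx0 : w n - x @[n --> \oo] --> (0 : R) by exact/subr_cvg0.
have [N _ wN] : \forall n \near \oo, `|w n - x| <= 1.
  have /cvgr0_norm_le := wx0; exact.
rewrite -(cvg_shiftn N).
set C := m / eps * (1 + eps^-1) `^ m.
apply: (@Rintegral_dominated_cvg _ _ _ mu _ measurableT
  (fun n y => dline_kernel m eps (w (n + N)%N - y) * u y) _
  (fun y => C * (line_kernel m eps (x - y) * `|u y|))).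
- move=> n; apply: measurable_funM => //; apply: msec; exact: measurable_dline_kernel.
- apply: measurable_funM => //; apply: msec; exact: measurable_dline_kernel.
- apply: filterS (ae_neq x) => y xy _; apply: cvgMl.
  have /(@cvg_nbhsP _ R^o) H := @continuous_dline_kernel m eps _ e0 xy.
  apply: (H (fun n => w (n + N)%N - y)).
  by apply: cvgB; [rewrite (cvg_shiftn N)|exact: cvg_cst].
- exact: integrable_majorant.
- move=> n y _; rewrite normrM mulrA ler_wpM2r//.
  apply: (le_trans (dline_kernel_le_eps _ m1 e0)).
  rewrite /C -[leRHS]mulrA; apply: ler_wpM2l; first by rewrite divr_ge0 ?ltW// (lt_trans ltr01).
  have := @line_kernel_harnack _ m eps (w (n + N)%N - y) (x - w (n + N)%N) m1 e0.
  rewrite (_ : w (n + N)%N - y + (x - w (n + N)%N) = x - y); last by ring.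
  by apply; rewrite distrC; apply: wN; exact: leq_addl.
Qed.

End LineKernelDerivative.

(** * The pointwise and L^2 bounds on the derivative *)

Section SchurKernels.
Context {R : realType}.
Notation mu := (@lebesgue_measure R).
Notation mR := (measurableTypeR R).
Implicit Types (m eps r x y t h : R).

Let msub : measurable_fun [set: mR * mR] (fun p : mR * mR => p.1 - p.2).
Proof. by apply: measurable_funB. Qed.

(** The kernel is symmetric and of convolution type, so it serves as both Schur weights. Its mass is
    a tail integral with exponent [m - 1], which exceeds 1 because [2 < m]. *)
Lemma schur_decay m eps (f : R -> R) : 2 < m -> 0 < eps ->
  measurable_fun [set: R] f -> (forall t, 0 <= f t) -> (forall t, f (t + 1) = f t) ->
  (\int[mu]_(x in `[0%R, 1%R[)
     ((\int[mu]_t ((eps + `|x - t|) `^ (- (m - 1)) * f t)%:E) *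
      (\int[mu]_t ((eps + `|x - t|) `^ (- (m - 1)) * f t)%:E)) <=
   ((2 * (eps `^ (2 - m) / (m - 2))) ^+ 2)%:E *
     \int[mu]_(x in `[0%R, 1%R[) (f x ^+ 2)%:E)%E.
Proof.
move=> m2 e0 mf f0 pf.
pose k (p : mR * mR) := (eps + `|p.1 - p.2|) `^ (- (m - 1)).
have mk : measurable_fun [set: mR * mR] k.
  exact: (measurableT_comp (measurable_decay (- (m - 1)) eps) msub).
have k0 p : 0 <= k p by exact: powR_ge0.
have H (x : R) : (\int[mu]_t ((eps + `|x - t|) `^ (- (m - 1)))%:E <=
    (2 * (eps `^ (2 - m) / (m - 2)))%:E)%E.
  rewrite (@ge0_integral_sub _ x (fun t => ((eps + `|t|) `^ (- (m - 1)))%:E)); last 2 first.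
  - by apply/measurable_EFinP; exact: measurable_decay.
  - by move=> y; rewrite lee_fin powR_ge0.
  have := @integral_radial_tail R (m - 1) eps 0 _ e0 (lexx 0).
  rewrite addr0 (_ : 1 - (m - 1) = 2 - m); last ring.
  rewrite (_ : m - 1 - 1 = m - 2); last ring.
  move=> /(_ _); rewrite ltrBrDr => /(_ _); rewrite (_ : 1 + 1 = 2)// => /(_ m2).
  by under eq_integral do rewrite normr_ge0.
have C0 : 0 < 2 * (eps `^ (2 - m) / (m - 2)).
  by rewrite mulr_gt0// divr_gt0 ?powR_gt0//; lra.
rewrite expr2.
apply: (@schur_test_periodic _ _ _ k k k f) => //.
- exact: ltW.
- by move=> x t; rewrite /k/= opprD addrACA subrr addr0.
- by move=> t; under eq_integral do rewrite /k/= distrC; exact: H.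
Qed.

Section Hardy.
Variables (d : R -> R) (eps : R).
Hypotheses (e0 : 0 < eps) (d0 : forall x, 0 <= d x)
  (dlip : forall x y, `|d x - d y| <= `|x - y|)
  (pd : forall x, d (x + 1) = d x) (md : measurable_fun [set: R] d).

(** The radius [d x + eps / 2] and the normalisation [eps + d x] are comparable: this is an average
    over a ball whose size follows [d], as in Hardy's inequality. *)
Definition hardy_kernel x t : R :=
  if `|x - t| <= d x + eps / 2 then (eps + d x)^-1 else 0.

Lemma measurable_hardy_kernel :
  measurable_fun [set: mR * mR] (fun p : mR * mR => hardy_kernel p.1 p.2).
Proof.
apply: measurable_fun_ifT => //.
- apply: measurable_fun_ler; first exact: measurableT_comp.
  by apply: measurable_funD => //; exact: (measurableT_comp md).
- rewrite (_ : (fun t : mR * mR => (eps + d t.1)^-1) =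
     (fun t : mR * mR => (eps + d t.1) `^ (-1))); last first.
    by apply/funext => p; rewrite powR_inv1// addr_ge0// ltW.
  apply: measurable_fun_powR_comp; apply: measurable_funD => //.
  exact: (measurableT_comp md).
Qed.

Lemma schur_hardy (f : R -> R) :
  measurable_fun [set: R] f -> (forall t, 0 <= f t) -> (forall t, f (t + 1) = f t) ->
  (\int[mu]_(x in `[0%R, 1%R[)
     ((\int[mu]_t (hardy_kernel x t * f t)%:E) *
      (\int[mu]_t (hardy_kernel x t * f t)%:E)) <=
   (4 * (4 * 3 `^ (3 / 2)))%:E *
     \int[mu]_(x in `[0%R, 1%R[) (f x ^+ 2)%:E)%E.
Proof.
move=> mf f0 pf.
(* Schur weights: powers of the 1-Lipschitz function s = eps + d, split so that
   k^2 = k1 * k2. *)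
pose s (x : R) := eps + d x.
have s0 x : 0 < s x by rewrite ltr_wpDr.
have ms : measurable_fun [set: R] s by exact: measurable_funD.
pose k1 (p : mR * mR) := if `|p.1 - p.2| <= d p.1 + eps / 2
  then s p.1 `^ (- 2^-1) * s p.2 `^ (- 2^-1) else 0.
pose k2 (p : mR * mR) := if `|p.1 - p.2| <= d p.1 + eps / 2
  then s p.1 `^ (- (3 / 2)) * s p.2 `^ (2^-1) else 0.
have mP : measurable_fun [set: mR * mR] (fun p : mR * mR => `|p.1 - p.2| <= d p.1 + eps / 2).
  apply: measurable_fun_ler; first exact: measurableT_comp.
  by apply: measurable_funD => //; exact: (measurableT_comp md).
have mspow (q : R) (pr : mR * mR -> mR) : measurable_fun [set: mR * mR] pr ->
    measurable_fun [set: mR * mR] (fun p : mR * mR => s (pr p) `^ q).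
  by move=> mpr; apply: measurable_fun_powR_comp; exact: (measurableT_comp ms).
apply: (@schur_test_periodic _ _ _ (fun p => hardy_kernel p.1 p.2) k1 k2 f) => //.
- exact: measurable_hardy_kernel.
- by apply: measurable_fun_ifT => //; apply: measurable_funM; exact: mspow.
- by apply: measurable_fun_ifT => //; apply: measurable_funM; exact: mspow.
- by move=> p; rewrite /hardy_kernel; case: ifP => // _; rewrite invr_ge0 ltW ?s0.
- by move=> p; rewrite /k1; case: ifP => // _; rewrite mulr_ge0// powR_ge0.
- by move=> p; rewrite /k2; case: ifP => // _; rewrite mulr_ge0// powR_ge0.
- move=> p; rewrite /hardy_kernel /k1 /k2; case: ifP => _; last by rewrite expr0n mul0r.
  rewrite -/(s p.1) mulrACA -!powRD; try by apply/implyP => _; rewrite gt_eqF ?s0.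
  rewrite (_ : - 2^-1 + - (3 / 2) = - 2%:R :> R); last by field.
  rewrite (_ : - 2^-1 + 2^-1 = 0 :> R); last by field.
  by rewrite powRr0 mulr1 powR_invn ?exprVn// ltW.
- by move=> x t; rewrite /k2/= /s !pd opprD addrACA subrr addr0.
(* Rows: since [s] is 1-Lipschitz, [s t >= s x - |x - t|], which is positive on the support because
   [rho < s x]. What remains is an integrable inverse square root, with integral at most
   [4 (s x)^(1/2)]. *)
- change (forall x : R, (\int[mu]_t (k1 (x, t))%:E <= 4%:E)%E).
  move=> x; pose rho := d x + eps / 2.
  have rho0 : 0 <= rho by rewrite addr_ge0// divr_ge0// ltW.
  have rs : rho < s x by rewrite /rho /s [ltRHS]addrC ltrD2l ltr_pdivrMr// ltr_pMr// ltr1n.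
  apply: (@le_trans _ _ (\int[mu]_t ((s x `^ (- 2^-1))%:E *
     (if `|x - t| <= rho then (s x - `|x - t|) `^ (- 2^-1) else 0)%:E))%E).
    apply: ge0_le_integral => //.
    + by move=> t _; rewrite lee_fin /k1; case: ifP => // _; rewrite mulr_ge0// powR_ge0.
    + apply/measurable_EFinP; apply: (measurableT_comp (f := k1)) => //.
      by apply: measurable_fun_ifT => //; apply: measurable_funM; exact: mspow.
    + apply: measurable_funeM; apply/measurable_EFinP.
      have mxt : measurable_fun [set: mR] (fun t => `|x - t|).
        by apply: measurableT_comp => //; exact: measurable_funB.
      apply: measurable_fun_ifT => //; first exact: measurable_fun_ler.
      by apply: measurable_fun_powR_comp; exact: measurable_funB.
    + move=> t _; rewrite -EFinM lee_fin /k1/= -/rho; case: ifP => xt; last by rewrite mulr0.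
      rewrite ler_wpM2l ?powR_ge0// !powRN.
      have h1 : 0 < s x - `|x - t| by move: xt rs; lra.
      have h2 : s x - `|x - t| <= s t.
        by rewrite /s; have := dlip x t; have := ler_norm (d x - d t); lra.
      rewrite lef_pV2 ?posrE ?powR_gt0//.
      by apply: ge0_ler_powR; rewrite ?nnegrE ?invr_ge0// ltW.
  rewrite ge0_integralZl_EFin//; last 3 first.
  + by move=> t _; rewrite lee_fin; case: ifP => // _; exact: powR_ge0.
  + apply/measurable_EFinP.
    have mxt : measurable_fun [set: mR] (fun t => `|x - t|).
      by apply: measurableT_comp => //; exact: measurable_funB.
    apply: measurable_fun_ifT => //; first exact: measurable_fun_ler.
    by apply: measurable_fun_powR_comp; exact: measurable_funB.
  + exact: powR_ge0.
  rewrite (@ge0_integral_sub _ x (fun t =>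
    (if `|t| <= rho then (s x - `|t|) `^ (- 2^-1) else 0)%:E)); last 2 first.
  + apply/measurable_EFinP; apply: measurable_fun_ifT => //; first exact: measurable_fun_ler.
    by apply: measurable_fun_powR_comp; exact: measurable_funB.
  + by move=> t; rewrite lee_fin; case: ifP => // _; exact: powR_ge0.
  apply: (@le_trans _ _ ((s x `^ (- 2^-1))%:E * (4 * s x `^ 2^-1)%:E)%E).
    by rewrite lee_wpmul2l ?lee_fin ?powR_ge0// integral_radial_core.
  rewrite -EFinM lee_fin mulrCA -powRD; last by apply/implyP => _; rewrite gt_eqF.
  by rewrite addrC subrr powRr0 mulr1.
(* Columns: on the support [s t + |t - x| <= 3 * s x], so [(s x)^(-3/2)] is at most [3^(3/2)] times
   the same power of [s t + |t - x|], which is integrable in [x] since [3/2 > 1]. *)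
- change (forall t : R, (\int[mu]_x (k2 (x, t))%:E <= (4 * 3 `^ (3 / 2))%:E)%E).
  move=> t; pose c := s t `^ (2^-1) * 3 `^ (3 / 2).
  have c0 : 0 <= c by rewrite mulr_ge0// powR_ge0.
  apply: (@le_trans _ _ (\int[mu]_x (c%:E * ((s t + `|t - x|) `^ (- (3 / 2)))%:E))%E).
    apply: ge0_le_integral => //.
    + by move=> x _; rewrite lee_fin /k2; case: ifP => // _; rewrite mulr_ge0// powR_ge0.
    + apply/measurable_EFinP; apply: (measurableT_comp (f := k2)) => //.
      by apply: measurable_fun_ifT => //; apply: measurable_funM; exact: mspow.
    + apply: measurable_funeM; apply/measurable_EFinP.
      apply: (measurableT_comp (measurable_decay _ _)); exact: measurable_funB.
    + move=> x _; rewrite -EFinM lee_fin /k2/=; case: ifP => [xt|_]; last first.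
        by rewrite mulr_ge0// powR_ge0.
      rewrite mulrC /c -mulrA ler_wpM2l ?powR_ge0// !powRN.
      have stx0 : 0 < s t + `|t - x| by rewrite ltr_wpDr.
      rewrite -[leLHS]mul1r ler_pdivlMr ?powR_gt0// mulrAC ler_pdivrMr ?powR_gt0// mul1r.
      rewrite -powRM; [|by []|exact: ltW].
      apply: ge0_ler_powR; rewrite ?nnegrE ?divr_ge0 ?mulr_ge0 ?(ltW stx0) ?(ltW (s0 _))//.
      have h : d t - d x <= `|x - t| by rewrite (le_trans (ler_norm _))// distrC.
      rewrite distrC /s; move: xt h e0 (d0 x).
      by move: (d x) (d t) `|x - t| eps => a b z e; lra.
  rewrite ge0_integralZl_EFin//; last 2 first.
  + by move=> x _; rewrite lee_fin powR_ge0.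
  + apply/measurable_EFinP; apply: (measurableT_comp (measurable_decay _ _)).
    exact: measurable_funB.
  rewrite (@ge0_integral_sub _ t (fun x => ((s t + `|x|) `^ (- (3 / 2)))%:E)); last 2 first.
  + by apply/measurable_EFinP; exact: measurable_decay.
  + by move=> y; rewrite lee_fin powR_ge0.
  have q1 : 1 < 3 / 2 :> R by lra.
  have := integral_radial_tail q1 (s0 t) (lexx 0).
  under eq_integral do rewrite normr_ge0.
  rewrite addr0 => H.
  apply: (le_trans (lee_wpmul2l _ H)); first by rewrite lee_fin.
  rewrite -EFinM lee_fin /c (_ : 1 - 3 / 2 = - 2^-1 :> R); last by field.
  rewrite [leLHS](_ : _ = (4 * 3 `^ (3 / 2)) * (s t `^ 2^-1 * s t `^ (- 2^-1))); last by field.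
  rewrite -powRD; last by apply/implyP => _; rewrite gt_eqF.
  by rewrite subrr powRr0 mulr1.
Qed.

End Hardy.

Section PointwiseBound.
Variables (m eps : R) (f v n d : R -> R).
Hypotheses (m2 : 2 < m) (e0 : 0 < eps).
Hypotheses (mf : measurable_fun [set: R] f) (mv : measurable_fun [set: R] v)
  (mn : measurable_fun [set: R] n).
Hypotheses (f0 : forall t, 0 <= f t) (v0 : forall t, 0 <= v t)
  (n0 : forall t, 0 <= n t) (d0 : forall x, 0 <= d x).
Hypotheses (pv : forall t, v (t + 1) = v t) (pn : forall t, n (t + 1) = n t).
Hypotheses (iv : mu.-integrable [set` `[0, 1[] (EFin \o v))
  (iN : mu.-integrable [set` `[0, 1[] (EFin \o n)).

Definition ball_integral x (r : R) : \bar R :=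
  (\int[mu]_t (if (`|x - t| <= r)%R then f t else 0%R)%:E)%E.

Hypothesis v_osc : forall x y, ((`|v y - v x|)%:E <= ball_integral x (`|x - y|)%R)%E.
Hypothesis n_far : forall x y, 0 < n y -> d x <= `|x - y|.
(** The first alternative covers an empty zero set of [v], where the distance [d] carries no
    information. *)
Hypothesis v_core : forall x,
  (forall y, n y = 0) \/ ((v x)%:E <= ball_integral x (d x + eps / 2))%E.

Let m1 : 1 < m. Proof. by apply: lt_trans m2; rewrite ltr1n. Qed.
Let m0 : 0 < m. Proof. exact: lt_trans ltr01 m1. Qed.
Let p := line_kernel m eps.
Let psi := dline_kernel m eps.

Let p0 r : 0 <= p r. Proof. exact: line_kernel_ge0. Qed.

Let mp x : measurable_fun [set: mR] (fun y => p (x - y)).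
Proof.
by apply: (measurableT_comp (measurable_line_kernel m eps)); exact: measurable_funB.
Qed.

Let mpsi x : measurable_fun [set: mR] (fun y => psi (x - y)).
Proof.
by apply: (measurableT_comp (measurable_dline_kernel m eps)); exact: measurable_funB.
Qed.

Let mball2 x : measurable_fun [set: mR * mR]
   (fun q : mR * mR => if `|x - q.1| <= `|x - q.2| then f q.1 else 0).
Proof.
apply: measurable_fun_ifT => //.
- apply: measurable_fun_ler; apply: measurableT_comp => //; exact: measurable_funB.
- exact: (measurableT_comp mf).
Qed.

Let ball_integral_ge0 x r : (0 <= ball_integral x r)%E.
Proof. by apply: integral_ge0 => t _; rewrite lee_fin; case: ifP. Qed.

Let mballE x : measurable_fun [set: mR] (fun y => ball_integral x (`|x - y|)%R).
Proof.
apply: (@measurable_fun_fubini_tonelli_G _ _ _ _ _ mu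
  (fun q : mR * mR => (if `|x - q.1| <= `|x - q.2| then f q.1 else 0)%:E)).
- exact/measurable_EFinP.
- by move=> q; rewrite lee_fin; case: ifP.
Qed.

Let N x := (\int[mu]_t ((eps + `|x - t|) `^ (- (m - 1)) * f t)%:E)%E.

Let N_ge0 x : (0 <= N x)%E.
Proof. by apply: integral_ge0 => t _; rewrite lee_fin mulr_ge0// powR_ge0. Qed.

(** By Tonelli, [f t] is weighted by the kernel mass at distance at least [|x - t|] from [x];
    integrating this tail changes the exponent [-m] into [1 - m]. *)
Lemma integral_kernel_ball x :
  (\int[mu]_y ((p (x - y))%:E * ball_integral x (`|x - y|)%R) <=
   (eps `^ (m - 1))%:E * N x)%E.
Proof.
pose F (q : mR * mR) := p (x - q.2) * (if `|x - q.1| <= `|x - q.2| then f q.1 else 0).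
have mF : measurable_fun [set: mR * mR] (EFin \o F).
  apply/measurable_EFinP; apply: measurable_funM => //.
  exact: (measurableT_comp (mp x)).
have F0 q : (0 <= (EFin \o F) q)%E.
  by rewrite lee_fin mulr_ge0//; case: ifP.
have msec (y : mR) : measurable_fun [set: mR]
    (fun t => (if `|x - t| <= `|x - y| then f t else 0)%:E).
  apply/measurable_EFinP; apply: measurable_fun_ifT => //.
  apply: measurable_fun_ler => //; apply: measurableT_comp => //; exact: measurable_funB.
have -> : (\int[mu]_y ((p (x - y))%:E * ball_integral x (`|x - y|)%R) =
    \int[mu]_y \int[mu]_t (EFin \o F) (t, y))%E.
  apply: eq_integral => y _; rewrite /ball_integral -ge0_integralZl_EFin//.
  by move=> t _; rewrite lee_fin; case: ifP.
rewrite -(fubini_tonelli (m1 := mu) (m2 := mu) (EFin \o F))//.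
rewrite /N -ge0_integralZl_EFin//; last 3 first.
- by move=> t _; rewrite lee_fin mulr_ge0// powR_ge0.
- apply/measurable_EFinP; apply: measurable_funM => //.
  apply: (measurableT_comp (measurable_decay _ _)); exact: measurable_funB.
- exact: powR_ge0.
have mxt : measurable_fun [set: mR] (fun t => `|x - t|).
  by apply: measurableT_comp => //; exact: measurable_funB.
apply: ge0_le_integral => //.
- by move=> t _; apply: integral_ge0 => y _; exact: F0.
- exact: (@measurable_fun_fubini_tonelli_F _ _ _ _ _ mu (EFin \o F)).
- apply: measurable_funeM; apply/measurable_EFinP; apply: measurable_funM => //.
  apply: (measurableT_comp (measurable_decay _ _)); exact: measurable_funB.
- move=> t _.
  have mtail : measurable_fun [set: R] (fun r => (if `|x - t| <= `|r| then p r else 0)%:E).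
    apply/measurable_EFinP; apply: measurable_fun_ifT => //.
      exact: measurable_fun_ler.
    exact: measurable_line_kernel.
  have -> : (\int[mu]_y (EFin \o F) (t, y) = \int[mu]_y ((f t)%:E *
     (if `|x - t| <= `|x - y| then p (x - y) else 0)%:E))%E.
    apply: eq_integral => y _; rewrite /= /F/= -EFinM.
    by case: ifP => _; rewrite ?mulr0// mulrC.
  rewrite ge0_integralZl_EFin//; last 2 first.
  + by move=> y _; rewrite lee_fin; case: ifP.
  + by apply: (measurableT_comp mtail); exact: measurable_funB.
  rewrite (@ge0_integral_sub _ x (fun r => (if `|x - t| <= `|r| then p r else 0)%:E))//; last first.
    by move=> y; rewrite lee_fin; case: ifP.
  apply: (le_trans (lee_wpmul2l _ (integral_line_kernel_tail m1 e0 (normr_ge0 (x - t))))).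
    by rewrite lee_fin.
  by rewrite -!EFinM lee_fin opprB mulrC mulrA.
Qed.

Lemma integral_dline_kernel_eq0 x : \int[mu]_y psi (x - y) = 0.
Proof.
have mpsi' : measurable_fun [set: R] (EFin \o psi).
  by apply/measurable_EFinP; exact: measurable_dline_kernel.
rewrite /Rintegral integralE.
have -> : (\int[mu]_y (fun y => (psi (x - y))%:E)^\+ y =
   \int[mu]_y (EFin \o psi)^\+ y)%E.
  rewrite -(ge0_integral_sub x (f := (EFin \o psi)^\+%E))//.
  - by apply: eq_integral => y _; rewrite !funeposE.
  - exact: measurable_funepos.
have -> : (\int[mu]_y (fun y => (psi (x - y))%:E)^\- y =
   \int[mu]_y (EFin \o psi)^\- y)%E.
  rewrite -(ge0_integral_sub x (f := (EFin \o psi)^\-%E))//.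
  - by apply: eq_integral => y _; rewrite !funenegE.
  - exact: measurable_funeneg.
have -> : (\int[mu]_y (EFin \o psi)^\- y = \int[mu]_y (EFin \o psi)^\+ y)%E.
  rewrite -ge0_integral_reflect//; last exact: measurable_funeneg.
  by apply: eq_integral => y _; rewrite funenegE funeposE /= /psi dline_kernel_odd opprK.
(* For an infinite value the difference is [-oo], which [fine] also sends to 0. *)
by case: (\int[mu]_y (EFin \o psi)^\+ y)%E => //= r; rewrite subrr.
Qed.

Let mpg (g : R -> R) x : measurable_fun [set: R] g ->
  measurable_fun [set: mR] (fun y => (p (x - y) * g y)%:E).
Proof. by move=> mg; apply/measurable_EFinP; exact: measurable_funM. Qed.

Let int_p_fin (g : R -> R) x : measurable_fun [set: R] g -> (forall y, 0 <= g y) ->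
  (forall t, g (t + 1) = g t) -> mu.-integrable [set` `[0, 1[] (EFin \o g) ->
  (\int[mu]_y (p (x - y) * g y)%:E)%E \is a fin_num.
Proof.
move=> mg g0 pg ig; apply: integrable_fin_num => //.
exact: (integrable_line_conv m1 e0 mg pg ig x).
Qed.

(* Positivity of p * (v - n) at x bounds the n-mass by the v-mass. *)
Let int_p_n_le x : 0 < \int[mu]_y (p (x - y) * (v y - n y)) ->
  (\int[mu]_y (p (x - y) * n y)%:E <= (v x)%:E + (eps `^ (m - 1))%:E * N x)%E.
Proof.
move=> U0.
have le1 : (\int[mu]_y (p (x - y) * n y)%:E <= \int[mu]_y (p (x - y) * v y)%:E)%E.
  have Iv := integrable_line_conv m1 e0 mv pv iv x.
  have In := integrable_line_conv m1 e0 mn pn iN x.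
  move: U0; rewrite (@eq_Rintegral _ _ _ mu _ (fun y => p (x - y) * v y - p (x - y) * n y)); last first.
    by move=> y _; rewrite mulrBr.
  rewrite RintegralB// subr_gt0 /Rintegral => /ltW.
  by rewrite -lee_fin !fineK//; exact: int_p_fin.
apply: (le_trans le1).
apply: (@le_trans _ _ (\int[mu]_y ((v x)%:E * (p (x - y))%:E +
   (p (x - y))%:E * ball_integral x (`|x - y|)%R))%E).
  apply: ge0_le_integral => //.
  - by move=> y _; rewrite lee_fin mulr_ge0.
  - exact: mpg.
  - apply: emeasurable_funD; last first.
      by apply: emeasurable_funM => //; exact/measurable_EFinP.
    by apply: measurable_funeM; exact/measurable_EFinP.
  - move=> y _; rewrite muleC -ge0_muleDr//; last by rewrite lee_fin.
    rewrite EFinM; apply: lee_wpmul2l; first by rewrite lee_fin.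
    apply: le_trans (leeD (lexx _) (v_osc x y)).
    by rewrite -EFinD lee_fin -lerBlDl ler_norm.
rewrite ge0_integralD//=; last 4 first.
- by move=> y _; rewrite mule_ge0// lee_fin.
- by apply: measurable_funeM; exact/measurable_EFinP.
- by move=> y _; rewrite mule_ge0// lee_fin.
- by apply: emeasurable_funM => //; exact/measurable_EFinP.
apply: leeD; last exact: integral_kernel_ball.
rewrite ge0_integralZl_EFin//; last 2 first.
- by move=> y _; rewrite lee_fin.
- exact/measurable_EFinP.
rewrite -[leRHS]mule1; apply: lee_wpmul2l; first by rewrite lee_fin.
exact: integral_line_kernel_le1.
Qed.

Let abs_split x :
  ((`|\int[mu]_y (psi (x - y) * (v y - n y))|)%:E <=
   \int[mu]_y (`|psi (x - y)| * `|v y - v x|)%:E +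
   \int[mu]_y (`|psi (x - y)| * n y)%:E)%E.
Proof.
have mvn : measurable_fun [set: R] (fun y => v y - n y) by exact: measurable_funB.
have Ivn : mu.-integrable [set: mR] (EFin \o (fun y => psi (x - y) * (v y - n y))).
  apply: (integrable_dline_conv m1 e0 mvn) => [y|].
    by rewrite pv pn.
  exact: (integrableB _ iv iN).
have Ic c : mu.-integrable [set: mR] (EFin \o (fun y => psi (x - y) * c)).
  apply: (@integrable_dline_conv _ m eps (cst c)) => //.
  apply/integrableP; split; first by apply/measurable_EFinP; exact: measurable_cst.
  have := @integral_cst _ _ _ mu _ (measurable_itv `[0%R, 1%R[) (`|c|%:E).
  rewrite /= lebesgue_measure_itv/= lte_fin ltr01 oppr0 adde0 mule1 => ->.
  exact: ltry.
have I0 : \int[mu]_y (psi (x - y) * v x) = 0.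
  rewrite RintegralZr//; first by rewrite integral_dline_kernel_eq0 mul0r.
  apply: eq_integrable (Ic 1) => // y _; by rewrite /= mulr1.
(* The kernel psi is odd, so the constant v x may be subtracted from v. *)
rewrite -[X in `|X|]subr0 -I0 -RintegralB// EFin_normr_Rintegral//; last first.
  exact: (integrableB _ Ivn (Ic (v x))).
have Isum : measurable_fun [set: mR] (fun y => (psi (x - y) * (v y - n y) - psi (x - y) * v x)%:E).
  by apply/measurable_EFinP; apply: measurable_funB; apply: measurable_funM => //;
    exact: measurable_funB.
have mabs (g : R -> R) : measurable_fun [set: mR] g ->
    measurable_fun [set: mR] (fun y => (`|psi (x - y)| * g y)%:E).
  by move=> mg; apply/measurable_EFinP; apply: measurable_funM => //; exact: measurableT_comp.
have mvx : measurable_fun [set: mR] (fun y => `|v y - v x|).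
  by apply: measurableT_comp => //; exact: measurable_funB.
apply: (le_trans (le_abse_integral _ _ _)) => //.
rewrite -ge0_integralD//; last 3 first.
- exact: mabs.
- by move=> y _; rewrite lee_fin mulr_ge0.
- exact: mabs.
apply: ge0_le_integral => //.
- exact: measurableT_comp.
- by apply: emeasurable_funD; exact: mabs.
- move=> y _; rewrite -EFinD lee_fin -mulrBr normrM -mulrDr ler_wpM2l//.
  rewrite addrAC (le_trans (ler_normB _ _))// lerD2l ger0_norm//.
Qed.

(** The decay integral [N x] arises twice with coefficient m eps^(m-2), from the oscillation of [v]
    and from the bound on the mass of [n]; hence the factor 2. *)
Lemma line_conv_deriv_bound x : 0 < \int[mu]_y (p (x - y) * (v y - n y)) ->
  ((`|\int[mu]_y (psi (x - y) * (v y - n y))|)%:E <=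
   (2 * m * eps `^ (m - 2))%:E * N x +
   m%:E * \int[mu]_t (hardy_kernel d eps x t * f t)%:E)%E.
Proof.
move=> U0; apply: (le_trans (abs_split x)).
set H := (\int[mu]_t (hardy_kernel d eps x t * f t)%:E)%E.
have ed0 : 0 < eps + d x by rewrite ltr_wpDr.
have hk0 t : 0 <= hardy_kernel d eps x t.
  by rewrite /hardy_kernel; case: ifP => // _; rewrite invr_ge0 ltW.
have H0 : (0 <= H)%E by apply: integral_ge0 => t _; rewrite lee_fin mulr_ge0.
have mN0 : (0 <= (m * eps `^ (m - 2))%:E * N x)%E.
  by rewrite mule_ge0// lee_fin mulr_ge0 ?powR_ge0// ltW.
have epsE : eps^-1 * eps `^ (m - 1) = eps `^ (m - 2).
  rewrite -powR_inv1 ?ltW// -powRD; last by apply/implyP => _; rewrite gt_eqF.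
  by congr (_ `^ _); ring.
have part1 : (\int[mu]_y (`|psi (x - y)| * `|v y - v x|)%:E <=
    (m * eps `^ (m - 2))%:E * N x)%E.
  apply: (@le_trans _ _ (\int[mu]_y ((m / eps)%:E *
     ((p (x - y))%:E * ball_integral x (`|x - y|)%R)))%E).
    apply: ge0_le_integral => //.
    - apply/measurable_EFinP; apply: measurable_funM; apply: measurableT_comp => //.
      exact: measurable_funB.
    - apply: measurable_funeM; apply: emeasurable_funM => //; exact/measurable_EFinP.
    - move=> y _; rewrite [leLHS]EFinM [leRHS]muleA -[X in (_ <= X * _)%E]EFinM.
      apply: lee_pmul => //; rewrite ?lee_fin//.
      exact: dline_kernel_le_eps.
  rewrite ge0_integralZl_EFin//; last 3 first.
  - by move=> y _; rewrite mule_ge0// lee_fin.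
  - by apply: emeasurable_funM => //; exact/measurable_EFinP.
  - by rewrite divr_ge0// ltW.
  have -> : ((m * eps `^ (m - 2))%:E * N x =
      (m / eps)%:E * ((eps `^ (m - 1))%:E * N x))%E.
    by rewrite muleA -EFinM -mulrA epsE.
  apply: lee_wpmul2l; last exact: integral_kernel_ball.
  by rewrite lee_fin divr_ge0// ltW.
have part2 : (\int[mu]_y (`|psi (x - y)| * n y)%:E <=
    (m * eps `^ (m - 2))%:E * N x + m%:E * H)%E.
  have [nz|vx] := v_core x.
    rewrite integral0_eq; last by move=> y _; rewrite nz mulr0.
    by rewrite adde_ge0// mule_ge0// lee_fin ltW.
  apply: (@le_trans _ _ (\int[mu]_y ((m / (eps + d x))%:E * (p (x - y) * n y)%:E))%E).
    apply: ge0_le_integral => //.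
    - by move=> y _; rewrite lee_fin mulr_ge0.
    - apply/measurable_EFinP; apply: measurable_funM => //; exact: measurableT_comp.
    - by apply: measurable_funeM; exact: mpg.
    - move=> y _; rewrite -EFinM lee_fin mulrA.
      have := n0 y; rewrite le_eqVlt => /orP[/eqP <-|ny]; first by rewrite !mulr0.
      rewrite ler_wpM2r//; apply: (le_trans (dline_kernel_le _ m1 e0)).
      rewrite ler_wpM2r// ler_wpM2l// ?(ltW m0)// lef_pV2 ?posrE//; last first.
        by rewrite ltr_wpDr.
      by rewrite lerD2l n_far.
  rewrite ge0_integralZl_EFin//; last 3 first.
  - by move=> y _; rewrite lee_fin mulr_ge0.
  - exact: mpg.
  - by rewrite divr_ge0// ltW.
  have med0 : 0 <= m / (eps + d x) by rewrite divr_ge0// ltW.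
  apply: (le_trans (lee_wpmul2l _ (int_p_n_le U0))); first by rewrite lee_fin.
  rewrite ge0_muleDr//; last 2 first.
  - by rewrite lee_fin.
  - by rewrite mule_ge0// lee_fin powR_ge0.
  (* The weight [(eps + d x)^-1] is relaxed to [eps^-1] on the decay integral, but kept on [v x],
     where it forms the Hardy kernel. *)
  rewrite addeC; apply: leeD.
    rewrite muleA -EFinM; apply: lee_wpmul2r => //.
    rewrite lee_fin -epsE mulrA ler_wpM2r ?powR_ge0// ler_wpM2l ?(ltW m0)//.
    by rewrite lef_pV2 ?posrE// lerDl.
  rewrite EFinM -muleA; apply: lee_wpmul2l; first by rewrite lee_fin ltW.
  have ei0 : 0 <= (eps + d x)^-1 by rewrite invr_ge0 ltW.
  apply: (le_trans (lee_wpmul2l _ vx)); first by rewrite lee_fin.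
  rewrite /ball_integral -ge0_integralZl_EFin//; last 2 first.
  - by move=> t _; rewrite lee_fin; case: ifP.
  - apply/measurable_EFinP; apply: measurable_fun_ifT => //.
    apply: measurable_fun_ler => //; apply: measurableT_comp => //; exact: measurable_funB.
  rewrite /H le_eqVlt; apply/orP; left; apply/eqP; apply: eq_integral => t _.
  by rewrite -EFinM /hardy_kernel; case: ifP => // _; rewrite mulr0 mul0r.
apply: (le_trans (leeD part1 part2)).
rewrite addeA le_eqVlt; apply/orP; left; apply/eqP; congr (_ + _)%E.
rewrite -ge0_muleDl//.
- by rewrite -EFinD; congr (_%:E * _)%E; ring.
- by rewrite lee_fin mulr_ge0 ?powR_ge0// ltW.
- by rewrite lee_fin mulr_ge0 ?powR_ge0// ltW.
Qed.

End PointwiseBound.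

End SchurKernels.

(** * Weak derivatives *)

Section TorusFunctions.
Context {R : realType}.
Notation mu := (@lebesgue_measure R).
Notation mR := (measurableTypeR R).

Lemma torus_Lp1P (f : R -> R) : torus_Lp 1%E f <->
  [/\ periodic f 1, measurable_fun [set: R] f &
      mu.-integrable [set` `[0, 1[] (EFin \o f)].
Proof.
split=> [[pf /Lfun1_integrable iF]|[pf mf iF]].
  have mf : measurable_fun [set: R] f.
    by apply/measurable_EFinP; exact: (measurable_int _ iF).
  by split => //; apply/torus_integrableP => //; exact/measurable_EFinP.
split=> //; apply/Lfun1_integrable; apply/torus_integrableP => //.
exact/measurable_EFinP.
Qed.

Lemma continuous_integrable_itv (f : R -> R) (a b : R) : continuous f ->
  mu.-integrable [set` `[a, b]] (EFin \o f).
Proof.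
move=> cf; apply: continuous_compact_integrable; first exact: segment_compact.
exact: continuous_subspaceT.
Qed.

Lemma continuous_integrable01 (f : R -> R) : continuous f ->
  mu.-integrable [set` `[0, 1[] (EFin \o f).
Proof.
move=> cf; apply: integrableS (continuous_integrable_itv 0 1 cf) => //.
by apply: subset_itvl; rewrite bnd_simp.
Qed.

Lemma Rintegral_deriv_periodic (F f : R -> R) : periodic F 1 ->
  (forall x : R, is_derive x 1 F (f x)) -> continuous f ->
  \int[mu]_(x in `[0, 1]) f x = 0.
Proof.
move=> pF dF cf.
have cF : continuous F.
  move=> x; apply/differentiable_continuous/derivable1_diffP.
  exact: (@ex_derive _ _ _ _ _ _ _ (dF x)).
rewrite /Rintegral (@continuous_FTC2 _ f F)//.
- by rewrite -EFinB/= -[X in F X](add0r 1) pF subrr.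
- exact: continuous_subspaceT.
- split=> [x _||].
  + exact: (@ex_derive _ _ _ _ _ _ _ (dF x)).
  + by apply: cvg_at_right_filter; exact: cF.
  + by apply: cvg_at_left_filter; exact: cF.
- by move=> x _; rewrite derive1E; exact: (@derive_val _ _ _ _ _ _ _ (dF x)).
Qed.

(** Squaring removes the corner of the positive part: the first-order remainder is at most [h ^+ 2],
    whatever the signs of [s] and [s + h]. *)
Lemma is_derive_max0_sqr (s : R) :
  is_derive s 1 (fun s : R => Num.max s 0 ^+ 2) (2 * Num.max s 0).
Proof.
suff H : h^-1 *: (Num.max (h *: (1 : R) + s) 0 ^+ 2 - Num.max s 0 ^+ 2) @[h --> 0^'] -->
    2 * Num.max s 0.
  apply: DeriveDef; first by apply/cvg_ex; eexists; exact: H.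
  by apply/cvg_lim; first exact: Rhausdorff.
have key (h : R) :
    `|Num.max (h + s) 0 ^+ 2 - Num.max s 0 ^+ 2 - 2 * Num.max s 0 * h| <= h ^+ 2.
  rewrite ler_norml.
  by case: (leP (h + s) 0) => h1; case: (leP s 0) => h2; apply/andP; split; nra.
apply/cvgrPdist_le => e e0; near=> h.
have h0 : h != 0 by near: h; exact: nbhs_dnbhs_neq.
have he : `|h| <= e.
  near: h; apply: dnbhs0_le => //.
rewrite distrC /GRing.scale/= mulr1.
have -> : h^-1 * (Num.max (h + s) 0 ^+ 2 - Num.max s 0 ^+ 2) - 2 * Num.max s 0 =
   h^-1 * (Num.max (h + s) 0 ^+ 2 - Num.max s 0 ^+ 2 - 2 * Num.max s 0 * h).
  by field.
rewrite normrM normfV ler_pdivrMl ?normr_gt0//.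
apply: (le_trans (key h)).
by rewrite -real_normK ?num_real// expr2 ler_wpM2l.
Unshelve. all: by end_near. Qed.

End TorusFunctions.

(** * Weak derivative of the positive part of a C^1 periodic function *)

Section PositivePart.
Context {R : realType}.
Notation mu := (@lebesgue_measure R).
Notation mR := (measurableTypeR R).
Variables (U D : R -> R) (c : R).
Hypotheses (pU : periodic U 1) (pD : periodic D 1)
  (dU : forall x : R, is_derive x 1 U (D x)) (cD : continuous D).

Let H x : R := Num.max (U x - c) 0.
Let w x : R := if c < U x then D x else 0.

Let H0 x : 0 <= H x. Proof. by rewrite /H le_max lexx orbT. Qed.

Let cU : continuous U.
Proof.
move=> x; apply/differentiable_continuous/derivable1_diffP.
exact: (@ex_derive _ _ _ _ _ _ _ (dU x)).
Qed.

Let cH : continuous H.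
Proof.
have -> : H = fun x => (U x - c + `|U x - c|) / 2.
  by apply/funext => x; rewrite /H maxr_absE addr0 subr0.
move=> x; apply: cvgMl; apply: cvgD; last apply: cvg_norm.
  by apply: cvgB; [exact: cU|exact: cvg_cst].
by apply: cvgB; [exact: cU|exact: cvg_cst].
Qed.

Let mw : measurable_fun [set: R] w.
Proof.
apply: measurable_fun_ifT => //.
  by apply: measurable_fun_ltr => //; exact: continuous_measurable_fun.
exact: continuous_measurable_fun.
Qed.

Let wE x : w x = (H x != 0)%:R * D x.
Proof.
rewrite /w /H; case: ltP => Uc.
  by rewrite max_l ?subr_ge0 ?ltW// subr_eq0 gt_eqF// mul1r.
by rewrite max_r ?subr_le0// eqxx mul0r.
Qed.

Let w_le x : `|w x| <= `|D x|.
Proof. by rewrite /w; case: ifP => // _; rewrite normr0. Qed.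

Let smooth_cvg (phi dphi : R -> R) : periodic phi 1 ->
  (forall x : R, is_derive x 1 phi (dphi x)) -> continuous dphi ->
  \int[mu]_(x in `[0, 1]) (w x * phi x + H x * dphi x) = 0.
Proof.
move=> pphi dderiv cdphi.
have cphi : continuous phi.
  move=> x; apply/differentiable_continuous/derivable1_diffP.
  exact: (@ex_derive _ _ _ _ _ _ _ (dderiv x)).
pose delta (k : nat) : R := k.+1%:R^-1.
have delta0 k : 0 < delta k by rewrite invr_gt0.
have delta1 k : delta k <= 1 by rewrite invf_le1// ler1n.
(* sqrt (H^2 + delta^2) is a C^1 approximation of H = (U - c)^+, since H^2 is
   already C^1. *)
pose S k x : R := Num.sqrt (H x ^+ 2 + delta k ^+ 2).
have HD0 k x : 0 < H x ^+ 2 + delta k ^+ 2.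
  by rewrite ltr_wpDl ?sqr_ge0// exprn_gt0.
have S0 k x : 0 < S k x by rewrite sqrtr_gt0.
have HS k x : H x <= S k x.
  rewrite -[leLHS](ger0_norm (H0 x)) -sqrtr_sqr ler_wsqrtr// lerDl sqr_ge0//.
have SHd k x : S k x <= H x + delta k.
  have Hd0 : 0 <= H x + delta k by rewrite addr_ge0// ltW.
  rewrite -[leRHS](ger0_norm Hd0) -sqrtr_sqr ler_wsqrtr// sqrrD.
  by rewrite lerD2r lerDl mulrn_wge0// mulr_ge0// ltW.
have SH k x : S k x <= H x + 1 by rewrite (le_trans (SHd k x))// lerD2l.
have dS k (x : R) : is_derive x 1 (S k) (H x * D x / S k x).
  have d1 : is_derive x 1 (fun x => U x - c) (D x).
    by rewrite -[X in is_derive _ _ _ X]subr0; apply: is_deriveB.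
  have d2 := @is_derive1_comp _ _ _ x _ _ (is_derive_max0_sqr (U x - c)) d1.
  have d3 : is_derive x 1 (fun x => H x ^+ 2 + delta k ^+ 2) (2 * H x * D x).
    by rewrite -[X in is_derive _ _ _ X]addr0; apply: is_deriveD.
  have d4 := @is_derive1_comp _ _ _ x _ _ (is_derive1_sqrt (HD0 k x)) d3.
  apply: (is_derive_eq d4); rewrite -/(S k x).
  by field; rewrite gt_eqF.
pose f k x := H x * D x / S k x * phi x + S k x * dphi x.
have cS k : continuous (S k).
  move=> x; apply/differentiable_continuous/derivable1_diffP.
  exact: (@ex_derive _ _ _ _ _ _ _ (dS k x)).
have cf k : continuous (f k).
  move=> x; apply: cvgD; apply: cvgM; [|exact: cphi|exact: cS|exact: cdphi].
  apply: cvgM; first by apply: cvgM; [exact: cH|exact: cD].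
  by apply: cvgV; [rewrite gt_eqF|exact: cS].
have int0 k : \int[mu]_(x in `[0, 1]) f k x = 0.
  apply: (@Rintegral_deriv_periodic _ (fun x => S k x * phi x)) => //.
    by move=> x; rewrite pphi /S /H pU.
  move=> x; have := @is_deriveM _ _ _ _ x 1 _ _ (dS k x) (dderiv x).
  move=> dd; apply: (is_derive_eq dd).
  by rewrite /GRing.scale/= addrC mulrC.
have cg : continuous (fun x => `|D x| * `|phi x| + (H x + 1) * `|dphi x|).
  move=> x; apply: cvgD; apply: cvgM.
  - by apply: cvg_norm; exact: cD.
  - by apply: cvg_norm; exact: cphi.
  - by apply: cvgD; [exact: cH|exact: cvg_cst].
  - by apply: cvg_norm; exact: cdphi.
have delta_cvg : delta k @[k --> \oo] --> (0 : R) by exact: cvg_harmonic.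
have S_cvg x : S k x @[k --> \oo] --> H x.
  apply: (@squeeze_cvgr _ _ _ _ (cst (H x)) (fun k => H x + delta k)).
  - by apply: nearW => k; rewrite HS SHd.
  - exact: cvg_cst.
  - by rewrite -[X in _ --> X]addr0; apply: cvgD; [exact: cvg_cst|].
(* Where [H x = 0] the derivative of [S k] is 0 for every [k]; elsewhere [H x / S k x] tends to 1.
   Hence the limit derivative vanishes on the level set [U x = c]. *)
have f_cvg x : f k x @[k --> \oo] --> w x * phi x + H x * dphi x.
  apply: cvgD; apply: cvgMl => //.
  rewrite wE; have [->|Hx] := eqVneq (H x) 0.
    by under eq_fun do rewrite !mul0r; rewrite mul0r; exact: cvg_cst.
  rewrite mul1r -[X in _ --> X](mulfK Hx) (mulrC (D x)).
  apply: cvgMr; apply: cvgV => //; exact: S_cvg.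
have cvg0 : \int[mu]_(x in `[0, 1]) f k x @[k --> \oo] -->
    \int[mu]_(x in `[0, 1]) (w x * phi x + H x * dphi x).
  apply: (@Rintegral_dominated_cvg _ _ _ mu _ _ f _
     (fun x => `|D x| * `|phi x| + (H x + 1) * `|dphi x|)) => //.
  - move=> k; apply: measurable_funTS; exact: continuous_measurable_fun.
  - apply: measurable_funTS; apply: measurable_funD; apply: measurable_funM => //;
      exact: continuous_measurable_fun.
  - exact: aeW.
  - exact: continuous_integrable_itv.
  - move=> k x _; rewrite /f (le_trans (ler_normD _ _))//.
    rewrite !normrM normfV (gtr0_norm (S0 k x)) (ger0_norm (H0 x)) lerD//.
      rewrite ler_wpM2r// mulrAC ler_piMl//.
      by rewrite ler_pdivrMr// mul1r HS.
    by rewrite ler_wpM2r.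
have cvg0' : \int[mu]_(x in `[0, 1]) f k x @[k --> \oo] --> (0 : R).
  by under eq_fun do rewrite int0; exact: cvg_cst.
by apply: cvg_unique cvg0 cvg0'; exact: Rhausdorff.
Qed.

Lemma weak_derivative_pos_part :
  is_weak_derivative (fun x => U x - c)^\+ (fun x => if c < U x then D x else 0).
Proof.
have mH : measurable_fun [set: R] H by exact: continuous_measurable_fun.
have iw : mu.-integrable [set` `[0, 1[] (EFin \o w).
  apply: le_integrable (continuous_integrable01 cD) => //.
    by apply: measurable_funTS; exact/measurable_EFinP.
  by move=> x _; rewrite /= lee_fin.
split.
- apply/torus_Lp1P; split => //; last exact: continuous_integrable01.
  by move=> x; rewrite /funrpos pU.
- by apply/torus_Lp1P; split => // x; rewrite pU pD.
move=> phi [pphi sphi].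
have dphi (x : R) : is_derive x 1 phi (derive1 phi x).
  by apply: DeriveDef; [exact: (sphi 0%N x)|rewrite derive1E].
have cdphi : continuous (derive1 phi).
  move=> x; apply/differentiable_continuous/derivable1_diffP.
  by have := sphi 1%N x; rewrite derive1n1.
have cphi : continuous phi.
  move=> x; apply/differentiable_continuous/derivable1_diffP.
  exact: (sphi 0%N x).
have := smooth_cvg pphi dphi cdphi.
have iwphi : mu.-integrable [set` `[0, 1]] (EFin \o (fun x => w x * phi x)).
  have cDphi : continuous (fun x => D x * phi x).
    by move=> x; apply: cvgM; [exact: cD|exact: cphi].
  apply: le_integrable (continuous_integrable_itv 0 1 cDphi) => //.
    apply: measurable_funTS; apply/measurable_EFinP; apply: measurable_funM => //.
    exact: continuous_measurable_fun.
  by move=> x _; rewrite /= lee_fin !normrM ler_wpM2r.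
have iHphi : mu.-integrable [set` `[0, 1]] (EFin \o (fun x => H x * derive1 phi x)).
  apply: continuous_integrable_itv => x.
  by apply: cvgM; [exact: cH|exact: cdphi].
have S01 : [set` `[(0 : R), 1[] `<=` [set` `[(0 : R), 1]].
  by apply: subset_itvl; rewrite bnd_simp.
rewrite RintegralD// => /eqP; rewrite addrC addr_eq0 => /eqP.
rewrite !Rintegral_torus; last 2 first.
- by apply: measurable_funM => //; exact: continuous_measurable_fun.
- by apply: measurable_funM => //; exact: continuous_measurable_fun.
rewrite !Rintegral_itv_bndo_bndc//.
- exact: integrableS iwphi.
- exact: integrableS iHphi.
Qed.

End PositivePart.

(** * Primitives of integrable periodic functions *)

Section Primitive.
Context {R : realType}.
Notation mu := (@lebesgue_measure R).
Notation mR := (measurableTypeR R).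
Implicit Types (h : R -> R) (a b x y : R).

Lemma measurable_Rintegral_param (F : mR * mR -> R) : measurable_fun [set: mR * mR] F ->
  measurable_fun [set: mR] (fun x => \int[mu]_t F (x, t)).
Proof.
move=> mF.
have mEF : measurable_fun [set: mR * mR] (EFin \o F) by exact/measurable_EFinP.
apply: (measurableT_comp (f := fine)) => //.
under eq_fun do rewrite integralE.
apply: emeasurable_funB.
- rewrite (_ : (fun x => _) = fun x => (\int[mu]_t (EFin \o F)^\+ (x, t))%E).
    apply: (@measurable_fun_fubini_tonelli_F _ _ _ _ _ mu (EFin \o F)^\+%E) => //.
    exact: measurable_funepos.
  by apply/funext => x; apply: eq_integral => t _; rewrite !funeposE.
- rewrite (_ : (fun x => _) = fun x => (\int[mu]_t (EFin \o F)^\- (x, t))%E).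
    apply: (@measurable_fun_fubini_tonelli_F _ _ _ _ _ mu (EFin \o F)^\-%E) => //.
    exact: measurable_funeneg.
  by apply/funext => x; apply: eq_integral => t _; rewrite !funenegE.
Qed.

Lemma integral_periodic (h : R -> R) (s : R) : measurable_fun [set: R] h ->
  (forall x, h (x + 1) = h x) ->
  (\int[mu]_(x in `[s, (s + 1)%R[) (h x)%:E = \int[mu]_(x in `[0%R, 1%R[) (h x)%:E)%E.
Proof.
move=> mh ph; have meh : measurable_fun [set: R] (EFin \o h) by exact/measurable_EFinP.
rewrite integralE [RHS]integralE; congr (_ - _)%E; apply: ge0_integral_periodic => //.
- exact: measurable_funepos.
- by move=> x; rewrite !funeposE /= ph.
- exact: measurable_funeneg.
- by move=> x; rewrite !funenegE /= ph.
Qed.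

Lemma periodic_integrable_itv (h : R -> R) a b : measurable_fun [set: R] h ->
  (forall x, h (x + 1) = h x) -> mu.-integrable [set` `[0, 1[] (EFin \o h) ->
  mu.-integrable [set` `[a, b]] (EFin \o h).
Proof.
move=> mh ph ih.
have meh : measurable_fun [set: R] (EFin \o h) by exact/measurable_EFinP.
have mah : measurable_fun [set: R] (fun x => `|(h x)%:E|)%E by exact: measurableT_comp.
have fin (n : nat) : (\int[mu]_(x in `[a, (a + n%:R)%R[) `|(h x)%:E| < +oo)%E.
  elim: n => [|n IH].
    by rewrite addr0 set_itvco0 integral_set0 ltry.
  rewrite (@ge0_integral_itv_split _ a (a + n%:R) (a + n.+1%:R)) //.
  - rewrite lte_add_pinfty// -natr1 addrA.
    rewrite (@ge0_integral_periodic _ _ (fun x => `|(h x)%:E|)%E)//.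
      by have /integrableP[] := ih.
    by move=> x; rewrite ph.
  - by rewrite lerDl.
  - by rewrite lerD2l ler_nat.
apply/integrableP; split; first exact: measurable_funTS.
set n := (Num.truncn (b - a)).+1.
apply: le_lt_trans (fin n); apply: ge0_subset_integral => //.
  exact: measurable_funTS.
move=> x; rewrite /= !in_itv/= => /andP[-> xb]/=.
apply: (le_lt_trans xb); rewrite -ltrBlDl.
exact: truncnS_gt.
Qed.

(** A numerical indicator: [below x t - below 0 t] is the signed indicator of the interval between 0
    and [x], so one formula, jointly measurable in [x] and [t], defines the primitive for both signs
    of [x]. *)
Definition below (x t : R) : R := if t <= x then 1 else 0.

Definition primitive h x : R := \int[mu]_t ((below x t - below 0 t) * h t).

Section PrimitiveTheory.
Variable h : R -> R.
Hypothesis mh : measurable_fun [set: R] h.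
Hypothesis ih : forall a b, mu.-integrable [set` `[a, b]] (EFin \o h).

Let mle (x : R) : measurable_fun [set: mR] (below x).
Proof. by apply: measurable_fun_ifT => //; exact: measurable_fun_ler. Qed.

Let ihoc a b : mu.-integrable [set` `]a, b]] (EFin \o h).
Proof.
by apply: integrableS (ih a b) => //; apply: subset_itvr; rewrite bnd_simp.
Qed.

Let iprim x y :
  mu.-integrable [set: mR] (EFin \o (fun t => (below y t - below x t) * h t)).
Proof.
set a := Num.min x y; set b := Num.max x y.
have mab : measurable ([set` `[a, b]] : set mR) by exact: measurable_itv.
have G := (@integrable_mkcond _ mR R mu _ (EFin \o h) mab).1 (ih a b).
apply: (le_integrable measurableT _ _ G).
  apply/measurable_EFinP; apply: measurable_funM => //; apply: measurable_funB; exact: mle.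
move=> t _ /=; rewrite /below /patch mem_setE in_itv/= ge_min le_max.
case: (leP x t) => xt; case: (leP t x) => tx; case: (leP y t) => yt; case: (leP t y) => ty /=;
  rewrite ?subrr ?subr0 ?sub0r ?mul0r ?mul1r ?mulN1r ?normrN ?normr0 ?lee_fin ?normr_ge0//=;
  lra.
Qed.

Lemma primitive_sub x y : x <= y ->
  primitive h y - primitive h x = \int[mu]_(t in `]x, y]) h t.
Proof.
move=> xy; rewrite /primitive -RintegralB//.
rewrite [RHS]Rintegral_mkcond; apply: eq_Rintegral => t _.
rewrite /below /patch mem_setE in_itv/= -mulrBl opprB addrA subrK.
case: (leP t y) => ty /=; rewrite ?andbF ?andbT.
  by rewrite ltNge; case: (leP t x) => tx; rewrite ?subrr ?subr0 ?mul0r ?mul1r.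
by rewrite leNgt (le_lt_trans xy ty)/= subrr mul0r.
Qed.

Lemma measurable_primitive : measurable_fun [set: R] (primitive h).
Proof.
apply: (@measurable_Rintegral_param (fun q : mR * mR => (below q.1 q.2 - below 0 q.2) * h q.2)).
apply: measurable_funM; last exact: (measurableT_comp mh).
apply: measurable_funB; last exact: (measurableT_comp (mle 0)).
by apply: measurable_fun_ifT => //; exact: measurable_fun_ler.
Qed.

Lemma primitive_periodic : (forall x, h (x + 1) = h x) ->
  \int[mu]_(t in `[0, 1[) h t = 0 -> forall x, primitive h (x + 1) = primitive h x.
Proof.
move=> ph h0 x; apply/eqP; rewrite -subr_eq0 primitive_sub ?lerDl//; apply/eqP.
rewrite Rintegral_itv_obnd_cbnd//.
rewrite -Rintegral_itv_bndo_bndc; last first.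
  apply: integrableS (ih x (x + 1)) => //.
  by apply: subset_itvl; rewrite bnd_simp.
by rewrite -h0 /Rintegral integral_periodic.
Qed.

Lemma primitive_osc x y : ((`|primitive h y - primitive h x|)%:E <=
  ball_integral (fun t => `|h t|)%R x (`|x - y|)%R)%E.
Proof.
have H (a b : R) : a <= b -> ((`|primitive h b - primitive h a|)%:E <=
    \int[mu]_(t in `[a, b]) (`|h t|)%:E)%E.
  move=> ab; rewrite primitive_sub// Rintegral_itv_obnd_cbnd//.
  rewrite EFin_normr_Rintegral//.
  apply: (le_trans (le_abse_integral _ _ _)) => //.
  by apply: measurable_funTS; exact/measurable_EFinP.
have mball : measurable_fun [set: mR] (fun t => (if `|x - t| <= `|x - y| then `|h t| else 0)%:E).
  apply/measurable_EFinP; apply: measurable_fun_ifT => //.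
    apply: measurable_fun_ler => //; apply: measurableT_comp => //.
    exact: measurable_funB.
  exact: measurableT_comp.
have H2 (a b : R) : (forall t, a <= t <= b -> `|x - t| <= `|x - y|) ->
   (\int[mu]_(t in `[a, b]) (`|h t|)%:E <= ball_integral (fun t => `|h t|)%R x (`|x - y|)%R)%E.
  move=> sub; rewrite /ball_integral integral_mkcond; apply: ge0_le_integral => //.
  - by move=> t _; rewrite /patch; case: ifP => // _; rewrite lee_fin.
  - apply: (iffLR (measurable_restrictT _ (measurable_itv _))).
    apply: measurable_funTS; apply/measurable_EFinP; exact: measurableT_comp.
  - move=> t _; rewrite /patch mem_setE in_itv/=; case: ifP => [/sub ->//|_].
    by rewrite lee_fin; case: ifP.
have [xy|yx] := leP x y.
  apply: le_trans (H _ _ xy) (H2 _ _ _) => t /andP[xt ty].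
  by rewrite !(distrC x) !ger0_norm ?subr_ge0// lerD2r.
rewrite distrC; apply: le_trans (H _ _ (ltW yx)) (H2 _ _ _) => t /andP[yt tx].
by rewrite !ger0_norm ?subr_ge0 ?(ltW yx)// lerD2l lerN2.
Qed.

Lemma is_derive_primitive x : {for x, continuous h} ->
  is_derive x 1 (primitive h) (h x).
Proof.
move=> ch.
have x1x : x - 1 < x by rewrite ltrBlDr ltrDl.
have xx1 : x < x + 1 by rewrite ltrDl.
have [] := @continuous_FTC1 R h (BRight (x - 1)) x (x + 1) xx1 _ _ ch.
- exact: ihoc.
- exact: x1x.
set F := (X in derivable X) => dF dFE.
have near_F : \forall y \near x, primitive h (x - 1) + F y = primitive h y.
  near=> y.
  have xy : x - 1 <= y by apply: ltW; near: y; exact: lt_nbhsr.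
  by rewrite /F -primitive_sub// addrC subrK.
have F' : is_derive x 1 F (h x) by apply: DeriveDef; [exact: dF|rewrite -dFE derive1E].
have H : is_derive x 1 (fun y => primitive h (x - 1) + F y) (0 + h x).
  by apply: is_deriveD.
by rewrite add0r in H; exact: near_eq_is_derive near_F H.
Unshelve. all: by end_near. Qed.

End PrimitiveTheory.
End Primitive.

(** * Smooth periodic test functions *)

Section Smooth.
Context {R : realType}.
Implicit Types (f g : R -> R).

(* A class of functions closed under differentiation; hence it consists of smooth
   functions. *)
Inductive elementary : (R -> R) -> Prop :=
| elementary_cst (c : R) : elementary (fun=> c)
| elementary_sin (a b : R) : elementary (fun x => sin (a * x + b))
| elementary_cos (a b : R) : elementary (fun x => cos (a * x + b))
| elementary_exp f : elementary f -> elementary (fun x => expR (f x))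
| elementary_add f g : elementary f -> elementary g -> elementary (fun x => f x + g x)
| elementary_mul f g : elementary f -> elementary g -> elementary (fun x => f x * g x).

Lemma is_derive_affine (a b x : R) : is_derive x 1 (fun x : R => a * x + b) a.
Proof.
have H : is_derive x 1 (fun x : R => a * x + b) (a *: (1 : R) + 0).
  by apply: is_deriveD.
by apply: (is_derive_eq H); rewrite addr0 /GRing.scale/= mulr1.
Qed.

Lemma elementary_derive f : elementary f ->
  exists2 g, elementary g & forall x : R, is_derive x 1 f (g x).
Proof.
elim=> {f} [c|a b|a b|f ef [g eg fg]|f h ef [g eg fg] eh [k ek hk]|
    f h ef [g eg fg] eh [k ek hk]].
- exists (fun=> 0); first exact: elementary_cst.
  by move=> x; exact: is_derive_cst.
- exists (fun x => cos (a * x + b) * a).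
    by apply: elementary_mul; [exact: elementary_cos|exact: elementary_cst].
  by move=> x; exact: (is_derive1_comp (is_derive_sin _) (is_derive_affine a b x)).
- exists (fun x => - 1 * sin (a * x + b) * a).
    apply: elementary_mul; last exact: elementary_cst.
    by apply: elementary_mul; [exact: elementary_cst|exact: elementary_sin].
  move=> x; rewrite mulN1r.
  exact: (is_derive1_comp (is_derive_cos _) (is_derive_affine a b x)).
- exists (fun x => expR (f x) * g x).
    by apply: elementary_mul => //; exact: elementary_exp.
  by move=> x; exact: (is_derive1_comp (is_derive_expR _) (fg x)).
- exists (fun x => g x + k x); first exact: elementary_add.
  by move=> x; exact: is_deriveD.
- exists (fun x => f x * k x + h x * g x).
    by apply: elementary_add; exact: elementary_mul.
  by move=> x; exact: is_deriveM.
Qed.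

(** Asking that the derivative [g] be elementary, rather than [f], admits primitives of elementary
    functions as test functions. *)
Lemma elementary_smooth f g : elementary g -> (forall x : R, is_derive x 1 f (g x)) ->
  forall (n : nat) (x : R), derivable (derive1n n f) x 1.
Proof.
move=> eg fg n; elim: n f g eg fg => [|n IH] f g eg fg x.
  exact: (@ex_derive _ _ _ _ _ _ _ (fg x)).
rewrite derive1Sn.
have -> : f^`()%classic = g.
  by apply/funext => y; rewrite derive1E; exact: (@derive_val _ _ _ _ _ _ _ (fg y)).
by have [h eh gh] := elementary_derive eg; exact: IH eh gh x.
Qed.

Lemma elementary_continuous f : elementary f -> continuous f.
Proof.
move=> /elementary_derive[g _ fg] x.
apply/differentiable_continuous/derivable1_diffP.
exact: (@ex_derive _ _ _ _ _ _ _ (fg x)).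
Qed.

(* As n tends to infinity this approximates the indicator function of ]0, b[ + Z. *)
Definition smooth_step (b : R) (n : nat) (x : R) : R :=
  expR (- 1 * expR (- n%:R * (sin (pi * x + 0) * sin (- pi * x + pi * b)))).

Lemma elementary_smooth_step b n : elementary (smooth_step b n).
Proof.
apply: elementary_exp; apply: elementary_mul; first exact: elementary_cst.
apply: elementary_exp; apply: elementary_mul; first exact: elementary_cst.
by apply: elementary_mul; exact: elementary_sin.
Qed.

(** Each sine changes sign under translation by 1, so their product is unchanged. *)
Lemma smooth_step_periodic b n : periodic (smooth_step b n) 1.
Proof.
move=> x; rewrite /smooth_step.
have -> : pi * (x + 1) + 0 = pi * x + 0 + pi by ring.
have -> : - pi * (x + 1) + pi * b = (- pi * x + pi * b) - pi by ring.
by rewrite sinDpi sinB sinpi cospi mulr0 subr0 mulrN1 mulrNN.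
Qed.

Lemma smooth_step_bound b n x : 0 <= smooth_step b n x <= 1.
Proof.
by rewrite expR_ge0/= -[leRHS]expR0 ler_expR mulN1r oppr_le0 expR_ge0.
Qed.

(** On []0, 1[] the product of sines is positive before [b] and negative after it, so the inner
    exponential tends to 0 or to infinity and the outer one to 1 or 0. *)
Lemma smooth_step_cvg b x : 0 < b < 1 -> 0 < x < 1 -> x != b ->
  smooth_step b n x @[n --> \oo] --> (if x < b then 1 else 0 : R).
Proof.
move=> /andP[b0 b1] /andP[x0 x1] xb.
set s := sin (pi * x + 0) * sin (- pi * x + pi * b).
have sx : 0 < sin (pi * x + 0).
  rewrite addr0; apply: sin_gt0_pi.
  by rewrite mulr_gt0 ?pi_gt0//= gtr_pMr ?pi_gt0.
have eb : - pi * x + pi * b = pi * (b - x) by ring.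
have H (r : R) : 0 < r -> expR (- (n%:R * r)) @[n --> \oo] --> (0 : R).
  move=> r0; apply: (@cvg_comp _ _ _ (fun n : nat => n%:R * r) (fun t : R => expR (- t)) _ _ _ _ (@cvgr_expR R)).
  apply/cvgryPge => A.
  have /cvgryPge/(_ (A / r)) := @cvgr_idn R.
  by apply: filterS => n; rewrite ler_pdivrMr.
have [xb1|bx] := ltP x b.
  have s0 : 0 < s.
    rewrite mulr_gt0// eb; apply: sin_gt0_pi.
    rewrite mulr_gt0 ?pi_gt0 ?subr_gt0//= gtr_pMr ?pi_gt0//; lra.
  rewrite -[X in _ --> X]expR0; apply: cvg_comp; last exact: continuous_expR.
  have -> : (0 : R) = - 1 * 0 by rewrite mulr0.
  apply: cvgMr; rewrite /s mulr0.
  by under eq_fun do rewrite mulNr; exact: H.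
have s0 : 0 < - s.
  rewrite -mulrN mulr_gt0// eb -sinN; apply: sin_gt0_pi.
  have bx' : b < x by rewrite lt_neqAle eq_sym xb.
  rewrite -mulrN opprB mulr_gt0 ?pi_gt0 ?subr_gt0//= gtr_pMr ?pi_gt0//; lra.
(* The inequality [expR t >= 1 + t >= t] reduces the double exponential to a single one. *)
apply: (@squeeze_cvgr _ _ _ _ (cst 0) (fun n => expR (- (n%:R * - s)))).
- apply: nearW => n; have /andP[-> _] := smooth_step_bound b n x.
  rewrite ler_expR mulN1r lerN2 mulNr -mulrN.
  by apply: le_trans (expR_ge1Dx _); rewrite lerDr.
- exact: cvg_cst.
- exact: H.
Qed.

End Smooth.

(** * Absolutely continuous representative of a weakly differentiable function *)

Section Representative.
Context {R : realType}.
Notation mu := (@lebesgue_measure R).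
Notation mR := (measurableTypeR R).

Lemma integrable_mul_continuous (f c : R -> R) : measurable_fun [set: R] f ->
  mu.-integrable [set` `[0, 1[] (EFin \o f) -> continuous c ->
  mu.-integrable [set` `[0, 1[] (EFin \o (fun x => f x * c x)).
Proof.
move=> mf i_f cc.
rewrite (_ : EFin \o _ = (EFin \o f) \* (EFin \o c))%E; last first.
  by apply/funext => x.
apply: integrableMl => //.
  by apply: measurable_funTS; exact: continuous_measurable_fun.
have /compact_bounded[M [_ HM]] := @continuous_compact _ _ c [set` `[0, 1]]
  (continuous_subspaceT cc) (@segment_compact R 0 1).
exists M; split; rewrite ?num_real// => N MN x x01; apply: HM => //.
by exists x => //; apply: subset_itvl x01; rewrite bnd_simp.
Qed.

Variables g h : R -> R.
Hypothesis wgh : is_weak_derivative g h.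

Let pg x : g (x + 1) = g x. Proof. by have [/torus_Lp1P[pg _ _] _ _] := wgh; exact: pg. Qed.
Let mg : measurable_fun [set: R] g. Proof. by have [/torus_Lp1P[]] := wgh. Qed.
Let ig : mu.-integrable [set` `[0, 1[] (EFin \o g).
Proof. by have [/torus_Lp1P[]] := wgh. Qed.
Let ph x : h (x + 1) = h x. Proof. by have [_ /torus_Lp1P[ph _ _] _] := wgh; exact: ph. Qed.
Let mh : measurable_fun [set: R] h. Proof. by have [_ /torus_Lp1P[]] := wgh. Qed.
Let ih a b : mu.-integrable [set` `[a, b]] (EFin \o h).
Proof. by have [_ /torus_Lp1P[_ _ i1] _] := wgh; exact: periodic_integrable_itv. Qed.
Let ih0 : mu.-integrable [set` `[0, 1[] (EFin \o h).
Proof. by have [_ /torus_Lp1P[]] := wgh. Qed.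

Let P := primitive h.

Let weakE (phi dphi : R -> R) : periodic phi 1 -> elementary dphi ->
  (forall x : R, is_derive x 1 phi (dphi x)) ->
  \int[mu]_(x in `[0, 1[) (g x * dphi x) = - \int[mu]_(x in `[0, 1[) (h x * phi x).
Proof.
move=> pphi ed dd; have [_ _ W] := wgh.
have cphi : continuous phi.
  move=> x; apply/differentiable_continuous/derivable1_diffP.
  exact: (@ex_derive _ _ _ _ _ _ _ (dd x)).
have := W phi; rewrite (_ : phi^`()%classic = dphi); last first.
  by apply/funext => y; rewrite derive1E; exact: (@derive_val _ _ _ _ _ _ _ (dd y)).
rewrite !Rintegral_torus; last 2 first.
- by apply: measurable_funM => //; exact: continuous_measurable_fun.
- apply: measurable_funM => //; apply: continuous_measurable_fun.
  exact: elementary_continuous.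
by apply; split => //; exact: elementary_smooth.
Qed.

Let Rintegral0 (A : set mR) : \int[mu]_(x in A) (0 : R) = 0.
Proof. by rewrite /Rintegral integral0. Qed.

(** The constant 1 is a test function. Mean zero is what makes the primitive [P] periodic. *)
Let h_mean0 : \int[mu]_(x in `[0, 1[) h x = 0.
Proof.
have := @weakE (fun=> 1) (fun=> 0) _ (elementary_cst 0) _.
under eq_Rintegral do rewrite mulr0.
rewrite Rintegral0 => H.
under eq_Rintegral do rewrite -[h _]mulr1.
by apply: oppr_inj; rewrite oppr0 -H.
Qed.

Let pP x : P (x + 1) = P x.
Proof. exact: (primitive_periodic mh ih ph h_mean0). Qed.
Let mP : measurable_fun [set: R] P. Proof. exact: measurable_primitive. Qed.
Let P0 : P 0 = 0.
Proof.
rewrite /P /primitive; under eq_Rintegral do rewrite subrr mul0r.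
exact: Rintegral0.
Qed.

Let ihoc a b : mu.-integrable [set` `]a, b]] (EFin \o h).
Proof.
by apply: integrableS (ih a b) => //; apply: subset_itvr; rewrite bnd_simp.
Qed.

(** As [h] is merely integrable, integration by parts goes through Fubini on the triangle
    [0 < t <= x < 1]. The boundary value [phi 0] is multiplied by the mean of [h], which is zero. *)
Let by_parts (phi dphi : R -> R) : periodic phi 1 -> continuous dphi ->
  (forall x : R, is_derive x 1 phi (dphi x)) ->
  \int[mu]_(x in `[0, 1[) (P x * dphi x) = - \int[mu]_(x in `[0, 1[) (h x * phi x).
Proof.
move=> pphi cd dd.
have cphi : continuous phi.
  move=> x; apply/differentiable_continuous/derivable1_diffP.
  exact: (@ex_derive _ _ _ _ _ _ _ (dd x)).
pose K (q : mR * mR) : R :=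
  if (0 < q.2 <= q.1) && (q.1 < 1) then h q.2 * dphi q.1 else 0.
have mK' : measurable_fun [set: mR * mR] K.
  apply: measurable_fun_ifT => //.
    apply: measurable_and; first apply: measurable_and.
    - exact: measurable_fun_ltr.
    - exact: measurable_fun_ler.
    - exact: measurable_fun_ltr.
  apply: measurable_funM; first exact: measurableT_comp.
  by apply: measurableT_comp => //; exact: continuous_measurable_fun.
have mK : measurable_fun [set: mR * mR] (EFin \o K) by exact/measurable_EFinP.
have Kt x : (\int[mu]_t (K (x, t))%:E)%E = (if 0 <= x < 1 then P x * dphi x else 0)%:E.
  case: ifPn => x01.
    have /andP[x0 x1] := x01.
    have -> : P x = \int[mu]_(t in `]0, x]) h t.
      by rewrite -primitive_sub// -/P P0 subr0.
    rewrite mulrC EFinM fineK; last by apply: integrable_fin_num.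
    rewrite -integralZl//.
    rewrite [RHS]integral_mkcond; apply: eq_integral => t _.
    rewrite /K /patch mem_setE in_itv/= x1 andbT.
    by case: ifP => // _; rewrite -EFinM mulrC.
  rewrite -[RHS](@integral0 _ mR _ mu setT); apply: eq_integral => t _.
  rewrite /K/=; case: ifP => // /andP[/andP[t0 tx] x1].
  by case/negP: x01; rewrite x1 andbT (le_trans (ltW t0)).
have Kx t : (\int[mu]_x (K (x, t))%:E)%E =
    (if 0 < t < 1 then - (h t * (phi t - phi 0)) else 0)%:E.
  case: ifPn => t01.
    have /andP[t0 t1] := t01.
    have -> : phi t - phi 0 = - (phi 1 - phi t) by rewrite -[X in phi X - phi t](add0r 1) pphi opprB.
    rewrite mulrN opprK EFinM EFinB.
    have ccd : continuous (dphi : R -> R) by [].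
    rewrite -(@continuous_FTC2 _ dphi phi)//; last first.
    - by move=> x _; rewrite derive1E; exact: (@derive_val _ _ _ _ _ _ _ (dd x)).
    - split=> [x _||].
      + exact: (@ex_derive _ _ _ _ _ _ _ (dd x)).
      + by apply: cvg_at_right_filter; exact: cphi.
      + by apply: cvg_at_left_filter; exact: cphi.
    - exact: continuous_subspaceT.
    rewrite -integralZl//; last exact: continuous_integrable_itv.
    rewrite -integral_itv_bndo_bndc; last first.
      apply: measurable_funTS; apply/measurable_EFinP.
      by apply: measurable_funM => //; exact: continuous_measurable_fun.
    rewrite [RHS]integral_mkcond; apply: eq_integral => x _.
    by rewrite /K /patch mem_setE in_itv/= t0/=; case: ifP.
  rewrite -[RHS](@integral0 _ mR _ mu setT); apply: eq_integral => x _.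
  rewrite /K/=; case: ifP => // /andP[/andP[t0 tx] x1].
  by case/negP: t01; rewrite t0 (le_lt_trans tx).
have iK : (mu \x mu)%E.-integrable setT (EFin \o K).
  apply/integrable12ltyP => //.
  pose M := (\int[mu]_(t in [set` `[0%R, 1%R]]) `|(h t)%:E|)%E.
  have M_fin : M \is a fin_num.
    by have /integrableP[_ fM] := ih 0 1; rewrite ge0_fin_numE// integral_ge0.
  have /integrableP[mc fc] := continuous_integrable_itv 0 1 cd.
  apply: (@le_lt_trans _ _ (\int[mu]_(x in [set` `[0%R, 1%R]]) (`|(dphi x)%:E| * M))%E); last first.
    rewrite ge0_integralZr//.
    - apply: lte_mul_pinfty; [exact: integral_ge0| |by rewrite ltey_eq M_fin].
      by rewrite ge0_fin_numE// integral_ge0.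
    - exact: measurableT_comp.
    - by rewrite integral_ge0.
  rewrite [leRHS]integral_mkcond; apply: ge0_le_integral => //.
  - by move=> x _; apply: integral_ge0.
  - apply: (@measurable_fun_fubini_tonelli_F _ _ _ _ _ mu (abse \o (EFin \o K))) => //=.
    exact: measurableT_comp.
  - apply: (iffLR (measurable_restrictT _ (measurable_itv _))).
    by apply: emeasurable_funM => //; exact: measurableT_comp.
  - move=> x _; rewrite /patch mem_setE in_itv/=.
    case: ifPn => x01.
      rewrite -ge0_integralZl//; last first.
        apply: measurable_funTS; apply: measurableT_comp => //; exact/measurable_EFinP.
      rewrite [leRHS]integral_mkcond; apply: ge0_le_integral => //.
      + have mKx : measurable_fun [set: mR] (fun t : mR => K (x, t)).
          by apply: (measurableT_comp mK'); exact: measurable_pair1.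
        by apply/measurable_EFinP; exact: measurableT_comp.
      + apply: (iffLR (measurable_restrictT _ (measurable_itv _))).
        apply: emeasurable_funM => //; apply: measurable_funTS; apply: measurableT_comp => //.
        exact/measurable_EFinP.
      move=> t _; rewrite /K/= /patch mem_setE in_itv/=.
      case: ifP => [/andP[/andP[t0 tx] x1]|_].
        by rewrite (ltW t0) (le_trans tx (ltW x1))/= normrM mulrC.
      by rewrite normr0; case: ifP => _; rewrite ?mule_ge0.
    rewrite le_eqVlt; apply/predU1P; left.
    rewrite -[RHS](@integral0 _ mR _ mu setT); apply: eq_integral => t _; rewrite /K/=.
    case: ifP => [/andP[/andP[t0 tx] x1]|_]; last by rewrite normr0.
    by case/negP: x01; rewrite (ltW x1) andbT (le_trans (ltW t0)).
have L : (\int[mu]_x \int[mu]_t (K (x, t))%:E =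
    \int[mu]_(x in [set` `[0%R, 1%R[]) (P x * dphi x)%:E)%E.
  rewrite [RHS]integral_mkcond; apply: eq_integral => x _.
  by rewrite Kt /patch mem_setE in_itv/=; case: ifP.
have L' : (\int[mu]_t \int[mu]_x (K (x, t))%:E =
    \int[mu]_(t in [set` `]0%R, 1%R[]) (- (h t * (phi t - phi 0)))%:E)%E.
  rewrite [RHS]integral_mkcond; apply: eq_integral => t _.
  by rewrite Kx /patch mem_setE in_itv/=; case: ifP.
have -> : \int[mu]_(x in `[0, 1[) (P x * dphi x) =
    \int[mu]_(t in `]0, 1[) (- (h t * (phi t - phi 0))).
  by apply: (congr1 fine); rewrite -L -L'; exact: Fubini iK.
have ihphi : mu.-integrable [set` `[0, 1[] (EFin \o (fun t => h t * phi t)).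
  exact: integrable_mul_continuous.
have ihc : mu.-integrable [set` `[0, 1[] (EFin \o (fun t => h t * phi 0)).
  by apply: integrable_mul_continuous => // x; exact: cvg_cst.
have -> : \int[mu]_(t in `]0, 1[) (- (h t * (phi t - phi 0))) =
    \int[mu]_(t in `[0, 1[) (h t * phi 0 - h t * phi t).
  rewrite -Rintegral_itv_obnd_cbnd.
    by apply: eq_Rintegral => t _; ring.
  have i2 := @integrableB _ mR R mu _ (measurable_itv _) _ _ ihc ihphi.
  by apply: integrableS i2 => //; apply: subset_itvr; rewrite bnd_simp.
rewrite RintegralB// RintegralZr//.
by rewrite h_mean0 mul0r sub0r.
Qed.

Let F x := g x - P x.

Let iP : mu.-integrable [set` `[0, 1[] (EFin \o P).
Proof.
pose N := \int[mu]_(t in [set` `[0, 1]]) `|h t|.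
have PN x : 0 <= x < 1 -> `|P x| <= N.
  move=> /andP[x0 x1].
  have -> : P x = \int[mu]_(t in `]0, x]) h t.
    by rewrite -primitive_sub// -/P P0 subr0.
  apply: le_trans (le_normr_Rintegral _ _) _ => //.
  have fE a b : (\int[mu]_(t in `[a, b]) `|h t|)%:E = (\int[mu]_(t in `[a, b]) `|(h t)%:E|)%E.
    have /integrableP[_ fh] := ih a b.
    by rewrite fineK// ge0_fin_numE// integral_ge0.
  rewrite Rintegral_itv_obnd_cbnd; last by apply: integrable_norm.
  rewrite -lee_fin /N !fE; apply: ge0_subset_integral => //.
    by apply: measurable_funTS; exact/measurable_EFinP/measurableT_comp.
  move=> t; rewrite /= !in_itv/= => /andP[t0 tx].
  by rewrite t0 (le_trans tx (ltW x1)).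
have icst : mu.-integrable [set` `[0, 1[] (EFin \o (fun=> N)).
  exact: continuous_integrable01 (fun x => @cst_continuous _ _ _ _).
apply: le_integrable icst => //.
  by apply: measurable_funTS; exact/measurable_EFinP.
move=> x; rewrite /= in_itv/= lee_fin => /PN/le_trans; apply.
exact: ler_norm.
Qed.

Let iF : mu.-integrable [set` `[0, 1[] (EFin \o F).
Proof.
rewrite (_ : EFin \o F = (EFin \o g) \- (EFin \o P))%E; first by apply: integrableB.
by apply/funext => x.
Qed.

Let mF : measurable_fun [set: R] F. Proof. exact: measurable_funB. Qed.

Let pF x : F (x + 1) = F x. Proof. by rewrite /F pg pP. Qed.

Let c0 := \int[mu]_(x in `[0, 1[) F x.

(** [G] minus its mean has a periodic primitive, which is an admissible test function; [g] and [P]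
    satisfy the same identity against it, so their difference is annihilated. *)
Let orth (G : R -> R) : elementary G -> periodic G 1 ->
  \int[mu]_(x in `[0, 1[) (F x * (G x - \int[mu]_(y in `[0, 1[) G y)) = 0.
Proof.
move=> eG pG; set gam := \int[mu]_(y in _) G y.
pose q x := G x - gam.
have eq_ : elementary q by apply: elementary_add => //; exact: elementary_cst.
have cq := elementary_continuous eq_.
have mq : measurable_fun [set: R] q by exact: continuous_measurable_fun.
have iq a b : mu.-integrable [set` `[a, b]] (EFin \o q) by exact: continuous_integrable_itv.
have pq x : q (x + 1) = q x by rewrite /q pG.
have q0 : \int[mu]_(x in `[0, 1[) q x = 0.
  rewrite RintegralB//; last 2 first.
  - exact: continuous_integrable01 (elementary_continuous eG).
  - exact: (continuous_integrable01 (fun x => @cst_continuous _ _ _ _)).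
  by rewrite Rintegral_cst//= lebesgue_measure_itv/= lte01 oppr0 addr0 mulr1 subrr.
have dq (x : R) : is_derive x 1 (primitive q) (q x) by exact: (is_derive_primitive mq iq (cq x)).
have pQ : periodic (primitive q) 1 by move=> x; apply: primitive_periodic.
have := weakE pQ eq_ dq; rewrite -(by_parts pQ cq dq) => E.
under eq_Rintegral do rewrite /F mulrBl.
rewrite RintegralB//.
- by rewrite E subrr.
- exact: integrable_mul_continuous.
- exact: integrable_mul_continuous.
Qed.

Let step (b x : R) : R := if x < b then 1 else 0.

Let mstep b : measurable_fun [set: mR] (step b).
Proof. by apply: measurable_fun_ifT => //; exact: measurable_fun_ltr. Qed.

Let smooth_step_integral_cvg (f : R -> R) b : 0 < b < 1 -> measurable_fun [set: R] f ->
  mu.-integrable [set` `[0, 1[] (EFin \o f) ->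
  \int[mu]_(x in `[0, 1[) (f x * smooth_step b n x) @[n --> \oo] -->
  \int[mu]_(x in `[0, 1[) (f x * step b x).
Proof.
move=> b01 mf i_f.
apply: (@Rintegral_dominated_cvg _ _ _ mu _ _ (fun n x => f x * smooth_step b n x)
  (fun x => f x * step b x) (fun x => `|f x|)) => //.
- move=> n; apply: measurable_funTS; apply: measurable_funM => //.
  exact: continuous_measurable_fun (elementary_continuous (elementary_smooth_step b n)).
- by apply: measurable_funTS; apply: measurable_funM.
(* At 0 and at [b] one sine vanishes, and every [smooth_step b n] has the value [exp(-1)]; these two
   points form the exceptional set. *)
- exists [set 0; b]; split.
  + exact: measurableU.
  + by apply: countable_lebesgue_measure0; exact: finite_set_countable.
  + move=> x /= /not_implyP[]; rewrite in_itv/= => /andP[x0 x1] H.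
    apply: contrapT => /not_orP[/eqP nx0 /eqP nxb]; apply: H.
    apply: cvgMr; apply: smooth_step_cvg => //.
    by rewrite lt_neqAle eq_sym nx0 x0.
- exact: integrable_norm.
- move=> n x _; have /andP[s0 s1] := smooth_step_bound b n x.
  by rewrite normrM (ger0_norm s0) ler_piMr.
Qed.

(* The weak-derivative identity says that F = g - primitive h is orthogonal to all
   smooth functions of mean zero; steps are limits of such, up to a constant. *)
Let F_step b : 0 < b < 1 ->
  \int[mu]_(x in `[0, 1[) (F x * step b x) =
  (\int[mu]_(x in `[0, 1[) (1 * step b x)) * c0.
Proof.
move=> b01.
have i1 : mu.-integrable [set` `[0, 1[] (EFin \o (fun=> 1 : R)).
  exact: (continuous_integrable01 (fun x => @cst_continuous _ _ _ _)).
have C1 := smooth_step_integral_cvg b01 mF iF.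
have C2 : (\int[mu]_(x in `[0, 1[) (1 * smooth_step b n x)) * c0 @[n --> \oo] -->
    (\int[mu]_(x in `[0, 1[) (1 * step b x)) * c0.
  by apply: cvgMl; apply: smooth_step_integral_cvg.
apply: (cvg_unique _ C1); first exact: Rhausdorff.
rewrite (_ : (fun n => _) = fun n : nat =>
  (\int[mu]_(x in `[0, 1[) (1 * smooth_step b n x)) * c0); first exact: C2.
apply/funext => n.
have := orth (elementary_smooth_step b n) (smooth_step_periodic b n).
under eq_Rintegral do rewrite mulrBr.
have cs := elementary_continuous (elementary_smooth_step b n).
rewrite RintegralB//; last 2 first.
- exact: integrable_mul_continuous.
- by apply: integrable_mul_continuous => // x; exact: cvg_cst.
move/eqP; rewrite subr_eq0 => /eqP ->.
rewrite RintegralZr// mulrC; congr (_ * _).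
by apply: eq_Rintegral => x _; rewrite mul1r.
Qed.

(** By [F_step] the integrals of [F - c0] over all intervals []0, b]] vanish, and Lebesgue
    differentiation recovers the integrand almost everywhere. *)
Let F_cst : {ae mu, forall x, 0 < x < 1 -> F x = c0}.
Proof.
pose q x := F x - c0.
have mq : measurable_fun [set: R] q by exact: measurable_funB.
have pq x : q (x + 1) = q x by rewrite /q pF.
have icst : mu.-integrable [set` `[0, 1[] (EFin \o (fun=> c0)).
  exact: (continuous_integrable01 (fun x => @cst_continuous _ _ _ _)).
have iq0 : mu.-integrable [set` `[0, 1[] (EFin \o q).
  rewrite (_ : EFin \o q = (EFin \o F) \- (EFin \o (fun=> c0)))%E; first by apply: integrableB.
  by apply/funext => x.
have iq a b : mu.-integrable [set` `[a, b]] (EFin \o q).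
  exact: periodic_integrable_itv.
have q0 b : 0 < b < 1 -> \int[mu]_(x in `]0, b]) q x = 0.
  move=> b01; have /andP[b0 b1] := b01.
  have iqo : mu.-integrable [set` `]0, b[] (EFin \o q).
    by apply: integrableS (iq 0 b) => //; apply: subset_itvScc; rewrite bnd_simp.
  rewrite -(Rintegral_itv_bndo_bndc iqo) (Rintegral_itv_obnd_cbnd iqo).
  have -> : \int[mu]_(x in `[0, b[) q x = \int[mu]_(x in `[0, 1[) (F x * step b x - c0 * (1 * step b x)).
    rewrite [LHS]Rintegral_mkcond [RHS]Rintegral_mkcond; apply: eq_Rintegral => x _.
    rewrite /patch !mem_setE !in_itv/= /step.
    have [x0|_] := leP 0 x => //=; have [xb|bx] := ltP x b.
      by rewrite (lt_trans xb b1) !mulr1.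
    by rewrite !mulr0 subr0; case: ifP.
  have ist (f : R -> R) : measurable_fun [set: R] f -> mu.-integrable [set` `[0, 1[] (EFin \o f) ->
      mu.-integrable [set` `[0, 1[] (EFin \o (fun x => f x * step b x)).
    move=> mf; apply: le_integrable => //.
      by apply: measurable_funTS; apply/measurable_EFinP; exact: measurable_funM.
    move=> x _; rewrite /= lee_fin /step normrM ler_piMr//.
    by case: ifP; rewrite ?normr1 ?normr0.
  have is1 : mu.-integrable [set` `[0, 1[] (EFin \o (fun x => 1 * step b x)).
    by apply: ist => //; exact: (continuous_integrable01 (fun x => @cst_continuous _ _ _ _)).
  rewrite RintegralB//; last 2 first.
  - exact: ist.
  - rewrite (_ : EFin \o _ = (fun x => c0%:E * (1 * step b x)%:E))%E; first exact: integrableZl.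
    by apply/funext => x.
  by rewrite RintegralZl// F_step// mulrC subrr.
have lq : locally_integrable [set: R] q.
  split => //; first exact: openT.
  move=> A _ /[dup] /compact_measurable mA /compact_bounded[N [_ NA]].
  have AN : A `<=` [set` `[- (`|N| + 1), `|N| + 1]].
    by move=> z Az; rewrite set_itvcc /= -ler_norml NA// ltr_pwDr// ler_norm.
  by have /integrableP[] := @integrableS _ mR R mu _ _ _ (measurable_itv _) mA AN (iq _ _).
have iqb y : mu.-integrable [set` Interval (BRight 0) (BRight y)] (EFin \o q).
  by apply: integrableS (iq 0 y) => //; apply: subset_itvr; rewrite bnd_simp.
have := FTC1 iqb lq.
apply: (@filterS _ _ (ae_filter_ringOfSetsType mu)) => x /= H /andP[x0 x1].
have [|_] := H; first by rewrite lte_fin.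
rewrite derive1E => dE.
apply/eqP; rewrite -subr_eq0; apply/eqP; rewrite -/(q x) -dE.
have near0 : \forall y \near x, (fun=> 0 : R) y = \int[mu]_(t in `]0, y]) q t.
  near=> y; rewrite q0//; apply/andP; split.
    by near: y; exact: lt_nbhsr.
  by near: y; exact: lt_nbhsl.
have d0 : is_derive x 1 (fun=> 0 : R) 0 by exact: is_derive_cst.
have d1 := @near_eq_is_derive _ _ _ _ _ x 1 0 near0 d0.
exact: (@derive_val _ _ _ _ _ _ _ d1).
Unshelve. all: by end_near. Qed.

Lemma weak_derivative_representative :
  exists c, [/\ {ae mu, forall x, 0 < x < 1 -> g x = primitive h x + c},
    forall x, primitive h (x + 1) = primitive h x & measurable_fun [set: R] (primitive h)].
Proof.
exists c0; split => //.
apply: (@filterS _ _ (ae_filter_ringOfSetsType mu)) F_cst => x + x01 => /(_ x01) <-.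
by rewrite /F addrC subrK.
Qed.

End Representative.

(** * Assembly of the estimate *)

Section NonnegRepresentative.
Context {R : realType}.
Notation mu := (@lebesgue_measure R).
Notation mR := (measurableTypeR R).

Lemma max0_lipschitz (a b : R) : `|Num.max a 0 - Num.max b 0| <= `|a - b|.
Proof.
rewrite !maxr_absE !addr0 !subr0.
rewrite -mulrBl normrM (@ger0_norm _ 2^-1)// ler_pdivrMr//.
have -> : a + `|a| - (b + `|b|) = (a - b) + (`|a| - `|b|) by ring.
rewrite (le_trans (ler_normD _ _))// mulr_natr mulr2n lerD2l.
exact: ler_dist_dist.
Qed.

(** The positive part of [primitive h + c] still agrees with the nonnegative [g] almost everywhere
    on the period, is nonnegative at every point, and oscillates no more than the primitive. *)
Lemma weak_derivative_ge0_representative (g h : R -> R) : is_weak_derivative g h ->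
  (forall x, 0 <= g x) ->
  exists v : R -> R, [/\ forall x, v (x + 1) = v x, measurable_fun [set: R] v,
    forall x, 0 <= v x,
    {ae mu, forall x, 0 < x < 1 -> g x = v x} &
    forall x y, ((`|v y - v x|)%:E <= ball_integral (fun t => `|h t|)%R x (`|x - y|)%R)%E].
Proof.
move=> wgh g0; have [_ /torus_Lp1P[ph mh ih0] _] := wgh.
have ih a b : mu.-integrable [set` `[a, b]] (EFin \o h) by exact: periodic_integrable_itv.
have [c [gc pP mP]] := weak_derivative_representative wgh.
exists (fun x => Num.max (primitive h x + c) 0); split.
- by move=> x; rewrite pP.
- by apply: measurable_maxr => //; exact: measurable_funD.
- by move=> x; rewrite le_max lexx orbT.
- apply: (@filterS _ _ (ae_filter_ringOfSetsType mu)) gc => x + x01 => /(_ x01) gx.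
  by rewrite -gx max_l.
- move=> x y; apply: le_trans (primitive_osc mh ih x y); rewrite lee_fin.
  apply: (le_trans (max0_lipschitz _ _)).
  by rewrite opprD addrACA subrr addr0.
Qed.

End NonnegRepresentative.

(** * Distance to a set *)

Section SetDistance.
Context {R : realType}.
Implicit Types (Z : set R) (x y z : R).

(* When Z is empty this is inf set0 = 0. *)
Definition set_dist Z x : R := inf [set `|x - z| | z in Z].

Let has_lb Z x : has_lbound [set `|x - z| | z in Z].
Proof. by exists 0 => _ [z _ <-]. Qed.

Lemma set_dist0 x : set_dist set0 x = 0.
Proof. by rewrite /set_dist image_set0 inf0. Qed.

Lemma set_dist_le Z x z : Z z -> set_dist Z x <= `|x - z|.
Proof. by move=> Zz; apply: ge_inf => //; exists z. Qed.

Lemma set_dist_ge0 Z x : 0 <= set_dist Z x.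
Proof.
have [->|/set0P[z Zz]] := eqVneq Z set0; first by rewrite set_dist0.
by apply: lb_le_inf; [exists `|x - z|, z|move=> _ [t _ <-]].
Qed.

Lemma set_dist_adherent Z x (e : R) : Z !=set0 -> 0 < e ->
  exists2 z, Z z & `|x - z| < set_dist Z x + e.
Proof.
move=> [z Zz] e0; have hi : has_inf [set `|x - z| | z in Z].
  by split => //; exists `|x - z|, z.
by have [_ [t Zt <-] xt] := inf_adherent e0 hi; exists t.
Qed.

Lemma set_dist_lipschitz Z x y : `|set_dist Z x - set_dist Z y| <= `|x - y|.
Proof.
have [->|/set0P Z0] := eqVneq Z set0; first by rewrite !set_dist0 subrr normr0.
have H a b : set_dist Z a <= `|a - b| + set_dist Z b.
  rewrite -lerBlDl; apply: lb_le_inf.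
    by have [z Zz] := Z0; exists `|b - z|, z.
  move=> _ [z Zz <-]; rewrite lerBlDl (le_trans (set_dist_le a Zz))//.
  by rewrite (le_trans _ (ler_normD _ _))// addrA subrK.
by rewrite ler_norml lerBlDr H andbT lerNl opprB lerBlDr distrC H.
Qed.

Lemma measurable_set_dist Z : measurable_fun [set: R] (set_dist Z).
Proof.
apply: continuous_measurable_fun => x; apply/cvgrPdist_le => e e0; near=> y.
apply: (le_trans (set_dist_lipschitz _ _ _)).
by near: y; exact: (@cvgr_dist_le _ _ _ _ _ id x _ e).
Unshelve. all: by end_near. Qed.

Lemma set_dist_periodic Z x : (forall z, Z (z + 1) <-> Z z) ->
  set_dist Z (x + 1) = set_dist Z x.
Proof.
move=> pZ; congr inf; apply/seteqP; split=> [_ [z Zz <-]|_ [z Zz <-]].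
  exists (z - 1); first by apply/pZ; rewrite subrK.
  by rewrite opprB addrA addrAC.
by exists (z + 1); [apply/pZ|rewrite opprD addrACA subrr addr0].
Qed.

End SetDistance.

(** * Bound of the convolution by the essential supremum *)

Section SupBound.
Context {R : realType}.
Notation mu := (@lebesgue_measure R).
Notation mR := (measurableTypeR R).
Notation tm := (torus_measure R).

(** The essential supremum refers to the torus measure, so the convolution is folded onto the torus
    to use it and unfolded again to use that the line kernel has mass at most 1. *)
Lemma line_conv_le_Lnormoo (m eps : R) (u : R -> R) (x : R) : 1 < m -> 0 < eps ->
  measurable_fun [set: R] u -> (forall y, u (y + 1) = u y) ->
  mu.-integrable [set` `[0, 1[] (EFin \o u) ->
  ((\int[mu]_y (line_kernel m eps (x - y) * u y))%:E <= torus_Lnorm +oo (u^\+)%R)%E.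
Proof.
move=> m1 e0 mu' pu iu.
have mup : measurable_fun [set: R] u^\+ by exact: measurable_maxr.
have pup y : u^\+ (y + 1) = u^\+ y by rewrite /funrpos pu.
have iup : mu.-integrable [set` `[0, 1[] (EFin \o u^\+).
  apply: le_integrable iu => //.
    by apply: measurable_funTS; exact/measurable_EFinP.
  move=> y _; rewrite /= lee_fin /funrpos ger0_norm ?le_max ?lexx ?orbT//.
  by rewrite ge_max ler_norm normr_ge0.
have fE (f : R -> R) : mu.-integrable [set: mR] (EFin \o f) ->
    (\int[mu]_y f y)%:E = (\int[mu]_y (f y)%:E)%E.
  by move=> i_f; rewrite /Rintegral fineK//; apply: integrable_fin_num.
rewrite fE; last by apply: integrable_line_conv.
apply: (@le_trans _ _ (\int[mu]_y (line_kernel m eps (x - y) * u^\+ y)%:E)%E).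
  apply: le_integral => //; [exact: integrable_line_conv|exact: integrable_line_conv|].
  move=> y _; rewrite lee_fin ler_wpM2l//; first exact: line_kernel_ge0.
  by rewrite /funrpos le_max lexx.
rewrite -integral_torus_kernel//.
set M := torus_Lnorm _ _.
have aeM : {ae tm, forall y, ((u^\+ y)%:E <= M)%E}.
  have := ess_sup_ge tm (abse \o (EFin \o u^\+)).
  (* The norm of exponent [+oo] is the essential supremum only when the total mass is positive; the
     torus has mass 1. *)
  rewrite /M /torus_Lnorm unlock torus_measureT lte01.
  apply: (@filterS _ _ (ae_filter_ringOfSetsType tm)) => y; apply: le_trans.
  by rewrite /= lee_fin ler_norm.
have M0 : (0 <= M)%E by exact: Lnorm_ge0.
move: aeM M0; case: M => [r| |//] aeM r0; last by rewrite leey.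
have mk : measurable_fun [set: mR] (fun y => torus_kernel m eps (x - y)).
  by apply: (measurableT_comp (measurable_torus_kernel m1 e0)); exact: measurable_funB.
have k0 y : 0 <= torus_kernel m eps (x - y) by exact: torus_kernel_ge0.
apply: (@le_trans _ _ (\int[tm]_y (torus_kernel m eps (x - y) * r)%:E)%E).
  apply: ae_ge0_le_integral => //.
  - by move=> y _; rewrite lee_fin mulr_ge0// /funrpos le_max lexx orbT.
  - by apply/measurable_EFinP; exact: measurable_funM.
  - by move=> y _; rewrite lee_fin mulr_ge0.
  - by apply/measurable_EFinP; exact: measurable_funM.
  - apply: (@filterS _ _ (ae_filter_ringOfSetsType tm)) aeM => y uy _.
    by rewrite lee_fin ler_wpM2l.
rewrite (@integral_torus_kernel _ m eps x (fun=> r))//.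
rewrite (_ : (fun y => _) = fun y => (r%:E * (line_kernel m eps (x - y))%:E)%E); last first.
  by apply/funext => y; rewrite mulrC.
rewrite ge0_integralZl_EFin//.
- by rewrite -[leRHS]mule1 lee_wpmul2l// integral_line_kernel_le1.
- by move=> y _; rewrite lee_fin line_kernel_ge0.
- apply/measurable_EFinP; apply: (measurableT_comp (measurable_line_kernel m eps)).
  exact: measurable_funB.
Qed.

End SupBound.

Section L2Bound.
Context {R : realType}.
Notation mu := (@lebesgue_measure R).
Notation mR := (measurableTypeR R).

Lemma sqr_le_of_le_add (r : R) (A B : \bar R) : (0 <= A)%E -> (0 <= B)%E ->
  ((`|r|)%:E <= A + B)%E -> ((r ^+ 2)%:E <= 2%:E * (A * A + B * B))%E.
Proof.
case: A => [a| |//]; case: B => [b| |//]; rewrite ?lee_fin => a0 b0.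
- move=> rab; rewrite -real_normK ?num_real//.
  have := lerXn2r 2 (normr_ge0 r : _ \is Num.nneg) (addr_ge0 a0 b0 : _ \is Num.nneg) rab.
  by move/le_trans; apply; have := sqr_ge0 (a - b); lra.
- by rewrite addeC => _; rewrite mulyy addey// mulry gtr0_sg// mul1e leey.
- by move=> _; rewrite mulyy addye// mulry gtr0_sg// mul1e leey.
- by move=> _; rewrite mulyy addye// mulry gtr0_sg// mul1e leey.
Qed.

Lemma torus_Lnorm2_le (K2 : R) (f g : R -> R) : 0 <= K2 ->
  measurable_fun [set: R] f -> measurable_fun [set: R] g ->
  (\int[mu]_(x in `[0%R, 1%R[) (f x ^+ 2)%:E <=
    K2%:E * \int[mu]_(x in `[0%R, 1%R[) (g x ^+ 2)%:E)%E ->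
  (torus_Lnorm 2%:E f <= (Num.sqrt K2)%:E * torus_Lnorm 2%:E g)%E.
Proof.
move=> K20 mf mg H.
have E (h : R -> R) : measurable_fun [set: R] h ->
    torus_Lnorm 2%:E h = ((\int[mu]_(x in `[0%R, 1%R[) (h x ^+ 2)%:E) `^ 2^-1)%E.
  move=> mh; rewrite /torus_Lnorm unlock; congr (_ `^ _)%E.
  rewrite -integral_torus; last first.
    by apply/measurable_EFinP; exact: measurable_funX.
  apply: eq_integral => x _ /=.
  by rewrite powR_mulrn// real_normK// num_real.
rewrite !E//.
have -> : (Num.sqrt K2)%:E = (K2%:E `^ 2^-1)%E by rewrite /= powR12_sqrt.
have I0 (h : R -> R) : (0 <= \int[mu]_(x in `[0%R, 1%R[) (h x ^+ 2)%:E)%E.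
  by apply: integral_ge0 => x _; rewrite lee_fin sqr_ge0.
rewrite -poweRM//; apply: gt0_ler_poweR => //.
- by rewrite in_itv/= I0 leey.
- by rewrite in_itv/= leey andbT mule_ge0.
Qed.

End L2Bound.

Section AlmostEverywhere.
Context {R : realType}.
Notation mu := (@lebesgue_measure R).
Notation mR := (measurableTypeR R).

Lemma ae_itv_oo_co (P : R -> Prop) : {ae mu, forall x, 0 < x < 1 -> P x} ->
  {ae mu, forall x, [set` `[0, 1[] x -> P x}.
Proof.
move=> aeP.
have ae0 : {ae mu, forall x : R, x != 0}.
  exists [set 0]; split => //; first exact: lebesgue_measure_set1.
  by move=> x /= /negP; rewrite negbK => /eqP.
have F := ae_filter_ringOfSetsType mu.
apply: (@filterS2 _ _ F _ _ _ _ aeP ae0) => x Px x0.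
by rewrite /= in_itv/= => /andP[x0' x1]; apply: Px; rewrite x1 lt_neqAle eq_sym x0 x0'.
Qed.

Lemma Rintegral_translate (f : R -> R) (a : R) : measurable_fun [set: R] f ->
  \int[mu]_y f (y + a) = \int[mu]_y f y.
Proof.
move=> mf; rewrite /Rintegral integralE [in RHS]integralE.
have mef : measurable_fun [set: mR] (EFin \o f) by exact/measurable_EFinP.
congr (fine (_ - _)).
- rewrite -(@ge0_integral_translate _ a (EFin \o f)^\+%E)//; last exact: measurable_funepos.
  by apply: eq_integral => x _; rewrite !funeposE.
- rewrite -(@ge0_integral_translate _ a (EFin \o f)^\-%E)//; last exact: measurable_funeneg.
  by apply: eq_integral => x _; rewrite !funenegE.
Qed.

End AlmostEverywhere.

(** * The L^2 bound on the weak derivative *)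

Section Main.
Context {R : realType}.
Notation mu := (@lebesgue_measure R).
Notation mR := (measurableTypeR R).
Notation tm := (torus_measure R).
Variables (m eps c : R) (u du : R -> R).
Hypotheses (m2 : 2 < m) (e0 : 0 < eps) (c0 : 0 < c).
Hypotheses (pu : forall x, u (x + 1) = u x) (mu' : measurable_fun [set: R] u)
  (iu : mu.-integrable [set` `[0, 1[] (EFin \o u)).
Hypothesis (wdu : is_weak_derivative u^\+ du).

Let m1 : 1 < m. Proof. by apply: lt_trans m2; rewrite ltr1n. Qed.

(** The witness is the classical derivative of the convolution where it exceeds [c], and 0
    elsewhere. The third clause locates its support, where [c] can be compared with the sup norm. *)
Lemma weak_derivative_conv_pos_part :
  exists w : R -> R,
    [/\ is_weak_derivative (fun x => torus_convolution (torus_kernel m eps) u x - c)^\+ w,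
      measurable_fun [set: R] w,
      (forall x, w x != 0 -> c < torus_convolution (torus_kernel m eps) u x) &
      (\int[mu]_(x in `[0%R, 1%R[) (w x ^+ 2)%:E <=
       (2 * ((4 * m / (m - 2)) ^+ 2 + m ^+ 2 * (4 * (4 * 3 `^ (3 / 2)))))%:E *
        \int[mu]_(x in `[0%R, 1%R[) (du x ^+ 2)%:E)%E].
Proof.
have up0 x : 0 <= u^\+ x by rewrite /funrpos le_max lexx orbT.
have [v [pv mv v0 uv v_osc]] := weak_derivative_ge0_representative wdu up0.
have [_ /torus_Lp1P[pdu mdu idu] _] := wdu.
(* Cutting [u^\-] off where [v] is positive places the support of [n] in the zero set of [v] at
   every point, as the distance argument requires. Then [v - n] agrees with [u] only almost
   everywhere, which the convolution does not see. *)
pose n y := if v y == 0 then u^\- y else 0.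
have mum : measurable_fun [set: R] u^\- by apply: measurable_maxr => //; exact: measurableT_comp.
have mn : measurable_fun [set: R] n.
  by apply: measurable_fun_ifT => //; exact: measurable_fun_eqr.
have n0 y : 0 <= n y by rewrite /n; case: ifP => // _; rewrite /funrneg le_max lexx orbT.
have pn y : n (y + 1) = n y by rewrite /n pv /funrneg pu.
have iv : mu.-integrable [set` `[0, 1[] (EFin \o v).
  have [/torus_Lp1P[_ mup /integrableP[_ iup]] _ _] := wdu.
  apply/integrableP; split; first by apply: measurable_funTS; exact/measurable_EFinP.
  apply: le_lt_trans iup; rewrite le_eqVlt; apply/predU1P; left.
  apply: ge0_ae_eq_integral => //.
  - by apply: measurable_funTS; apply/measurable_EFinP; exact: measurableT_comp.
  - by apply: measurable_funTS; apply/measurable_EFinP; exact: measurableT_comp.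
  - apply: ae_itv_oo_co; apply: (@filterS _ _ (ae_filter_ringOfSetsType mu)) uv => x + x01.
    by move=> /(_ x01) /= ->.
have iN : mu.-integrable [set` `[0, 1[] (EFin \o n).
  apply: le_integrable iu => //.
    by apply: measurable_funTS; exact/measurable_EFinP.
  move=> y _; rewrite /= lee_fin ger0_norm// /n; case: ifP => // _.
  by rewrite /funrneg ge_max normr_ge0 -normrN ler_norm.
pose g y := v y - n y.
have mg : measurable_fun [set: R] g by exact: measurable_funB.
have pg y : g (y + 1) = g y by rewrite /g pv pn.
have ig : mu.-integrable [set` `[0, 1[] (EFin \o g).
  rewrite (_ : EFin \o g = (EFin \o v) \- (EFin \o n))%E; first by apply: integrableB.
  by apply/funext => x.
have ug : {ae mu, forall x, 0 < x < 1 -> u x = g x}.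
  apply: (@filterS _ _ (ae_filter_ringOfSetsType mu)) uv => x + x01 => /(_ x01) ux.
  rewrite /g /n -ux /funrpos /funrneg.
  have [u0|u0] := leP (u x) 0.
    by rewrite eqxx max_l ?oppr_ge0// opprK add0r.
  by rewrite gt_eqF// subr0.
pose U x := \int[mu]_y (line_kernel m eps (x - y) * g y).
pose D x := \int[mu]_y (dline_kernel m eps (x - y) * g y).
have UE : torus_convolution (torus_kernel m eps) u = U.
  apply/funext => x; rewrite -[RHS]torus_convolutionE// /torus_convolution.
  have mk : measurable_fun [set: mR] (fun y => torus_kernel m eps (x - y)).
    by apply: (measurableT_comp (measurable_torus_kernel m1 e0)); exact: measurable_funB.
  rewrite !Rintegral_torus; [|exact: measurable_funM|exact: measurable_funM].
  congr fine; apply: ae_eq_integral => //.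
  - by apply: measurable_funTS; apply/measurable_EFinP; exact: measurable_funM.
  - by apply: measurable_funTS; apply/measurable_EFinP; exact: measurable_funM.
  - apply: ae_itv_oo_co; apply: (@filterS _ _ (ae_filter_ringOfSetsType mu)) ug => y + y01.
    by move=> /(_ y01) /= ->.
have pk (k : R -> R) x : measurable_fun [set: R] k ->
    \int[mu]_y (k (x + 1 - y) * g y) = \int[mu]_y (k (x - y) * g y).
  move=> mk; rewrite -(@Rintegral_translate _ _ 1); last first.
    by apply: measurable_funM => //; apply: (measurableT_comp mk); exact: measurable_funB.
  by apply: eq_Rintegral => y _; rewrite pg opprD addrACA subrr addr0.
have pU : periodic U 1 by move=> x; apply: pk; exact: measurable_line_kernel.
have pD : periodic D 1 by move=> x; apply: pk; exact: measurable_dline_kernel.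
have dU (x : R) : is_derive x 1 U (D x) by apply: is_derive_line_conv.
have cD : continuous D by apply: continuous_dline_conv.
have mw : measurable_fun [set: R] (fun x => if c < U x then D x else 0).
  apply: measurable_fun_ifT => //; last exact: continuous_measurable_fun.
  apply: measurable_fun_ltr => //; apply: continuous_measurable_fun => x.
  apply/differentiable_continuous/derivable1_diffP.
  exact: (@ex_derive _ _ _ _ _ _ _ (dU x)).
rewrite UE; exists (fun x => if c < U x then D x else 0); split.
- exact: (weak_derivative_pos_part c pU pD dU cD).
- exact: mw.
- by move=> x; case: ifP => //; rewrite eqxx.
pose f t := `|du t|.
have mf : measurable_fun [set: R] f by exact: measurableT_comp.
have f0 t : 0 <= f t by exact: normr_ge0.
have pf t : f (t + 1) = f t by rewrite /f pdu.
pose Z := [set z | v z = 0].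
pose d := set_dist Z.
have d0 x : 0 <= d x by exact: set_dist_ge0.
have dlip x y : `|d x - d y| <= `|x - y| by exact: set_dist_lipschitz.
have pd x : d (x + 1) = d x by apply: set_dist_periodic => z; rewrite /Z/= pv.
have md : measurable_fun [set: R] d by exact: measurable_set_dist.
have n_far x y : 0 < n y -> d x <= `|x - y|.
  by rewrite /n; case: eqP => [vy _|_]; [exact: set_dist_le|rewrite ltxx].
have mball x (r : R) : measurable_fun [set: mR] (fun t => (if `|x - t| <= r then f t else 0)%:E).
  apply/measurable_EFinP; apply: measurable_fun_ifT => //.
  by apply: measurable_fun_ler => //; apply: measurableT_comp => //; exact: measurable_funB.
have v_core x : (forall y, n y = 0) \/ ((v x)%:E <= ball_integral f x (d x + eps / 2))%E.
  have [Z0|/set0P Z0] := eqVneq Z set0.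
    left => y; rewrite /n; case: eqP => // vy.
    by have : Z y by []; rewrite Z0.
  (* At a zero [z] of [v] within [d x + eps / 2] of [x], the oscillation [|v z - v x|] is [v x]
     itself. *)
  right; have [z vz xz] := set_dist_adherent x Z0 (divr_gt0 e0 (ltr0Sn R 1)).
  have := v_osc x z; rewrite vz sub0r normrN ger0_norm// => /le_trans; apply.
  apply: ge0_le_integral => //.
  - by move=> t _; rewrite lee_fin; case: ifP.
  - move=> t _; rewrite lee_fin; case: ifPn => [xt|_]; last by case: ifP.
    by rewrite (le_trans xt (ltW xz)).
pose N x := (\int[mu]_t ((eps + `|x - t|) `^ (- (m - 1)) * f t)%:E)%E.
pose H x := (\int[mu]_t (hardy_kernel d eps x t * f t)%:E)%E.
have DB x : 0 < U x -> ((`|D x|)%:E <= (2 * m * eps `^ (m - 2))%:E * N x + m%:E * H x)%E.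
  by move=> Ux; apply: line_conv_deriv_bound.
pose a := 2 * m * eps `^ (m - 2).
have a0 : 0 <= a by rewrite !mulr_ge0 ?powR_ge0// ltW// (lt_trans ltr01).
have N0 x : (0 <= N x)%E.
  by apply: integral_ge0 => t _; rewrite lee_fin mulr_ge0 ?powR_ge0.
have H0 x : (0 <= H x)%E.
  apply: integral_ge0 => t _; rewrite lee_fin mulr_ge0// /hardy_kernel.
  by case: ifP => // _; rewrite invr_ge0 addr_ge0// ltW.
have mN : measurable_fun [set: mR] N.
  apply: (@measurable_fun_fubini_tonelli_F _ _ _ _ _ mu
    (fun q : mR * mR => ((eps + `|q.1 - q.2|) `^ (- (m - 1)) * f q.2)%:E)).
  - apply/measurable_EFinP; apply: measurable_funM; last exact: measurableT_comp.
    apply: (measurableT_comp (measurable_decay (- (m - 1)) eps)).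
    exact: measurable_funB.
  - by move=> q; rewrite lee_fin mulr_ge0 ?powR_ge0.
have mH : measurable_fun [set: mR] H.
  apply: (@measurable_fun_fubini_tonelli_F _ _ _ _ _ mu
    (fun q : mR * mR => (hardy_kernel d eps q.1 q.2 * f q.2)%:E)).
  - apply/measurable_EFinP; apply: measurable_funM; last exact: measurableT_comp.
    exact: measurable_hardy_kernel.
  - move=> q; rewrite lee_fin mulr_ge0// /hardy_kernel.
    by case: ifP => // _; rewrite invr_ge0 addr_ge0// ltW.
have wB x : (((if c < U x then D x else 0) ^+ 2)%:E <=
   (2 * a ^+ 2)%:E * (N x * N x) + (2 * m ^+ 2)%:E * (H x * H x))%E.
  case: ifPn => [cU|_]; last first.
    by rewrite expr0n adde_ge0// mule_ge0 ?mule_ge0// lee_fin mulr_ge0// sqr_ge0.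
  have m0 : 0 <= m by rewrite ltW// (lt_trans ltr01).
  have := sqr_le_of_le_add _ _ (DB x (lt_trans c0 cU)).
  rewrite !mule_ge0// => /(_ isT isT) /le_trans; apply.
  rewrite ge0_muleDr ?mule_ge0//.
  have q (b : R) (T : \bar R) :
      (2%:E * ((b%:E * T) * (b%:E * T)) = (2 * b ^+ 2)%:E * (T * T))%E.
    by rewrite muleACA expr2 !EFinM !muleA.
  by rewrite !q.
have mNN : measurable_fun ([set` `[0, 1[] : set mR) (fun x => N x * N x)%E.
  by apply: measurable_funTS; exact: emeasurable_funM.
have mHH : measurable_fun ([set` `[0, 1[] : set mR) (fun x => H x * H x)%E.
  by apply: measurable_funTS; exact: emeasurable_funM.
have NN0 x : (0 <= N x * N x)%E by exact: mule_ge0.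
have HH0 x : (0 <= H x * H x)%E by exact: mule_ge0.
have aa0 : 0 <= 2 * a ^+ 2 by rewrite mulr_ge0// sqr_ge0.
have mm0 : 0 <= 2 * m ^+ 2 by rewrite mulr_ge0// sqr_ge0.
have maN : measurable_fun ([set` `[0, 1[] : set mR) (fun x => (2 * a ^+ 2)%:E * (N x * N x))%E.
  exact: measurable_funeM.
have mmH : measurable_fun ([set` `[0, 1[] : set mR) (fun x => (2 * m ^+ 2)%:E * (H x * H x))%E.
  exact: measurable_funeM.
apply: (@le_trans _ _ (\int[mu]_(x in `[0%R, 1%R[)
    ((2 * a ^+ 2)%:E * (N x * N x) + (2 * m ^+ 2)%:E * (H x * H x)))%E).
  apply: ge0_le_integral => //.
  - by move=> x _; rewrite lee_fin sqr_ge0.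
  - by apply: measurable_funTS; apply/measurable_EFinP; exact: measurable_funX.
  - exact: emeasurable_funD.
rewrite ge0_integralD//; last 2 first.
- by move=> x _; exact: mule_ge0.
- by move=> x _; exact: mule_ge0.
rewrite !ge0_integralZl_EFin//.
have I2 : (\int[mu]_(x in `[0%R, 1%R[) (f x ^+ 2)%:E = \int[mu]_(x in `[0%R, 1%R[) (du x ^+ 2)%:E)%E.
  by apply: eq_integral => x _; rewrite /f real_normK// num_real.
have S1 := schur_decay m2 e0 mf f0 pf.
have S2 := schur_hardy e0 d0 dlip pd md mf f0 pf.
rewrite I2 in S1 S2.
set I := (\int[mu]_(x in _) (du x ^+ 2)%:E)%E.
have I0 : (0 <= I)%E by apply: integral_ge0 => x _; rewrite lee_fin sqr_ge0.
apply: (@le_trans _ _ ((2 * a ^+ 2)%:E * (((2 * (eps `^ (2 - m) / (m - 2))) ^+ 2)%:E * I) +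
   (2 * m ^+ 2)%:E * ((4 * (4 * 3 `^ (3 / 2)))%:E * I))%E).
  by apply: leeD; apply: lee_wpmul2l => //; rewrite lee_fin mulr_ge0// sqr_ge0.
rewrite !muleA -ge0_muleDl; last 2 first.
- by rewrite mule_ge0 ?lee_fin ?sqr_ge0.
- by rewrite mule_ge0 ?lee_fin // !mulr_ge0 ?powR_ge0.
rewrite -!EFinM -EFinD le_eqVlt; apply/predU1P; left; congr (_%:E * _)%E.
(* The power of [eps] in the pointwise bound is inverse to the one in the Schur norm, which makes
   the constant independent of [eps]. *)
have ee : eps `^ (m - 2) * eps `^ (2 - m) = 1.
  rewrite -powRD; last by apply/implyP => _; rewrite gt_eqF.
  by rewrite (_ : m - 2 + (2 - m) = 0) ?powRr0//; ring.
have m20 : m - 2 != 0 by rewrite gt_eqF// subr_gt0.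
rewrite mulrDr (mulrA 2 (m ^+ 2)); congr (_ + _).
have aE : a * (2 * (eps `^ (2 - m) / (m - 2))) = 4 * m / (m - 2).
  transitivity (4 * m * (eps `^ (m - 2) * eps `^ (2 - m)) / (m - 2)); last by rewrite ee mulr1.
  by rewrite /a; field.
by rewrite -aE [in RHS](exprMn _ a) -(mulrA 2 (a ^+ 2)).
Qed.

End Main.

Theorem proposition6p1 (R : realType) (m : R) (hm : 2 < m) :
  exists K : R, 0 < K /\
    forall u : R -> R,
      torus_Lp 1%E u ->
      torus_H1 u^\+ ->
      torus_Lp +oo%E u^\+ ->
    forall du : R -> R, is_weak_derivative u^\+ du ->
    forall c eps : R, 0 < c -> 0 < eps ->
    let u_eps := torus_convolution (torus_kernel m eps) u in
    exists w : R -> R,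
      is_weak_derivative (fun x => u_eps x - c)^\+ w /\
      (torus_Lnorm 2%:E w <=
         K%:E * (torus_Lnorm +oo (u^\+)%R * (c^-1)%:E) * torus_Lnorm 2%:E du)%E.
Proof.
have m1 : 1 < m by apply: lt_trans hm; rewrite ltr1n.
have m0 : 0 < m by exact: lt_trans ltr01 m1.
(* A constant for squared norms: the outer 2 is from [(A + B)^2 <= 2 (A^2 + B^2)], [4 m / (m - 2)]
   is the norm bound of the decay term, and [m^2] multiplies the two Schur constants of the Hardy
   kernel. *)
set K2 := 2 * ((4 * m / (m - 2)) ^+ 2 + m ^+ 2 * (4 * (4 * 3 `^ (3 / 2)))).
have K20 : 0 < K2.
  by rewrite mulr_gt0// ltr_wpDl ?sqr_ge0// !mulr_gt0// ?exprn_gt0// powR_gt0.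
exists (Num.sqrt K2); split; first by rewrite sqrtr_gt0.
move=> u /torus_Lp1P[pu mu' iu] _ _ du wdu c eps c0 e0 u_eps.
have [w [ww mw w_supp wL2]] := weak_derivative_conv_pos_part hm e0 c0 pu mu' iu wdu.
exists w; split=> //.
have [_ /torus_Lp1P[_ mdu _] _] := wdu.
have N2 := torus_Lnorm2_le (ltW K20) mw mdu wL2.
have M0 : (0 <= torus_Lnorm +oo (u^\+)%R)%E by exact: Lnorm_ge0.
have D0 : (0 <= torus_Lnorm 2%:E du)%E by exact: Lnorm_ge0.
have [[x /w_supp cu]|w0] := pselect (exists x, w x != 0).
  apply: (le_trans N2); apply: lee_wpmul2r => //.
  rewrite -[leLHS]mule1; apply: lee_wpmul2l; first by rewrite lee_fin sqrtr_ge0.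
  rewrite -lee_pdivrMr ?invr_gt0// invrK mul1e.
  apply: (@le_trans _ _ (u_eps x)%:E); first by rewrite lee_fin ltW.
  by rewrite /u_eps torus_convolutionE//; exact: line_conv_le_Lnormoo.
(* This case includes every [c] larger than the sup norm, for which the ratio is below 1 and gives
   no help. *)
have -> : w = fun=> 0.
  by apply/funext => x; apply/eqP/negPn/negP => wx; apply: w0; exists x.
rewrite (_ : torus_Lnorm 2%:E (fun=> 0) = 0%E).
  by rewrite !mule_ge0// lee_fin ?sqrtr_ge0// invr_ge0 ltW.
by rewrite /torus_Lnorm Lnorm0.
Qed.
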